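(* Assume that: (a) $\mathcal{F}$ is a Fréchet space of real and even entire maps that contains all real and even polynomial maps and whose topology is finer than the topology of local uniform convergence on $\mathbb{C}$; (b) $E$ is a countable dense subset of $\mathbb{C}$ that is symmetric with respect to the real axis and the imaginary axis, and such that $E\cap(\mathbb{R}\cup i\mathbb{R})$ is dense in $\mathbb{R}\cup i\mathbb{R}$; (c) $\Lambda$ is a dense subset of $\mathbb{C}$ that is symmetric with respect to the real axis and such that $\Lambda\cap\mathbb{R}$ is dense in $\mathbb{R}$. Then the set of $f\in\mathcal{F}$ such that $f^{-1}(E)=E$, every periodic point of $f$ lies in $E$, and the multiplier of $f$ at each of its cycles lies in $\Lambda$, is dense in $\mathcal{F}$.
   Context: An entire map $f$ is real if $f(\bar z)=\overline{f(z)}$ for all $z$, and even if $f(-z)=f(z)$ for all $z$. For a cycle $\{z,\dots,f^{\circ(n-1)}(z)\}$ of exact period $n$, the multiplier of $f$ at this cycle is $(f^{\circ n})'(z)$. *)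

(* Defs.v *)
From Stdlib Require Import Reals.
From Coquelicot Require Import Coquelicot.
Open Scope R_scope.

Notation CC := Complex.C.

Definition entire (f : CC -> CC) : Prop :=
  forall z : CC, @ex_derive C_AbsRing C_NormedModule f z.

Definition real_map (f : CC -> CC) : Prop :=
  forall z : CC, f (Cconj z) = Cconj (f z).

Definition even_map (f : CC -> CC) : Prop :=
  forall z : CC, f (Copp z) = f z.

Fixpoint poly_map (c : list CC) (z : CC) : CC :=
  match c with
  | nil => RtoC 0
  | cons a c' => Cplus a (Cmult z (poly_map c' z))
  end.

Definition fzero : CC -> CC := fun _ => RtoC 0.
Definition fadd (f g : CC -> CC) : CC -> CC := fun z => Cplus (f z) (g z).
Definition fscal (a : R) (f : CC -> CC) : CC -> CC := fun z => Cmult (RtoC a) (f z).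
Definition fsub (f g : CC -> CC) : CC -> CC := fun z => Cminus (f z) (g z).

(* F is a Frechet space (over R) of real and even entire maps, its topology
   being given by the countable family of seminorms (p k)_k:
   - F is a real vector subspace of real even entire maps,
   - each p k is a seminorm on F,
   - the family separates points (Hausdorff / metrizable),
   - F is complete for the induced (metrizable, locally convex) uniformity. *)
Definition frechet_real_even_entire (F : (CC -> CC) -> Prop)
    (p : nat -> (CC -> CC) -> R) : Prop :=
  (forall f, F f -> entire f /\ real_map f /\ even_map f) /\
  F fzero /\
  (forall f g, F f -> F g -> F (fadd f g)) /\
  (forall a f, F f -> F (fscal a f)) /\
  (forall k f, F f -> 0 <= p k f) /\
  (forall k f g, F f -> F g -> p k (fadd f g) <= p k f + p k g) /\
  (forall k a f, F f -> p k (fscal a f) = Rabs a * p k f) /\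
  (forall f, F f -> (forall k, p k f = 0) -> forall z, f z = RtoC 0) /\
  (forall u : nat -> CC -> CC, (forall j, F (u j)) ->
     (forall k eps, 0 < eps -> exists N, forall i j, (N <= i)%nat -> (N <= j)%nat ->
         p k (fsub (u i) (u j)) < eps) ->
     exists f, F f /\
       forall k eps, 0 < eps -> exists N, forall j, (N <= j)%nat ->
         p k (fsub (u j) f) < eps).

(* The topology of F is finer than local uniform convergence on C:
   every neighbourhood of 0 for local uniform convergence contains a
   neighbourhood of 0 of the seminorm topology (the inclusion is continuous). *)
Definition finer_than_local_uniform (F : (CC -> CC) -> Prop)
    (p : nat -> (CC -> CC) -> R) : Prop :=
  forall r eps, 0 < r -> 0 < eps ->
    exists n delta, 0 < delta /\
      forall f, F f -> (forall k, (k <= n)%nat -> p k f < delta) ->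
        forall z, Cmod z <= r -> Cmod (f z) < eps.

Definition countable_set (E : CC -> Prop) : Prop :=
  exists g : nat -> CC, forall z, E z -> exists n, g n = z.

Definition dense_in (A S : CC -> Prop) : Prop :=
  forall z eps, S z -> 0 < eps -> exists w, A w /\ S w /\ Cmod (Cminus w z) < eps.

Definition whole_plane : CC -> Prop := fun _ => True.
Definition real_line : CC -> Prop := fun z => Im z = 0.
Definition real_union_imag : CC -> Prop := fun z => Im z = 0 \/ Re z = 0.

Definition exact_period (f : CC -> CC) (n : nat) (z : CC) : Prop :=
  (1 <= n)%nat /\ Nat.iter n f z = z /\
  forall m, (1 <= m)%nat -> (m < n)%nat -> Nat.iter m f z <> z.

Definition periodic_point (f : CC -> CC) (z : CC) : Prop :=
  exists n, (1 <= n)%nat /\ Nat.iter n f z = z.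

Definition is_multiplier (f : CC -> CC) (n : nat) (z l : CC) : Prop :=
  @is_derive C_AbsRing C_NormedModule (Nat.iter n f) z l.

Definition good_map (E Lam : CC -> Prop) (f : CC -> CC) : Prop :=
  (forall z, E (f z) <-> E z) /\
  (forall z, periodic_point f z -> E z) /\
  (forall n z, exact_period f n z -> exists l, is_multiplier f n z l /\ Lam l).

(* Main.v *)
(* Starting from f, small real even polynomials are added one after the other, each divisible by high powers of
   (z^2 - a^2)(z^2 - conj a^2) for every node a already fixed. At a node the value and the derivative never change
   again. Three kinds of requirements are met in turn: a point of E becomes a node with value in E; all preimages in a
   disc of a point e of E become nodes; all solutions of f^n(z) = z in a disc lie on cycles of nodes, with multipliers
   in Lambda off the unit circle. For the last two, let Phi be f - e or f^n - id. An unpinned zero of Phi is moved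
   into E by interpolation, and Jensen's bound on the number of zeros, uniform near f, stops this after finitely many
   steps. Then Phi = P u on the disc, with u zero-free and all roots of P pinned. A later perturbation changes Phi by
   P v with v small, by the mean value property, so |Phi| >= d |P| persists, also in the limit: no Rouche argument is
   needed.

   A real cycle can only move along the real axis, and a non-real cycle invariant under conjugation has multiplier
   |D|^2, where D is the derivative along half of it, so these cycles need the density of Lambda in the real line. No
   cycle of nodes meets the critical point 0, because the nodes on a new cycle are chosen different from 0 and no other
   step closes a cycle. *)
Require Import Defs.
From Stdlib Require Import Reals.
From Coquelicot Require Import Coquelicot.
From Stdlib Require Import Lra Lia Psatz ClassicalEpsilon FunctionalExtensionality List Cantor.
Open Scope R_scope.

(** * Complex derivatives *)

(** A real even map takes equal or conjugate values at a, -a, conj a, -conj a, and real values on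
    both axes. So values can be prescribed only at points not related in this way, with real data on
    the axes, and points on the axes must be moved within the axes. The derivative at 0 is always 0,
    which need not lie in Lambda; this is why cycles avoid 0. New points and values in E are picked
    only after a bound on the perturbation is fixed, so interpolation needs constants uniform in the
    position of the points. Multipliers avoid the whole unit circle, not only 1, because the zeros
    of f^n - id have to be simple for every multiple n of the period. Then any change of f^n - id
    that vanishes at these zeros is divisible by P, although it is not linear in the perturbation of
    f. The zeros of f - e may be multiple; there high orders of vanishing give the division. The
    condition f(0) <> f(1), kept throughout, makes f - e nonzero somewhere in the unit disc, as
    Jensen's bound requires; for f^n - id evenness is enough, since 1 and -1 have the same image. *)

Ltac below_min :=
  solve [ apply Rle_refl
        | eapply Rle_trans; [apply Rmin_l | below_min]
        | eapply Rle_trans; [apply Rmin_r | below_min] ].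

Definition ccont (f : CC -> CC) (z : CC) : Prop :=
  forall eps, 0 < eps -> exists d, 0 < d /\
    forall w, Cmod (w - z) < d -> Cmod (f w - f z) < eps.

(** Equivalent to [is_derive] over both module structures on C, so that rules stated over the one
    and over the other can be combined. *)
Definition cder (f : CC -> CC) (z l : CC) : Prop :=
  forall eps, 0 < eps -> exists d, 0 < d /\
    forall w, Cmod (w - z) < d -> Cmod (f w - f z - l * (w - z)) <= eps * Cmod (w - z).

Lemma cder_is_derive f z l :
  cder f z l <-> @is_derive C_AbsRing C_NormedModule f z l.
Proof.
  split.
  - intros H. split.
    + apply (is_linear_scal_l (K := C_AbsRing) (V := C_NormedModule)).
    + intros x Hx.
      assert (x = z) as ->.
      { symmetry. apply is_filter_lim_locally_unique. exact Hx. }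
      intros eps. destruct (H eps (cond_pos eps)) as [d [Hd Hb]].
      exists (mkposreal d Hd). intros w Hw.
      specialize (Hb w Hw).
      change (Cmod (f w - f z - (w - z) * l) <= eps * Cmod (w - z)).
      rewrite (Cmult_comm (w - z) l). exact Hb.
  - intros [_ H] eps Heps.
    destruct (H z (fun P HP => HP) (mkposreal eps Heps)) as [d Hd].
    exists d. split. apply cond_pos.
    intros w Hw. specialize (Hd w Hw).
    change (Cmod (f w - f z - (w - z) * l) <= eps * Cmod (w - z)) in Hd.
    rewrite (Cmult_comm l). exact Hd.
Qed.

Lemma cder_is_derive_ring f z l :
  cder f z l <-> @is_derive C_AbsRing (AbsRing_NormedModule C_AbsRing) f z l.
Proof.
  split.
  - intros H. split.
    + apply (is_linear_scal_l (K := C_AbsRing) (V := AbsRing_NormedModule C_AbsRing)).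
    + intros x Hx.
      assert (x = z) as ->.
      { symmetry. apply is_filter_lim_locally_unique. exact Hx. }
      intros eps. destruct (H eps (cond_pos eps)) as [d [Hd Hb]].
      exists (mkposreal d Hd). intros w Hw.
      specialize (Hb w Hw).
      change (Cmod (f w - f z - (w - z) * l) <= eps * Cmod (w - z)).
      rewrite (Cmult_comm (w - z) l). exact Hb.
  - intros [_ H] eps Heps.
    destruct (H z (fun P HP => HP) (mkposreal eps Heps)) as [d Hd].
    exists d. split. apply cond_pos.
    intros w Hw. specialize (Hd w Hw).
    change (Cmod (f w - f z - (w - z) * l) <= eps * Cmod (w - z)) in Hd.
    rewrite (Cmult_comm l). exact Hd.
Qed.

Lemma Cmod_minus_sym (a b : CC) : Cmod (a - b) = Cmod (b - a).
Proof. replace (a - b)%C with (- (b - a))%C by ring. apply Cmod_opp. Qed.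

Lemma Cmod_sub_le (a b : CC) : Cmod (a - b) <= Cmod a + Cmod b.
Proof.
  unfold Cminus. eapply Rle_trans. apply Cmod_triangle. rewrite Cmod_opp. lra.
Qed.

Lemma Cmod_sub_ge (a b : CC) : Cmod a - Cmod b <= Cmod (a - b).
Proof.
  replace (Cmod a) with (Cmod ((a - b) + b)) by (f_equal; ring).
  pose proof (Cmod_triangle (a - b) b). lra.
Qed.

Lemma Cmod_le_via (a b c : CC) : Cmod (a - c) <= Cmod (a - b) + Cmod (b - c).
Proof. replace (a - c)%C with ((a - b) + (b - c))%C by ring. apply Cmod_triangle. Qed.

Lemma Im_le_Cmod (c : CC) : Rabs (Im c) <= Cmod c.
Proof.
  replace (Rabs (Im c)) with (Rabs (Re (- (c * Ci)))).
  - eapply Rle_trans. apply re_le_Cmod. rewrite Cmod_opp, Cmod_mult.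
    replace (Cmod Ci) with 1. lra.
    unfold Cmod, Ci; simpl. replace (_ + _) with 1 by ring. now rewrite sqrt_1.
  - rewrite re_opp, re_mult_Ci. f_equal. ring.
Qed.

Lemma Cmod_le_Re_Im (c : CC) : Cmod c <= Rabs (Re c) + Rabs (Im c).
Proof.
  unfold Cmod. apply Rsqr_incr_0_var.
  - rewrite Rsqr_sqrt. 2: nra.
    destruct c as [x y]; simpl.
    pose proof (Rabs_pos x); pose proof (Rabs_pos y).
    assert (x * x = Rabs x * Rabs x) by (rewrite <- Rabs_mult, Rabs_pos_eq; nra).
    assert (y * y = Rabs y * Rabs y) by (rewrite <- Rabs_mult, Rabs_pos_eq; nra).
    unfold Rsqr. nra.
  - pose proof (Rabs_pos (Re c)); pose proof (Rabs_pos (Im c)). lra.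
Qed.

Lemma C_ext (a b : CC) : Re a = Re b -> Im a = Im b -> a = b.
Proof. destruct a, b; simpl; intros -> ->; reflexivity. Qed.

Lemma Cmod_pos_neq (a b : CC) : a <> b -> 0 < Cmod (a - b).
Proof. intros H. apply -> Cmod_gt_0. now apply Cminus_eq_contra. Qed.

Lemma Cmod_self (a : CC) : Cmod (a - a) = 0.
Proof. replace (a - a)%C with (RtoC 0) by ring. apply Cmod_0. Qed.

Lemma cder_ccont f z l : cder f z l -> ccont f z.
Proof.
  intros H eps Heps. destruct (H 1 Rlt_0_1) as [d [Hd Hb]].
  set (K := 1 + Cmod l + 1).
  assert (0 < K) by (unfold K; pose proof (Cmod_ge_0 l); lra).
  exists (Rmin d (eps / K)). split.
  - apply Rmin_pos; [exact Hd | apply Rdiv_lt_0_compat; assumption].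
  - intros w Hw.
    assert (H1 : Cmod (w - z) < d) by (eapply Rlt_le_trans; [exact Hw | apply Rmin_l]).
    assert (H2 : Cmod (w - z) < eps / K) by (eapply Rlt_le_trans; [exact Hw | apply Rmin_r]).
    specialize (Hb w H1).
    replace (f w - f z)%C with ((f w - f z - l * (w - z)) + l * (w - z))%C by ring.
    eapply Rle_lt_trans. apply Cmod_triangle. rewrite Cmod_mult.
    apply (Rmult_lt_compat_r K) in H2; [|assumption].
    unfold Rdiv in H2. rewrite Rmult_assoc, Rinv_l, Rmult_1_r in H2 by lra.
    pose proof (Cmod_ge_0 (w - z)). unfold K in H2. nra.
Qed.

Lemma cder_unique f z l1 l2 : cder f z l1 -> cder f z l2 -> l1 = l2.
Proof.
  intros H1 H2. apply cder_is_derive, is_C_derive_unique in H1.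
  apply cder_is_derive, is_C_derive_unique in H2. congruence.
Qed.

Lemma cder_ext_loc (f g : CC -> CC) (z l : CC) (d : R) : 0 < d ->
  (forall w, Cmod (w - z) < d -> f w = g w) -> cder f z l -> cder g z l.
Proof.
  intros Hd E H eps Heps. destruct (H eps Heps) as [d' [Hd' Hb]].
  exists (Rmin d d'). split. now apply Rmin_pos.
  intros w Hw. rewrite <- E, <- E. apply Hb.
  - eapply Rlt_le_trans; [exact Hw | apply Rmin_r].
  - rewrite Cmod_self. exact Hd.
  - eapply Rlt_le_trans; [exact Hw | apply Rmin_l].
Qed.

Lemma cder_ext (f g : CC -> CC) (z l : CC) : (forall w, f w = g w) -> cder f z l -> cder g z l.
Proof. intros E. apply cder_ext_loc with 1. lra. intros; apply E. Qed.

Lemma cder_const c z : cder (fun _ => c) z 0.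
Proof.
  apply cder_is_derive. apply (@is_derive_const C_AbsRing C_NormedModule).
Qed.

Lemma cder_id z : cder (fun w => w) z 1.
Proof. apply cder_is_derive_ring. apply (@is_derive_id C_AbsRing). Qed.

Lemma cder_plus (f g : CC -> CC) (z a b : CC) :
  cder f z a -> cder g z b -> cder (fun w => (f w + g w)%C) z (a + b).
Proof.
  rewrite !cder_is_derive. apply (@is_derive_plus C_AbsRing C_NormedModule).
Qed.

Lemma cder_minus (f g : CC -> CC) (z a b : CC) :
  cder f z a -> cder g z b -> cder (fun w => (f w - g w)%C) z (a - b).
Proof.
  rewrite !cder_is_derive. apply (@is_derive_minus C_AbsRing C_NormedModule).
Qed.

Lemma cder_mult (f g : CC -> CC) (z a b : CC) :
  cder f z a -> cder g z b -> cder (fun w => (f w * g w)%C) z (a * g z + f z * b).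
Proof.
  rewrite !cder_is_derive_ring. intros H1 H2.
  apply (@is_derive_mult C_AbsRing f g z a b H1 H2). exact Cmult_comm.
Qed.

Lemma cder_comp (f g : CC -> CC) (z a b : CC) :
  cder f (g z) a -> cder g z b -> cder (fun w => f (g w)) z (a * b).
Proof.
  rewrite (cder_is_derive f), (cder_is_derive_ring g), cder_is_derive. intros H1 H2. rewrite Cmult_comm.
  exact (@is_derive_comp C_AbsRing C_NormedModule f g z a b H1 H2).
Qed.

Lemma cder_inv (z : CC) : z <> 0 -> cder Cinv z (- (/ z * / z)).
Proof.
  intros Hz eps Heps.
  assert (Hm : 0 < Cmod z) by (apply -> Cmod_gt_0; assumption).
  set (m := Cmod z) in *.
  (* The error is (w - z)^2 / (w z^2). The first radius gives |w| >= m / 2, so the error is at most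
     2 |w - z|^2 / m^3; the second radius makes this at most eps |w - z|. *)
  exists (Rmin (m / 2) (eps * (m * m * m) / 2)). split.
  { apply Rmin_pos. lra. apply Rdiv_lt_0_compat; [|lra].
    apply Rmult_lt_0_compat; [exact Heps|]. repeat apply Rmult_lt_0_compat; assumption. }
  intros w Hw.
  assert (H1 : Cmod (w - z) < m / 2) by (eapply Rlt_le_trans; [exact Hw | apply Rmin_l]).
  assert (H2 : Cmod (w - z) < eps * (m * m * m) / 2) by (eapply Rlt_le_trans; [exact Hw | apply Rmin_r]).
  assert (Hwm : m / 2 <= Cmod w).
  { pose proof (Cmod_sub_ge z (z - w)). replace (z - (z - w))%C with w in H by ring.
    rewrite Cmod_minus_sym in H1. fold m in H. lra. }
  assert (Hw0 : w <> 0) by (apply <- Cmod_gt_0; lra).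
  replace (/ w - / z - - (/ z * / z) * (w - z))%C
    with ((w - z) * (w - z) * (/ w * / z * / z))%C by (field; split; assumption).
  rewrite !Cmod_mult, !Cmod_inv by assumption. fold m.
  set (t := Cmod (w - z)) in *. set (n := Cmod w) in *.
  assert (0 <= t) by apply Cmod_ge_0.
  replace (t * t * (/ n * / m * / m)) with ((t * (/ n * / m * / m)) * t) by ring.
  apply Rmult_le_compat_r; [assumption|].
  assert (/ n <= 2 / m).
  { replace (2 / m) with (/ (m / 2)) by (field; lra). apply Rinv_le_contravar; lra. }
  apply Rle_trans with (t * (2 / m * / m * / m)).
  - apply Rmult_le_compat_l; [assumption|].
    assert (0 < / m) by (apply Rinv_0_lt_compat; lra).
    apply Rmult_le_compat_r; [lra|]. apply Rmult_le_compat_r; lra.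
  - apply Rmult_le_reg_r with (m * m * m). repeat apply Rmult_lt_0_compat; lra.
    replace (t * (2 / m * / m * / m) * (m * m * m)) with (2 * t) by (field; lra). lra.
Qed.

Lemma cder_div (f g : CC -> CC) (z a b : CC) : g z <> 0 ->
  cder f z a -> cder g z b -> exists l, cder (fun w => (f w / g w)%C) z l.
Proof.
  intros Hg Hf Hgd. eexists. unfold Cdiv. apply cder_mult. exact Hf.
  apply (cder_comp Cinv g). apply cder_inv; exact Hg. exact Hgd.
Qed.

Definition cdiff (f : CC -> CC) (z : CC) : Prop := exists l, cder f z l.

Lemma entire_cdiff f : entire f <-> forall z, cdiff f z.
Proof.
  split; intros H z; destruct (H z) as [l Hl]; exists l; apply cder_is_derive; exact Hl.
Qed.

Lemma entire_ccont f z : entire f -> ccont f z.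
Proof. intros H. apply entire_cdiff with (z := z) in H. destruct H as [l H]. eapply cder_ccont; eauto. Qed.

Lemma entire_const c : entire (fun _ => c).
Proof. apply entire_cdiff. intros z. eexists. apply cder_const. Qed.

Lemma entire_id : entire (fun z => z).
Proof. apply entire_cdiff. intros z. eexists. apply cder_id. Qed.

Lemma entire_plus (f g : CC -> CC) : entire f -> entire g -> entire (fun z => (f z + g z)%C).
Proof.
  rewrite !entire_cdiff. intros H1 H2 z. destruct (H1 z), (H2 z). eexists. apply cder_plus; eauto.
Qed.

Lemma entire_minus (f g : CC -> CC) : entire f -> entire g -> entire (fun z => (f z - g z)%C).
Proof.
  rewrite !entire_cdiff. intros H1 H2 z. destruct (H1 z), (H2 z). eexists. apply cder_minus; eauto.
Qed.

Lemma entire_mult (f g : CC -> CC) : entire f -> entire g -> entire (fun z => (f z * g z)%C).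
Proof.
  rewrite !entire_cdiff. intros H1 H2 z. destruct (H1 z), (H2 z). eexists. apply cder_mult; eauto.
Qed.

Lemma entire_comp (f g : CC -> CC) : entire f -> entire g -> entire (fun z => f (g z)).
Proof.
  rewrite !entire_cdiff. intros H1 H2 z. destruct (H1 (g z)), (H2 z). eexists. eapply cder_comp; eauto.
Qed.

Lemma entire_iter f n : entire f -> entire (Nat.iter n f).
Proof.
  intros H. induction n. apply entire_id. exact (entire_comp f (Nat.iter n f) H IHn).
Qed.

(** * Integrals of complex-valued functions of a real variable *)

Definition CInt (u : R -> CC) (a b : R) : CC :=
  (RInt (fun t => Re (u t)) a b, RInt (fun t => Im (u t)) a b).

Definition rcont (u : R -> CC) : Prop :=
  forall t, continuous (fun t => Re (u t)) t /\ continuous (fun t => Im (u t)) t.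

Lemma rcont_eps (u : R -> CC) :
  (forall t eps, 0 < eps -> exists d, 0 < d /\
     forall s, Rabs (s - t) < d -> Cmod (u s - u t) < eps) -> rcont u.
Proof.
  intros H t. split; apply filterlim_locally; intros eps;
    destruct (H t eps (cond_pos eps)) as [d [Hd Hb]]; exists (mkposreal d Hd); intros s Hs;
    specialize (Hb s Hs);
    [ change (Rabs (Re (u s) - Re (u t)) < eps) | change (Rabs (Im (u s) - Im (u t)) < eps)];
    eapply Rle_lt_trans; [| exact Hb | | exact Hb].
  - apply (re_le_Cmod (u s - u t)).
  - apply (Im_le_Cmod (u s - u t)).
Qed.

Lemma rcont_eps_inv (u : R -> CC) : rcont u ->
  forall t eps, 0 < eps -> exists d, 0 < d /\
     forall s, Rabs (s - t) < d -> Cmod (u s - u t) < eps.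
Proof.
  intros H t eps Heps. destruct (H t) as [H1 H2].
  assert (He2 : 0 < eps / 2) by lra.
  apply filterlim_locally with (eps := mkposreal _ He2) in H1.
  apply filterlim_locally with (eps := mkposreal _ He2) in H2.
  destruct H1 as [d1 H1]. destruct H2 as [d2 H2].
  exists (Rmin d1 d2). split. apply Rmin_pos; apply cond_pos.
  intros s Hs.
  specialize (H1 s (Rlt_le_trans _ _ _ Hs (Rmin_l _ _))).
  specialize (H2 s (Rlt_le_trans _ _ _ Hs (Rmin_r _ _))).
  change (Rabs (Re (u s) - Re (u t)) < eps / 2) in H1.
  change (Rabs (Im (u s) - Im (u t)) < eps / 2) in H2.
  eapply Rle_lt_trans. apply Cmod_le_Re_Im.
  change (Rabs (Re (u s) - Re (u t)) + Rabs (Im (u s) - Im (u t)) < eps). lra.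
Qed.

Lemma rcont_comp (f : CC -> CC) (u : R -> CC) :
  (forall t, ccont f (u t)) -> rcont u -> rcont (fun t => f (u t)).
Proof.
  intros Hf Hu. apply rcont_eps. intros t eps Heps.
  destruct (Hf t eps Heps) as [d [Hd Hb]].
  destruct (rcont_eps_inv u Hu t d Hd) as [d' [Hd' Hb']].
  exists d'. split; auto.
Qed.

Lemma rcont_const c : rcont (fun _ => c).
Proof. intros t; split; apply continuous_const. Qed.

Lemma rcont_plus (u v : R -> CC) : rcont u -> rcont v -> rcont (fun t => (u t + v t)%C).
Proof.
  intros Hu Hv t. destruct (Hu t), (Hv t). split.
  - apply (continuous_plus (fun t => Re (u t)) (fun t => Re (v t))); assumption.
  - apply (continuous_plus (fun t => Im (u t)) (fun t => Im (v t))); assumption.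
Qed.

Lemma rcont_minus (u v : R -> CC) : rcont u -> rcont v -> rcont (fun t => (u t - v t)%C).
Proof.
  intros Hu Hv t. destruct (Hu t), (Hv t). split.
  - apply (continuous_minus (fun t => Re (u t)) (fun t => Re (v t))); assumption.
  - apply (continuous_minus (fun t => Im (u t)) (fun t => Im (v t))); assumption.
Qed.

Lemma rcont_mult (u v : R -> CC) : rcont u -> rcont v -> rcont (fun t => (u t * v t)%C).
Proof.
  intros Hu Hv t. destruct (Hu t), (Hv t). split.
  - apply (continuous_minus (fun t => Re (u t) * Re (v t)) (fun t => Im (u t) * Im (v t)));
    apply (continuous_mult (K := R_AbsRing)); assumption.
  - apply (continuous_plus (fun t => Re (u t) * Im (v t)) (fun t => Im (u t) * Re (v t)));
    apply (continuous_mult (K := R_AbsRing)); assumption.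
Qed.

Lemma ex_RInt_Re (u : R -> CC) a b : rcont u -> ex_RInt (fun t => Re (u t)) a b.
Proof. intros H. apply (ex_RInt_continuous (V := R_CompleteNormedModule)). intros t _. apply (H t). Qed.

Lemma ex_RInt_Im (u : R -> CC) a b : rcont u -> ex_RInt (fun t => Im (u t)) a b.
Proof. intros H. apply (ex_RInt_continuous (V := R_CompleteNormedModule)). intros t _. apply (H t). Qed.

Lemma CInt_ext (u v : R -> CC) (a b : R) : (forall t, u t = v t) -> CInt u a b = CInt v a b.
Proof. intros H. unfold CInt. f_equal; apply RInt_ext; intros; rewrite H; reflexivity. Qed.

Lemma CInt_minus (u v : R -> CC) (a b : R) : rcont u -> rcont v ->
  CInt (fun t => (u t - v t)%C) a b = (CInt u a b - CInt v a b)%C.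
Proof.
  intros Hu Hv. apply C_ext; simpl.
  - apply (RInt_minus (V := R_CompleteNormedModule)); apply ex_RInt_Re; assumption.
  - apply (RInt_minus (V := R_CompleteNormedModule)); apply ex_RInt_Im; assumption.
Qed.

Lemma CInt_scal (c : CC) (u : R -> CC) a b : rcont u ->
  CInt (fun t => (c * u t)%C) a b = (c * CInt u a b)%C.
Proof.
  intros Hu. pose proof (ex_RInt_Re u a b Hu) as H1. pose proof (ex_RInt_Im u a b Hu) as H2.
  assert (S : forall k f, ex_RInt f a b -> ex_RInt (fun t => k * f t) a b /\
     RInt (fun t => k * f t) a b = k * RInt f a b).
  { intros k f Hf. split.
    - apply (ex_RInt_scal (V := R_NormedModule) f a b k Hf).
    - apply (RInt_scal (V := R_CompleteNormedModule) f a b k Hf). }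
  destruct (S (Re c) _ H1) as [A1 B1]. destruct (S (Im c) _ H1) as [A2 B2].
  destruct (S (Re c) _ H2) as [A3 B3]. destruct (S (Im c) _ H2) as [A4 B4].
  apply C_ext; simpl.
  - etransitivity. apply (RInt_minus (V := R_CompleteNormedModule) _ _ a b A1 A4).
    rewrite B1, B4. reflexivity.
  - etransitivity. apply (RInt_plus (V := R_CompleteNormedModule) _ _ a b A3 A2).
    rewrite B3, B2. reflexivity.
Qed.

Lemma CInt_Chasles (u : R -> CC) a b c : rcont u -> (CInt u a b + CInt u b c)%C = CInt u a c.
Proof.
  intros Hu. apply C_ext; simpl.
  - apply (RInt_Chasles (V := R_CompleteNormedModule)); apply ex_RInt_Re; assumption.
  - apply (RInt_Chasles (V := R_CompleteNormedModule)); apply ex_RInt_Im; assumption.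
Qed.

Lemma CInt_point (u : R -> CC) a : CInt u a a = 0.
Proof. unfold CInt. rewrite !RInt_point. reflexivity. Qed.

Lemma CInt_swap (u : R -> CC) a b : rcont u -> CInt u b a = (- CInt u a b)%C.
Proof.
  intros H. assert (E := CInt_Chasles u a b a H). rewrite CInt_point in E.
  replace (CInt u b a) with ((CInt u a b + CInt u b a) - CInt u a b)%C by ring.
  rewrite E. ring.
Qed.

(** Real and imaginary parts are bounded separately, hence the factor 2, which all later estimates
    can afford. *)
Lemma CInt_bound (u : R -> CC) a b M : rcont u ->
  (forall t, Rmin a b <= t <= Rmax a b -> Cmod (u t) <= M) ->
  Cmod (CInt u a b) <= 2 * M * Rabs (b - a).
Proof.
  assert (S : forall a b, a <= b -> rcont u -> (forall t, a <= t <= b -> Cmod (u t) <= M) ->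
    Cmod (CInt u a b) <= 2 * M * (b - a)).
  { clear a b. intros a b Hab Hu HM. eapply Rle_trans. apply Cmod_le_Re_Im. simpl.
    assert (Rabs (RInt (fun t => Re (u t)) a b) <= (b - a) * M).
    { apply abs_RInt_le_const; auto using ex_RInt_Re.
      intros t Ht. eapply Rle_trans. apply re_le_Cmod. auto. }
    assert (Rabs (RInt (fun t => Im (u t)) a b) <= (b - a) * M).
    { apply abs_RInt_le_const; auto using ex_RInt_Im.
      intros t Ht. eapply Rle_trans. apply Im_le_Cmod. auto. }
    lra. }
  intros Hu HM. destruct (Rle_dec a b).
  - rewrite Rmin_left, Rmax_right in HM by assumption. rewrite Rabs_pos_eq by lra. auto.
  - rewrite Rmin_right, Rmax_left in HM by lra. rewrite Rabs_left1 by lra.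
    rewrite CInt_swap, Cmod_opp by assumption. replace (- (b - a)) with (a - b) by ring.
    apply S; auto. lra.
Qed.

Definition rder (u : R -> CC) (t : R) (l : CC) : Prop :=
  is_derive (fun t => Re (u t)) t (Re l) /\ is_derive (fun t => Im (u t)) t (Im l).

Lemma CInt_FTC (U u : R -> CC) a b : (forall t, rder U t (u t)) -> rcont u ->
  CInt u a b = (U b - U a)%C.
Proof.
  intros HU Hu. apply C_ext; simpl.
  - apply is_RInt_unique. eapply (is_RInt_derive (V := R_CompleteNormedModule) (fun t => Re (U t)) (fun t => Re (u t))).
    + intros t _. apply HU.
    + intros t _. apply Hu.
  - apply is_RInt_unique. eapply (is_RInt_derive (V := R_CompleteNormedModule) (fun t => Im (U t)) (fun t => Im (u t))).
    + intros t _. apply HU.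
    + intros t _. apply Hu.
Qed.

Lemma is_derive_eps (f : R -> R) t l :
  is_derive f t l <-> (forall eps, 0 < eps -> exists d, 0 < d /\
    forall s, Rabs (s - t) < d -> Rabs (f s - f t - l * (s - t)) <= eps * Rabs (s - t)).
Proof.
  split.
  - intros [_ H] eps Heps.
    destruct (H t (fun P HP => HP) (mkposreal eps Heps)) as [d Hd].
    exists d. split. apply cond_pos.
    intros w Hw. specialize (Hd w Hw).
    change (Rabs (f w - f t - (w - t) * l) <= eps * Rabs (w - t)) in Hd.
    rewrite (Rmult_comm l). exact Hd.
  - intros H. split.
    + apply (is_linear_scal_l (K := R_AbsRing) (V := R_NormedModule)).
    + intros x Hx.
      assert (x = t) as ->.
      { symmetry. apply is_filter_lim_locally_unique. exact Hx. }
      intros eps. destruct (H eps (cond_pos eps)) as [d [Hd Hb]].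
      exists (mkposreal d Hd). intros w Hw.
      specialize (Hb w Hw).
      change (Rabs (f w - f t - (w - t) * l) <= eps * Rabs (w - t)).
      rewrite (Rmult_comm (w - t) l). exact Hb.
Qed.

Lemma rder_eps (u : R -> CC) t (l : CC) :
  rder u t l <-> (forall eps, 0 < eps -> exists d, 0 < d /\
    forall s, Rabs (s - t) < d -> Cmod (u s - u t - l * RtoC (s - t)) <= eps * Rabs (s - t)).
Proof.
  assert (ER : forall s, Re (u s - u t - l * RtoC (s - t)) = Re (u s) - Re (u t) - Re l * (s - t)).
  { intros s; simpl; unfold Re; ring. }
  assert (EI : forall s, Im (u s - u t - l * RtoC (s - t)) = Im (u s) - Im (u t) - Im l * (s - t)).
  { intros s; simpl; unfold Im; ring. }
  unfold rder. rewrite !is_derive_eps. split.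
  - intros [H1 H2] eps Heps.
    destruct (H1 (eps / 2)) as [d1 [Hd1 B1]]. lra.
    destruct (H2 (eps / 2)) as [d2 [Hd2 B2]]. lra.
    exists (Rmin d1 d2). split. now apply Rmin_pos.
    intros s Hs.
    specialize (B1 s (Rlt_le_trans _ _ _ Hs (Rmin_l _ _))).
    specialize (B2 s (Rlt_le_trans _ _ _ Hs (Rmin_r _ _))).
    eapply Rle_trans. apply Cmod_le_Re_Im. rewrite ER, EI. lra.
  - intros H. split; intros eps Heps; destruct (H eps Heps) as [d [Hd B]]; exists d; split; auto;
      intros s Hs; specialize (B s Hs).
    + rewrite <- ER. eapply Rle_trans. apply re_le_Cmod. exact B.
    + rewrite <- EI. eapply Rle_trans. apply Im_le_Cmod. exact B.
Qed.

Lemma rder_bound (u : R -> CC) t (l : CC) : rder u t l ->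
  exists d, 0 < d /\ forall s, Rabs (s - t) < d -> Cmod (u s - u t) <= (Cmod l + 1) * Rabs (s - t).
Proof.
  intros H. destruct (proj1 (rder_eps u t l) H 1 Rlt_0_1) as [d [Hd B]].
  exists d. split; auto. intros s Hs. specialize (B s Hs).
  replace (u s - u t)%C with ((u s - u t - l * RtoC (s - t)) + l * RtoC (s - t))%C by ring.
  eapply Rle_trans. apply Cmod_triangle. rewrite Cmod_mult, Cmod_R. lra.
Qed.

Lemma rder_comp (G : CC -> CC) (u : R -> CC) t (l m : CC) :
  cder G (u t) l -> rder u t m -> rder (fun s => G (u s)) t (l * m)%C.
Proof.
  intros HG Hu. apply rder_eps. intros eps Heps.
  destruct (rder_bound u t m Hu) as [d0 [Hd0 B0]].
  set (K := Cmod m + 1) in *.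
  assert (HK : 0 < K) by (unfold K; pose proof (Cmod_ge_0 m); lra).
  set (L := Cmod l + 1).
  assert (HL : 0 < L) by (unfold L; pose proof (Cmod_ge_0 l); lra).
  destruct (HG (eps / (2 * K))) as [d1 [Hd1 B1]]. apply Rdiv_lt_0_compat; lra.
  destruct (proj1 (rder_eps u t m) Hu (eps / (2 * L))) as [d2 [Hd2 B2]]. apply Rdiv_lt_0_compat; lra.
  exists (Rmin d0 (Rmin (d1 / K) d2)). split.
  { repeat apply Rmin_pos; auto. now apply Rdiv_lt_0_compat. }
  intros s Hs.
  assert (S0 : Rabs (s - t) < d0) by (eapply Rlt_le_trans; [exact Hs|apply Rmin_l]).
  assert (S1 : Rabs (s - t) < d1 / K).
  { eapply Rlt_le_trans; [exact Hs|]. eapply Rle_trans. apply Rmin_r. apply Rmin_l. }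
  assert (S2 : Rabs (s - t) < d2).
  { eapply Rlt_le_trans; [exact Hs|]. eapply Rle_trans. apply Rmin_r. apply Rmin_r. }
  specialize (B0 s S0). specialize (B2 s S2).
  assert (S3 : Cmod (u s - u t) < d1).
  { eapply Rle_lt_trans. exact B0. apply (Rmult_lt_compat_l K) in S1; auto.
    replace (K * (d1 / K)) with d1 in S1 by (field; lra). exact S1. }
  specialize (B1 (u s) S3).
  replace (G (u s) - G (u t) - l * m * RtoC (s - t))%C with
    ((G (u s) - G (u t) - l * (u s - u t)) + l * (u s - u t - m * RtoC (s - t)))%C by ring.
  eapply Rle_trans. apply Cmod_triangle. rewrite Cmod_mult.
  set (r := Rabs (s - t)) in *. assert (0 <= r) by apply Rabs_pos.
  assert (eps / (2 * K) * Cmod (u s - u t) <= eps / 2 * r).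
  { apply Rle_trans with (eps / (2 * K) * (K * r)).
    - apply Rmult_le_compat_l; auto. left; apply Rdiv_lt_0_compat; lra.
    - right. field. lra. }
  assert (Cmod l * Cmod (u s - u t - m * RtoC (s - t)) <= eps / 2 * r).
  { apply Rle_trans with (L * (eps / (2 * L) * r)).
    - apply Rmult_le_compat; auto using Cmod_ge_0. unfold L; lra.
    - right. field. lra. }
  lra.
Qed.

(** * Goursat's theorem *)

Definition rect_int (f : CC -> CC) (a b c d : R) : CC :=
  (CInt (fun t => f (t, c)) a b + Ci * CInt (fun s => f (b, s)) c d
   - CInt (fun t => f (t, d)) a b - Ci * CInt (fun s => f (a, s)) c d)%C.

Lemma rder_horizontal y t : rder (fun t => (t, y)) t 1.
Proof. split; simpl. apply (is_derive_id (K := R_AbsRing)). apply (is_derive_const (V := R_NormedModule)). Qed.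

Lemma rder_vertical x t : rder (fun t => (x, t)) t Ci.
Proof. split; simpl. apply (is_derive_const (V := R_NormedModule)). apply (is_derive_id (K := R_AbsRing)). Qed.

Lemma rcont_horizontal y : rcont (fun t => (t, y)).
Proof. intros t; split; simpl. apply continuous_id. apply continuous_const. Qed.

Lemma rcont_vertical x : rcont (fun t => (x, t)).
Proof. intros t; split; simpl. apply continuous_const. apply continuous_id. Qed.

Section Rect.
Variable f : CC -> CC.
Hypothesis Hc : forall z, ccont f z.

Lemma rcont_h y : rcont (fun t => f (t, y)).
Proof. apply (rcont_comp f); auto. apply rcont_horizontal. Qed.

Lemma rcont_v x : rcont (fun t => f (x, t)).
Proof. apply (rcont_comp f); auto. apply rcont_vertical. Qed.

Lemma rect_int_split_x a m b c d :
  rect_int f a b c d = (rect_int f a m c d + rect_int f m b c d)%C.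
Proof.
  unfold rect_int. rewrite <- (CInt_Chasles (fun t => f (t, c)) a m b) by apply rcont_h.
  rewrite <- (CInt_Chasles (fun t => f (t, d)) a m b) by apply rcont_h. ring.
Qed.

Lemma rect_int_split_y a b c m d :
  rect_int f a b c d = (rect_int f a b c m + rect_int f a b m d)%C.
Proof.
  unfold rect_int. rewrite <- (CInt_Chasles (fun t => f (a, t)) c m d) by apply rcont_v.
  rewrite <- (CInt_Chasles (fun t => f (b, t)) c m d) by apply rcont_v. ring.
Qed.

Lemma rect_int_degenerate_x a c d : rect_int f a a c d = 0.
Proof. unfold rect_int. rewrite !CInt_point. ring. Qed.

Lemma rect_int_degenerate_y a b c : rect_int f a b c c = 0.
Proof. unfold rect_int. rewrite !CInt_point. ring. Qed.

Lemma rect_int_swap_x a b c d : rect_int f b a c d = (- rect_int f a b c d)%C.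
Proof.
  pose proof (rect_int_split_x a b a c d) as H. rewrite rect_int_degenerate_x in H.
  replace (rect_int f b a c d) with ((rect_int f a b c d + rect_int f b a c d) - rect_int f a b c d)%C by ring.
  rewrite <- H. ring.
Qed.

Lemma rect_int_swap_y a b c d : rect_int f a b d c = (- rect_int f a b c d)%C.
Proof.
  pose proof (rect_int_split_y a b c d c) as H. rewrite rect_int_degenerate_y in H.
  replace (rect_int f a b d c) with ((rect_int f a b c d + rect_int f a b d c) - rect_int f a b c d)%C by ring.
  rewrite <- H. ring.
Qed.

Lemma rect_int_bound a b c d M :
  (forall x y, Rmin a b <= x <= Rmax a b -> Rmin c d <= y <= Rmax c d -> Cmod (f (x, y)) <= M) ->
  Cmod (rect_int f a b c d) <= 4 * M * (Rabs (b - a) + Rabs (d - c)).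
Proof.
  intros HM. unfold rect_int.
  assert (B1 : Cmod (CInt (fun t => f (t, c)) a b) <= 2 * M * Rabs (b - a)).
  { apply CInt_bound. apply rcont_h. intros t Ht. apply HM; auto. split. apply Rmin_l. apply Rmax_l. }
  assert (B2 : Cmod (CInt (fun t => f (t, d)) a b) <= 2 * M * Rabs (b - a)).
  { apply CInt_bound. apply rcont_h. intros t Ht. apply HM; auto. split. apply Rmin_r. apply Rmax_r. }
  assert (B3 : Cmod (Ci * CInt (fun t => f (a, t)) c d) <= 2 * M * Rabs (d - c)).
  { rewrite Cmod_mult, Cmod_Ci, Rmult_1_l.
    apply CInt_bound. apply rcont_v. intros t Ht. apply HM; auto. split. apply Rmin_l. apply Rmax_l. }
  assert (B4 : Cmod (Ci * CInt (fun t => f (b, t)) c d) <= 2 * M * Rabs (d - c)).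
  { rewrite Cmod_mult, Cmod_Ci, Rmult_1_l.
    apply CInt_bound. apply rcont_v. intros t Ht. apply HM; auto. split. apply Rmin_r. apply Rmax_r. }
  eapply Rle_trans. apply Cmod_sub_le.
  eapply Rle_trans. apply Rplus_le_compat_r. apply Cmod_sub_le.
  eapply Rle_trans. apply Rplus_le_compat_r. apply Rplus_le_compat_r. apply Cmod_triangle.
  lra.
Qed.

Lemma rect_int_primitive G a b c d :
  (forall z, cder G z (f z)) -> rect_int f a b c d = 0.
Proof.
  intros HG.
  assert (Hh : forall y a b, CInt (fun t => f (t, y)) a b = (G (b, y) - G (a, y))%C).
  { intros y a' b'. apply (CInt_FTC (fun t => G (t, y))). 2: apply rcont_h.
    intros t. rewrite <- (Cmult_1_r (f (t, y))).
    apply (rder_comp G (fun t => (t, y))). apply HG. apply rder_horizontal. }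
  assert (Hv : forall x a b, (Ci * CInt (fun t => f (x, t)) a b)%C = (G (x, b) - G (x, a))%C).
  { intros x a' b'. rewrite <- CInt_scal by apply rcont_v.
    apply (CInt_FTC (fun t => G (x, t))).
    - intros t. rewrite Cmult_comm.
      apply (rder_comp G (fun t => (x, t))). apply HG. apply rder_vertical.
    - apply (rcont_mult (fun _ => Ci)). apply rcont_const. apply rcont_v. }
  unfold rect_int. rewrite !Hh, !Hv. ring.
Qed.

End Rect.

Lemma rect_int_minus f g a b c d : (forall z, ccont f z) -> (forall z, ccont g z) ->
  rect_int (fun z => (f z - g z)%C) a b c d = (rect_int f a b c d - rect_int g a b c d)%C.
Proof.
  intros Hf Hg. unfold rect_int.
  rewrite (CInt_minus (fun t => f (t, c)) (fun t => g (t, c))) by (apply rcont_h; assumption).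
  rewrite (CInt_minus (fun t => f (t, d)) (fun t => g (t, d))) by (apply rcont_h; assumption).
  rewrite (CInt_minus (fun t => f (a, t)) (fun t => g (a, t))) by (apply rcont_v; assumption).
  rewrite (CInt_minus (fun t => f (b, t)) (fun t => g (b, t))) by (apply rcont_v; assumption).
  ring.
Qed.

Lemma rect_int_affine (al be : CC) a b c d :
  rect_int (fun z => (al + be * z)%C) a b c d = 0.
Proof.
  assert (HG : forall z, cder (fun z => (al * z + (be / 2) * (z * z))%C) z (al + be * z)).
  { intros z. replace (al + be * z)%C with
      ((0 * z + al * 1) + (0 * (z * z) + (be / 2) * (1 * z + z * 1)))%C.
    - apply (cder_plus (fun z => al * z)%C (fun z => (be / 2) * (z * z))%C).
      + apply (cder_mult (fun _ => al) (fun z => z)). apply cder_const. apply cder_id.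
      + apply (cder_mult (fun _ => be / 2)%C (fun z => z * z)%C). apply cder_const.
        apply (cder_mult (fun z => z) (fun z => z)); apply cder_id.
    - field. }
  apply (rect_int_primitive _ ) with (G := fun z => (al * z + (be / 2) * (z * z))%C); auto.
  intros z. apply entire_ccont. apply entire_plus. apply entire_const.
  apply entire_mult. apply entire_const. apply entire_id.
Qed.

(** Affine maps have primitives, so the affine approximation at (x0, y0) may be subtracted. What
    remains is at most eps times half the perimeter on the rectangle, and integration multiplies it
    by the length of the boundary. *)
Lemma goursat_local_bound f (x0 y0 : R) (l : CC) a b c d eps :
  (forall z, ccont f z) -> 0 <= eps -> a <= x0 <= b -> c <= y0 <= d ->
  (forall x y, a <= x <= b -> c <= y <= d ->
    Cmod (f (x, y) - f (x0, y0) - l * ((x, y) - (x0, y0))) <= eps * Cmod ((x, y) - (x0, y0))) ->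
  Cmod (rect_int f a b c d) <= 4 * eps * (b - a + (d - c)) ^ 2.
Proof.
  intros Hc He Hx Hy HB.
  set (g := fun z => (f (x0, y0) - l * (x0, y0) + l * z)%C).
  assert (Hg : forall z, ccont g z).
  { intros z. apply entire_ccont. apply entire_plus. apply entire_const.
    apply entire_mult. apply entire_const. apply entire_id. }
  replace (rect_int f a b c d) with (rect_int (fun z => (f z - g z)%C) a b c d).
  2: { rewrite rect_int_minus by assumption. unfold g at 1. rewrite rect_int_affine. ring. }
  assert (Hfg : forall z, ccont (fun z => (f z - g z)%C) z).
  { intros z e He'. destruct (Hc z (e / 2)) as [d1 [Hd1 B1]]. lra.
    destruct (Hg z (e / 2)) as [d2 [Hd2 B2]]. lra.
    exists (Rmin d1 d2). split. now apply Rmin_pos. intros w Hw.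
    specialize (B1 w (Rlt_le_trans _ _ _ Hw (Rmin_l _ _))).
    specialize (B2 w (Rlt_le_trans _ _ _ Hw (Rmin_r _ _))).
    replace (f w - g w - (f z - g z))%C with ((f w - f z) - (g w - g z))%C by ring.
    eapply Rle_lt_trans. apply Cmod_sub_le. lra. }
  eapply Rle_trans.
  - apply (rect_int_bound _ Hfg) with (M := eps * (b - a + (d - c))).
    intros x y Hx' Hy'. rewrite Rmin_left, Rmax_right in Hx' by lra.
    rewrite Rmin_left, Rmax_right in Hy' by lra.
    replace (f (x, y) - g (x, y))%C with (f (x, y) - f (x0, y0) - l * ((x, y) - (x0, y0)))%C
      by (unfold g; ring).
    eapply Rle_trans. apply HB; auto. apply Rmult_le_compat_l; auto.
    eapply Rle_trans. apply Cmod_le_Re_Im. simpl.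
    assert (Rabs (x + - x0) <= b - a) by (apply Rabs_le; lra).
    assert (Rabs (y + - y0) <= d - c) by (apply Rabs_le; lra). lra.
  - rewrite !Rabs_pos_eq by lra. right. ring.
Qed.

(** Continuity is assumed everywhere but differentiability only on the closed rectangle: this is
    what a function with one exceptional point offers on rectangles that avoid it. *)
Lemma goursat f a c w h : (forall z, ccont f z) -> 0 <= w -> 0 <= h ->
  (forall x y, a <= x <= a + w -> c <= y <= c + h -> cdiff f (x, y)) ->
  rect_int f a (a + w) c (c + h) = 0.
Proof.
  intros Hc Hw Hh Hd.
  destruct (Ceq_dec (rect_int f a (a + w) c (c + h)) 0) as [E|NE]; auto. exfalso.
  assert (Hpos : 0 < Cmod (rect_int f a (a + w) c (c + h))) by (apply -> Cmod_gt_0; exact NE).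
  set (W := fun p w h => Cmod (rect_int f (fst p) (fst p + w) (snd p) (snd p + h))).
  assert (Hwh : 0 < w + h).
  { destruct (Req_dec (w + h) 0); [|lra].
    assert (w = 0) by lra. subst w. exfalso. apply NE.
    replace (a + 0) with a by ring. apply rect_int_degenerate_x. }
  (* Bisection: some quarter carries at least a quarter of the integral. Three quarters are tested,
     and the fourth follows by elimination. *)
  assert (step : forall q : (R * R) * (R * R), exists p' : R * R,
     (fst p' = fst (fst q) \/ fst p' = fst (fst q) + fst (snd q) / 2) /\
     (snd p' = snd (fst q) \/ snd p' = snd (fst q) + snd (snd q) / 2) /\
     W (fst q) (fst (snd q)) (snd (snd q)) <= 4 * W p' (fst (snd q) / 2) (snd (snd q) / 2)).
  { intros [[x y] [u v]]; simpl.
    set (P1 := rect_int f x (x + u / 2) y (y + v / 2)).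
    set (P2 := rect_int f (x + u / 2) (x + u) y (y + v / 2)).
    set (P3 := rect_int f x (x + u / 2) (y + v / 2) (y + v)).
    set (P4 := rect_int f (x + u / 2) (x + u) (y + v / 2) (y + v)).
    assert (E : rect_int f x (x + u) y (y + v) = (P1 + P2 + (P3 + P4))%C).
    { rewrite (rect_int_split_y f Hc _ _ _ (y + v / 2)).
      rewrite (rect_int_split_x f Hc x (x + u / 2) (x + u) y).
      rewrite (rect_int_split_x f Hc x (x + u / 2) (x + u) (y + v / 2)). reflexivity. }
    assert (T : Cmod (rect_int f x (x + u) y (y + v)) <= Cmod P1 + Cmod P2 + (Cmod P3 + Cmod P4)).
    { rewrite E. eapply Rle_trans. apply Cmod_triangle.
      apply Rplus_le_compat; apply Cmod_triangle. }
    unfold W; simpl.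
    destruct (Rle_dec (Cmod (rect_int f x (x + u) y (y + v))) (4 * Cmod P1)).
    { exists (x, y); simpl; auto. }
    destruct (Rle_dec (Cmod (rect_int f x (x + u) y (y + v))) (4 * Cmod P2)).
    { exists (x + u / 2, y); simpl. replace (x + u / 2 + u / 2) with (x + u) by lra. auto. }
    destruct (Rle_dec (Cmod (rect_int f x (x + u) y (y + v))) (4 * Cmod P3)).
    { exists (x, y + v / 2); simpl. replace (y + v / 2 + v / 2) with (y + v) by lra. auto. }
    exists (x + u / 2, y + v / 2); simpl.
    replace (x + u / 2 + u / 2) with (x + u) by lra.
    replace (y + v / 2 + v / 2) with (y + v) by lra. repeat split; auto. fold P4. lra. }
  destruct (choice _ step) as [st Hst].
  set (sz := fun n => (w / 2 ^ n, h / 2 ^ n)).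
  set (p := fix p n := match n with O => (a, c) | S m => st (p m, sz m) end).
  assert (sz2 : forall n u, u / 2 ^ n / 2 = u / 2 ^ S n).
  { intros n u. simpl. field. apply pow_nonzero. lra. }
  assert (szpos : forall n u, 0 <= u -> 0 <= u / 2 ^ n).
  { intros n u Hu. apply Rmult_le_pos; auto. left. apply Rinv_0_lt_compat, pow_lt. lra. }
  assert (HW : forall n, W (a, c) w h <= 4 ^ n * W (p n) (w / 2 ^ n) (h / 2 ^ n)).
  { induction n.
    - simpl. unfold Rdiv. rewrite Rinv_1, !Rmult_1_r, Rmult_1_l. apply Rle_refl.
    - eapply Rle_trans. apply IHn. destruct (Hst (p n, sz n)) as [_ [_ H]]. simpl in H.
      rewrite !sz2 in H. simpl. simpl in H.
      assert (0 < 4 ^ n) by (apply pow_lt; lra). nra. }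
  assert (Hmx : forall n, fst (p n) <= fst (p (S n)) <= fst (p n) + w / 2 ^ S n).
  { intros n. destruct (Hst (p n, sz n)) as [H _]. simpl fst in *. simpl snd in *.
    rewrite sz2 in H. pose proof (szpos (S n) w Hw).
    change (p (S n)) with (st (p n, sz n)). destruct H as [-> | ->]; lra. }
  assert (Hmy : forall n, snd (p n) <= snd (p (S n)) <= snd (p n) + h / 2 ^ S n).
  { intros n. destruct (Hst (p n, sz n)) as [_ [H _]]. simpl fst in *. simpl snd in *.
    rewrite sz2 in H. pose proof (szpos (S n) h Hh).
    change (p (S n)) with (st (p n, sz n)). destruct H as [-> | ->]; lra. }
  assert (nest : forall (s : nat -> R) u, 0 <= u ->
     (forall n, s n <= s (S n) <= s n + u / 2 ^ S n) ->
     exists x, forall n, s n <= x <= s n + u / 2 ^ n).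
  { intros s u Hu Hs.
    assert (Hup : forall n m, s n <= s (n + m)%nat /\ s (n + m)%nat + u / 2 ^ (n + m) <= s n + u / 2 ^ n).
    { intros n. induction m.
      - rewrite Nat.add_0_r. lra.
      - replace (n + S m)%nat with (S (n + m)) by lia. specialize (Hs (n + m)%nat).
        pose proof (sz2 (n + m)%nat u). lra. }
    assert (Hle : forall n m, s n <= s m + u / 2 ^ m).
    { intros n m. pose proof (szpos n u Hu). pose proof (szpos m u Hu).
      destruct (Nat.le_ge_cases n m).
      - destruct (Hup n (m - n)%nat) as [H2 _]. replace (n + (m - n))%nat with m in H2 by lia. lra.
      - destruct (Hup m (n - m)%nat) as [_ H2]. replace (m + (n - m))%nat with n in H2 by lia. lra. }
    destruct (completeness (fun x => exists n, x = s n)) as [x [Hx1 Hx2]].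
    - exists (s O + u / 2 ^ 0). intros x [n ->]. apply Hle.
    - exists (s O). exists O. reflexivity.
    - exists x. intros n. split.
      + apply Hx1. exists n. reflexivity.
      + apply Hx2. intros y [m ->]. apply Hle. }
  destruct (nest (fun n => fst (p n)) w Hw Hmx) as [x0 Hx0].
  destruct (nest (fun n => snd (p n)) h Hh Hmy) as [y0 Hy0].
  assert (R0 : a <= x0 <= a + w).
  { specialize (Hx0 O). simpl in Hx0. unfold Rdiv in Hx0. rewrite Rinv_1 in Hx0. lra. }
  assert (R1 : c <= y0 <= c + h).
  { specialize (Hy0 O). simpl in Hy0. unfold Rdiv in Hy0. rewrite Rinv_1 in Hy0. lra. }
  destruct (Hd x0 y0 R0 R1) as [l Hl].
  (* Normalised so that the local bound with eps = K / 8, multiplied by 4^N, is half of the original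
     integral; by the bisection it would have to be at least the whole. *)
  set (K := W (a, c) w h / (w + h) ^ 2).
  assert (HK : 0 < K).
  { apply Rdiv_lt_0_compat. exact Hpos. apply pow_lt; lra. }
  destruct (Hl (K / 8)) as [dl [Hdl Bl]]. lra.
  destruct (pow_lt_1_zero (/ 2)) with (y := dl / (w + h)) as [N HN].
  { rewrite Rabs_pos_eq; lra. } { apply Rdiv_lt_0_compat; lra. }
  specialize (HN N (le_n N)). rewrite Rabs_pos_eq in HN by (apply pow_le; lra).
  rewrite pow_inv in HN.
  assert (HN2 : w / 2 ^ N + h / 2 ^ N < dl).
  { apply (Rmult_lt_compat_r (w + h)) in HN; [|lra].
    replace (dl / (w + h) * (w + h)) with dl in HN by (field; lra). unfold Rdiv. lra. }
  specialize (Hx0 N). specialize (Hy0 N). specialize (HW N).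
  pose proof (szpos N w Hw) as Z1. pose proof (szpos N h Hh) as Z2.
  assert (Bd : W (p N) (w / 2 ^ N) (h / 2 ^ N) <= 4 * (K / 8) * (w / 2 ^ N + h / 2 ^ N) ^ 2).
  { unfold W. eapply Rle_trans.
    - apply goursat_local_bound with (x0 := x0) (y0 := y0) (l := l) (eps := K / 8); auto; try lra.
      intros x y Hx Hy. apply Bl.
      eapply Rle_lt_trans. apply Cmod_le_Re_Im. simpl.
      assert (Rabs (x + - x0) <= w / 2 ^ N) by (apply Rabs_le; lra).
      assert (Rabs (y + - y0) <= h / 2 ^ N) by (apply Rabs_le; lra). lra.
    - right. ring. }
  assert (P4 : 0 < 4 ^ N) by (apply pow_lt; lra).
  apply (Rmult_le_compat_l (4 ^ N)) in Bd; [|lra].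
  assert (E4 : 4 ^ N * (4 * (K / 8) * (w / 2 ^ N + h / 2 ^ N) ^ 2) = K / 2 * (w + h) ^ 2).
  { replace 4 with (2 * 2) at 1 by ring. rewrite Rpow_mult_distr. field. apply pow_nonzero. lra. }
  rewrite E4 in Bd.
  assert (EK : K * (w + h) ^ 2 = W (a, c) w h).
  { unfold K. field. lra. }
  assert (0 < W (a, c) w h) by exact Hpos. lra.
Qed.

(** * Primitives and the mean value property *)

Lemma goursat_any f a b c d : (forall z, ccont f z) ->
  (forall x y, Rmin a b <= x <= Rmax a b -> Rmin c d <= y <= Rmax c d -> cdiff f (x, y)) ->
  rect_int f a b c d = 0.
Proof.
  intros Hc.
  assert (S : forall a b c d, a <= b -> c <= d ->
    (forall x y, a <= x <= b -> c <= y <= d -> cdiff f (x, y)) -> rect_int f a b c d = 0).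
  { intros a' b' c' d' H1 H2 H. replace b' with (a' + (b' - a')) by ring.
    replace d' with (c' + (d' - c')) by ring. apply goursat; auto; try lra.
    intros x y Hx Hy. apply H; lra. }
  destruct (Rle_dec a b) as [Hab|Hab]; destruct (Rle_dec c d) as [Hcd|Hcd];
    [rewrite (Rmin_left a b), (Rmax_right a b), (Rmin_left c d), (Rmax_right c d) by lra
    |rewrite (Rmin_left a b), (Rmax_right a b), (Rmin_right c d), (Rmax_left c d) by lra
    |rewrite (Rmin_right a b), (Rmax_left a b), (Rmin_left c d), (Rmax_right c d) by lra
    |rewrite (Rmin_right a b), (Rmax_left a b), (Rmin_right c d), (Rmax_left c d) by lra]; intros H.
  - apply S; auto.
  - rewrite rect_int_swap_y by assumption. rewrite S; auto. ring. lra.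
  - rewrite rect_int_swap_x by assumption. rewrite S; auto. ring. lra.
  - rewrite rect_int_swap_y, rect_int_swap_x by assumption. rewrite S; auto. ring. lra. lra.
Qed.

Section Exceptional.
Variable f : CC -> CC.
Variable p : CC.
Hypothesis Hc : forall z, ccont f z.
Hypothesis Hd : forall z : CC, z <> p -> cdiff f z.

(** Cutting off a rectangle at p, scaled by th, leaves pieces that avoid p and contribute nothing.
    Near p the map is bounded, so the small piece is O(th). One exceptional point is allowed because
    difference quotients have one. *)
Lemma rect_int_corner b d : rect_int f (Re p) b (Im p) d = 0.
Proof.
  destruct (Req_dec b (Re p)) as [->|Hb]. apply rect_int_degenerate_x.
  destruct (Req_dec d (Im p)) as [->|Hd']. apply rect_int_degenerate_y.
  set (S := Rabs (b - Re p) + Rabs (d - Im p)).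
  assert (HS : 0 < S).
  { unfold S. pose proof (Rabs_pos_lt (b - Re p)). pose proof (Rabs_pos (d - Im p)). lra. }
  destruct (Hc p 1 Rlt_0_1) as [dl [Hdl Bl]].
  set (M := Cmod (f p) + 1).
  assert (HM : 0 < M) by (unfold M; pose proof (Cmod_ge_0 (f p)); lra).
  assert (Key : forall th, 0 < th -> th < 1 -> th * S < dl ->
    Cmod (rect_int f (Re p) b (Im p) d) <= 4 * M * (th * S)).
  { intros th H0 H1 H2.
    set (b' := Re p + th * (b - Re p)). set (d' := Im p + th * (d - Im p)).
    rewrite (rect_int_split_x f Hc _ b'). rewrite (rect_int_split_y f Hc (Re p) b' _ d').
    assert (Hne : forall u w x, w <> u -> Rmin (u + th * (w - u)) w <= x <= Rmax (u + th * (w - u)) w -> x <> u).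
    { intros u w x Hw. unfold Rmin, Rmax. destruct (Rle_dec (u + th * (w - u)) w); intros Hx ->;
      destruct (Rlt_dec u w); nra. }
    rewrite (goursat_any f b' b) ; auto.
    2: { intros x y Hx Hy. apply Hd. intros E. apply (Hne (Re p) b x Hb Hx). rewrite <- E. reflexivity. }
    rewrite (goursat_any f (Re p) b' d' d); auto.
    2: { intros x y Hx Hy. apply Hd. intros E. apply (Hne (Im p) d y Hd' Hy). rewrite <- E. reflexivity. }
    replace (rect_int f (Re p) b' (Im p) d' + 0 + 0)%C with (rect_int f (Re p) b' (Im p) d') by ring.
    assert (Hin : forall u w x, Rmin u (u + th * (w - u)) <= x <= Rmax u (u + th * (w - u)) -> Rabs (x - u) <= th * Rabs (w - u)).
    { intros u w x. unfold Rmin, Rmax. destruct (Rle_dec u (u + th * (w - u))); intros Hx.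
      - assert (0 <= th * (w - u)) by lra. assert (0 <= w - u) by nra.
        rewrite (Rabs_pos_eq (w - u)) by lra. apply Rabs_le. lra.
      - assert (th * (w - u) < 0) by lra. assert (w - u < 0) by nra.
        rewrite (Rabs_left (w - u)) by lra. apply Rabs_le. lra. }
    eapply Rle_trans.
    - apply (rect_int_bound f Hc _ _ _ _ M). intros x y Hx Hy.
      apply Hin in Hx. apply Hin in Hy.
      replace (f (x, y)) with ((f (x, y) - f p) + f p)%C by ring.
      eapply Rle_trans. apply Cmod_triangle. unfold M.
      assert (Cmod (f (x, y) - f p) < 1); [|lra]. apply Bl.
      eapply Rle_lt_trans. apply Cmod_le_Re_Im. simpl. fold (Re p). fold (Im p).
      unfold S in H2. unfold Rminus in *. lra.
    - unfold b', d'. right. replace (Re p + th * (b - Re p) - Re p) with (th * (b - Re p)) by ring.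
      replace (Im p + th * (d - Im p) - Im p) with (th * (d - Im p)) by ring.
      rewrite !Rabs_mult, (Rabs_pos_eq th) by lra. unfold S. ring. }
  destruct (Ceq_dec (rect_int f (Re p) b (Im p) d) 0) as [E|NE]; auto. exfalso.
  assert (Hpos : 0 < Cmod (rect_int f (Re p) b (Im p) d)) by (apply -> Cmod_gt_0; exact NE).
  set (I := Cmod (rect_int f (Re p) b (Im p) d)) in *.
  (* Small enough for the scaled rectangle to lie where |f| <= M and for 4 M th S to be at most half
     of the supposed nonzero integral. *)
  set (th := Rmin (/ 2) (Rmin (dl / (2 * S)) (I / (8 * M * S)))).
  assert (T0 : 0 < th).
  { unfold th. repeat apply Rmin_pos. lra. apply Rdiv_lt_0_compat; lra. apply Rdiv_lt_0_compat; auto.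
    repeat apply Rmult_lt_0_compat; lra. }
  assert (T1 : th <= / 2) by apply Rmin_l.
  assert (T2 : th <= dl / (2 * S)) by below_min.
  assert (T3 : th <= I / (8 * M * S)) by below_min.
  apply (Rmult_le_compat_r S) in T2; [|lra].
  replace (dl / (2 * S) * S) with (dl / 2) in T2 by (field; lra).
  apply (Rmult_le_compat_r (4 * M * S)) in T3.
  2: { left. repeat apply Rmult_lt_0_compat; lra. }
  replace (I / (8 * M * S) * (4 * M * S)) with (I / 2) in T3 by (field; lra).
  specialize (Key th T0). assert (I <= 4 * M * (th * S)) by (apply Key; lra).
  replace (th * (4 * M * S)) with (4 * M * (th * S)) in T3 by ring. lra.
Qed.

Lemma rect_int_zero a b c d : rect_int f a b c d = 0.
Proof.
  assert (H : forall a b d, rect_int f a b (Im p) d = 0).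
  { intros a' b' d'. rewrite (rect_int_split_x f Hc _ (Re p)).
    rewrite (rect_int_swap_x f Hc (Re p) a'). rewrite !rect_int_corner. ring. }
  rewrite (rect_int_split_y f Hc _ _ _ (Im p)). rewrite (rect_int_swap_y f Hc _ _ (Im p) c).
  rewrite !H. ring.
Qed.

Lemma CInt_const (c : CC) a b : CInt (fun _ => c) a b = (c * RtoC (b - a))%C.
Proof.
  unfold CInt. rewrite !RInt_const. unfold scal; simpl; unfold mult; simpl.
  apply C_ext; simpl; ring_simplify; unfold Re, Im; ring.
Qed.

Lemma exceptional_primitive : exists G, forall z, cder G z (f z).
Proof.
  exists (fun z => (CInt (fun t => f (t, 0%R)) 0 (Re z) + Ci * CInt (fun s => f (Re z, s)) 0 (Im z))%C).
  intros z eps Heps.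
  destruct (Hc z (eps / 4)) as [d [Hd' B]]. lra.
  exists d. split; auto. intros w Hw.
  set (x0 := Re z). set (y0 := Im z). set (x := Re w). set (y := Im w).
  assert (E : (CInt (fun t => f (t, 0%R)) 0 x + Ci * CInt (fun s => f (x, s)) 0 y -
     (CInt (fun t => f (t, 0%R)) 0 x0 + Ci * CInt (fun s => f (x0, s)) 0 y0) - f z * (w - z))%C =
     (CInt (fun t => f (t, y0) - f z)%C x0 x + Ci * CInt (fun s => f (x, s) - f z)%C y0 y)%C).
  { rewrite (CInt_minus (fun t => f (t, y0)) (fun _ => f z)); [|apply rcont_h; auto|apply rcont_const].
    rewrite (CInt_minus (fun t => f (x, t)) (fun _ => f z)); [|apply rcont_v; auto|apply rcont_const].
    rewrite !CInt_const.
    assert (Ew : (w - z)%C = (RtoC (x - x0) + Ci * RtoC (y - y0))%C).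
    { apply C_ext; simpl; unfold x, x0, y, y0; unfold Re, Im; ring. }
    rewrite Ew.
    (* The vanishing integral around [x0, x] x [0, y0] lifts the horizontal segment from height 0 to
       height y0. Then z and w are joined by one horizontal and one vertical segment, on both of
       which f is close to f(z). *)
    pose proof (rect_int_zero x0 x 0 y0) as Z. unfold rect_int in Z.
    rewrite <- (CInt_Chasles (fun t => f (t, 0%R)) 0 x0 x) by (apply rcont_h; auto).
    rewrite <- (CInt_Chasles (fun t => f (x, t)) 0 y0 y) by (apply rcont_v; auto).
    match type of Z with ?l = _ => set (ZZ := l) in * end.
    match goal with |- ?a = ?b => replace a with (b + ZZ)%C by (unfold ZZ; ring) end.
    rewrite Z. ring. }
  rewrite E. clear E.
  assert (Hx : Rabs (x - x0) <= Cmod (w - z)) by apply (re_le_Cmod (w - z)).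
  assert (Hy : Rabs (y - y0) <= Cmod (w - z)) by apply (Im_le_Cmod (w - z)).
  assert (Bt : forall u v t, Rmin u v <= t <= Rmax u v -> Rabs (t - u) <= Rabs (v - u)).
  { intros u v t. unfold Rmin, Rmax. destruct (Rle_dec u v); intros Ht.
    - rewrite (Rabs_pos_eq (v - u)) by lra. apply Rabs_le; lra.
    - rewrite (Rabs_left (v - u)) by lra. apply Rabs_le; lra. }
  assert (mono : forall a b c d, Rabs a <= Rabs c -> Rabs b <= Rabs d -> Cmod (a, b) <= Cmod (c, d)).
  { intros a1 b1 c1 d1 H1 H2. unfold Cmod; simpl. apply sqrt_le_1_alt.
    apply Rsqr_le_abs_1 in H1. apply Rsqr_le_abs_1 in H2. unfold Rsqr in *. lra. }
  eapply Rle_trans. apply Cmod_triangle. rewrite Cmod_mult, Cmod_Ci, Rmult_1_l.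
  assert (B1 : Cmod (CInt (fun t => f (t, y0) - f z)%C x0 x) <= 2 * (eps / 4) * Rabs (x - x0)).
  { apply CInt_bound. apply rcont_minus. apply rcont_h; auto. apply rcont_const.
    intros t Ht. left. apply B. eapply Rle_lt_trans; [|exact Hw].
    replace ((t, y0) - z)%C with (t - x0, 0%R).
    2: { apply C_ext; simpl; unfold x0, y0; unfold Re, Im; ring. }
    replace (w - z)%C with (x - x0, y - y0).
    2: { apply C_ext; simpl; unfold x, y, x0, y0; unfold Re, Im; ring. }
    apply mono. auto. rewrite Rabs_R0. apply Rabs_pos. }
  assert (B2 : Cmod (CInt (fun t => f (x, t) - f z)%C y0 y) <= 2 * (eps / 4) * Rabs (y - y0)).
  { apply CInt_bound. apply rcont_minus. apply rcont_v; auto. apply rcont_const.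
    intros t Ht. left. apply B. eapply Rle_lt_trans; [|exact Hw].
    replace ((x, t) - z)%C with (x - x0, t - y0).
    2: { apply C_ext; simpl; unfold x, x0, y0; unfold Re, Im; ring. }
    replace (w - z)%C with (x - x0, y - y0).
    2: { apply C_ext; simpl; unfold x, y, x0, y0; unfold Re, Im; ring. }
    apply mono. lra. auto. }
  nra.
Qed.

End Exceptional.

(** * Circles, difference quotients and the mean value bound *)

Definition circ (t : R) : CC := (cos t, sin t).

Lemma Cmod_circ t : Cmod (circ t) = 1.
Proof.
  unfold Cmod, circ; simpl. replace (_ + _) with 1. apply sqrt_1.
  pose proof (sin2_cos2 t) as H. unfold Rsqr in H. lra.
Qed.

Lemma rder_circ t : rder circ t (Ci * circ t)%C.
Proof.
  split; simpl.
  - replace (0 * cos t - 1 * sin t) with (- sin t) by ring. apply is_derive_cos.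
  - replace (0 * sin t + 1 * cos t) with (cos t) by ring. apply is_derive_sin.
Qed.

Lemma rcont_circ : rcont circ.
Proof.
  intros t. split; simpl.
  - apply (ex_derive_continuous (V := R_NormedModule)). eexists. apply is_derive_cos.
  - apply (ex_derive_continuous (V := R_NormedModule)). eexists. apply is_derive_sin.
Qed.

Definition circle (c : CC) (r : R) (t : R) : CC := (c + RtoC r * circ t)%C.

Lemma rder_circle c r t : rder (circle c r) t (RtoC r * (Ci * circ t))%C.
Proof.
  unfold circle.
  replace (RtoC r * (Ci * circ t))%C with ((0 + (0 * circ t + RtoC r * 1)) * (Ci * circ t))%C by ring.
  apply (rder_comp (fun z => c + RtoC r * z)%C circ).
  - apply (cder_plus (fun _ => c) (fun z => RtoC r * z)%C). apply cder_const.
    apply (cder_mult (fun _ => RtoC r) (fun z => z)). apply cder_const. apply cder_id.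
  - apply rder_circ.
Qed.

Lemma rcont_circle c r : rcont (circle c r).
Proof. apply rcont_plus. apply rcont_const. apply rcont_mult. apply rcont_const. apply rcont_circ. Qed.

Lemma circle_int_zero f p c r : (forall z, ccont f z) -> (forall z : CC, z <> p -> cdiff f z) ->
  CInt (fun t => f (circle c r t) * (RtoC r * (Ci * circ t)))%C 0 (2 * PI) = 0.
Proof.
  intros Hc Hd. destruct (exceptional_primitive f p Hc Hd) as [G HG].
  rewrite (CInt_FTC (fun t => G (circle c r t))).
  - replace (circle c r (2 * PI)) with (circle c r 0). ring.
    unfold circle, circ. rewrite cos_2PI, sin_2PI, cos_0, sin_0. reflexivity.
  - intros t. apply (rder_comp G). apply HG. apply rder_circle.
  - apply (rcont_mult (fun t => f (circle c r t))).
    + apply (rcont_comp f). intros; apply Hc. apply rcont_circle.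
    + apply rcont_mult. apply rcont_const. apply rcont_mult. apply rcont_const. apply rcont_circ.
Qed.

(** The difference quotient with [l] filled in at [a]. If [l] is the derivative, it is continuous at
    [a] and differentiable elsewhere, so Cauchy's theorem with one exceptional point applies to it;
    this takes the place of Cauchy's formula. *)
Definition slope (f : CC -> CC) (a l z : CC) : CC :=
  if Ceq_dec z a then l else ((f z - f a) / (z - a))%C.

Lemma slope_at f a l : slope f a l a = l.
Proof. unfold slope. destruct (Ceq_dec a a); congruence. Qed.

Lemma slope_off f a l (z : CC) : z <> a -> slope f a l z = ((f z - f a) / (z - a))%C.
Proof. unfold slope. destruct (Ceq_dec z a); congruence. Qed.

Lemma slope_mult f a l (z : CC) : (f z - f a)%C = ((z - a) * slope f a l z)%C.
Proof.
  destruct (Ceq_dec z a) as [->|H]. ring.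
  rewrite slope_off by assumption. field. now apply Cminus_eq_contra.
Qed.

Lemma slope_cdiff f a l (z : CC) : z <> a -> cdiff f z -> cdiff (slope f a l) z.
Proof.
  intros Hz [m Hm].
  assert (H1 : cder (fun w => f w - f a)%C z (m - 0)).
  { apply (cder_minus f (fun _ => f a)); auto. apply cder_const. }
  assert (H2 : cder (fun w => w - a)%C z (1 - 0)).
  { apply (cder_minus (fun w => w) (fun _ => a)). apply cder_id. apply cder_const. }
  destruct (cder_div (fun w => f w - f a)%C (fun w => w - a)%C z _ _ (Cminus_eq_contra _ _ Hz) H1 H2) as [k Hk].
  exists k. apply (cder_ext_loc (fun w => (f w - f a) / (w - a))%C _ z k (Cmod (z - a))); auto.
  - now apply Cmod_pos_neq.
  - intros w Hw. rewrite slope_off; auto. intros ->. rewrite Cmod_minus_sym in Hw. lra.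
Qed.

Lemma slope_ccont f a l : cder f a l -> ccont (slope f a l) a.
Proof.
  intros H eps Heps. destruct (H (eps / 2)) as [d [Hd B]]. lra.
  exists d. split; auto. intros w Hw. rewrite slope_at.
  destruct (Ceq_dec w a) as [->|Hwa]. rewrite slope_at, Cmod_self. lra.
  rewrite slope_off by assumption.
  assert (Hp := Cmod_pos_neq w a Hwa). specialize (B w Hw).
  replace ((f w - f a) / (w - a) - l)%C with ((f w - f a - l * (w - a)) / (w - a))%C
    by (field; now apply Cminus_eq_contra).
  rewrite Cmod_div by now apply Cminus_eq_contra.
  apply Rle_lt_trans with (eps / 2); [|lra].
  apply Rmult_le_reg_r with (Cmod (w - a)); auto. unfold Rdiv. rewrite Rmult_assoc, Rinv_l by lra. lra.
Qed.

Lemma slope_circle_int f a c r : entire f ->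
  exists l, cder f a l /\
  CInt (fun t => slope f a l (circle c r t) * (RtoC r * (Ci * circ t)))%C 0 (2 * PI) = 0.
Proof.
  intros Hf. rewrite entire_cdiff in Hf. destruct (Hf a) as [l Hl]. exists l. split; auto.
  apply (circle_int_zero _ a).
  - intros z. destruct (Ceq_dec z a) as [->|Hz]. now apply slope_ccont.
    destruct (slope_cdiff f a l z Hz (Hf z)) as [k Hk]. eapply cder_ccont; eauto.
  - intros z Hz. apply slope_cdiff; auto.
Qed.

Lemma circ_neq_0 t : circ t <> 0.
Proof. apply <- Cmod_gt_0. rewrite Cmod_circ. lra. Qed.

(** On the circle about c the denominator z - c cancels against dz, so the vanishing integral of the
    slope says that f(c) is the mean of f over the circle. *)
Lemma mean_value_bound f c r M : entire f -> 0 < r ->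
  (forall z, Cmod (z - c) = r -> Cmod (f z) <= M) -> Cmod (f c) <= 2 * M.
Proof.
  intros Hf Hr HM. destruct (slope_circle_int f c c r Hf) as [l [Hl HI]].
  assert (Hcirc : forall t, Cmod (circle c r t - c) = r).
  { intros t. unfold circle. replace (c + RtoC r * circ t - c)%C with (RtoC r * circ t)%C by ring.
    rewrite Cmod_mult, Cmod_circ, Cmod_R, Rabs_pos_eq; lra. }
  assert (Hrc : rcont (fun t => f (circle c r t))).
  { apply (rcont_comp f). intros; now apply entire_ccont. apply rcont_circle. }
  rewrite (CInt_ext _ (fun t => Ci * (f (circle c r t) - f c))%C) in HI.
  2: { intros t. rewrite slope_off.
       - unfold circle. field. intros E. specialize (Hcirc t). unfold circle in Hcirc. rewrite E, Cmod_0 in Hcirc. lra.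
       - intros E. specialize (Hcirc t). rewrite E, Cmod_self in Hcirc. lra. }
  rewrite CInt_scal in HI by (apply rcont_minus; auto; apply rcont_const).
  rewrite CInt_minus in HI; auto; [|apply rcont_const]. rewrite CInt_const in HI.
  assert (E : (f c * RtoC (2 * PI - 0))%C = CInt (fun t => f (circle c r t)) 0 (2 * PI)).
  { replace (CInt (fun t => f (circle c r t)) 0 (2 * PI)) with
    (- Ci * (Ci * (CInt (fun t => f (circle c r t)) 0 (2 * PI) - f c * RtoC (2 * PI - 0))) + f c * RtoC (2 * PI - 0))%C.
    - rewrite HI. ring.
    - assert (CC2 : (Ci * Ci)%C = (- RtoC 1)%C) by (apply C_ext; simpl; ring).
      rewrite Cmult_assoc. replace (- Ci * Ci)%C with (- (Ci * Ci))%C by ring. rewrite CC2. ring. }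
  pose proof PI_RGT_0.
  assert (B : Cmod (CInt (fun t => f (circle c r t)) 0 (2 * PI)) <= 2 * M * Rabs (2 * PI - 0)).
  { apply CInt_bound; auto. }
  rewrite <- E, Cmod_mult, Cmod_R in B. rewrite Rabs_pos_eq in B by lra.
  apply Rmult_le_reg_r with (2 * PI - 0); lra.
Qed.

(** * Removable singularities and division by a zero *)

Lemma cinv_ccont (z : CC) : z <> 0 -> ccont Cinv z.
Proof. intros H. eapply cder_ccont. now apply cder_inv. Qed.

Lemma rcont_inv (u : R -> CC) : (forall t, u t <> 0) -> rcont u -> rcont (fun t => (/ u t)%C).
Proof. intros H Hu. apply (rcont_comp Cinv); auto. intros; now apply cinv_ccont. Qed.

Lemma circle_sub_center a t : Cmod (circle a 1 t - a) = 1.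
Proof.
  unfold circle. replace (a + 1 * circ t - a)%C with (circ t) by ring. apply Cmod_circ.
Qed.

Lemma circle_sub_lower a w t : Cmod (w - a) < 1 -> 1 - Cmod (w - a) <= Cmod (circle a 1 t - w).
Proof.
  intros H. pose proof (Cmod_le_via (circle a 1 t) w a). rewrite circle_sub_center in H0. lra.
Qed.

Lemma circle_sub_neq a w t : Cmod (w - a) < 1 -> (circle a 1 t - w)%C <> 0.
Proof. intros H. apply <- Cmod_gt_0. pose proof (circle_sub_lower a w t H). lra. Qed.

Lemma rcont_circle_inv a w : Cmod (w - a) < 1 -> rcont (fun t => (/ (circle a 1 t - w))%C).
Proof.
  intros H. apply rcont_inv. intros t; now apply circle_sub_neq.
  apply rcont_minus. apply rcont_circle. apply rcont_const.
Qed.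

Lemma Rcont_bounded (u : R -> CC) a b : rcont u -> exists M, 0 < M /\
  forall t, Rmin a b <= t <= Rmax a b -> Cmod (u t) <= M.
Proof.
  intros Hu.
  assert (S : forall g, (forall t, continuous g t) -> exists M, forall t, Rmin a b <= t <= Rmax a b -> Rabs (g t) <= M).
  { intros g Hg. destruct (continuity_ab_maj (fun t => Rabs (g t)) (Rmin a b) (Rmax a b)) as [M [HM _]].
    - apply Rminmax.
    - intros c _. apply continuity_pt_filterlim. apply (continuous_comp g Rabs). apply Hg. apply continuous_Rabs.
    - exists (Rabs (g M)). exact HM. }
  destruct (S (fun t => Re (u t))) as [M1 H1]. { intros; apply Hu. }
  destruct (S (fun t => Im (u t))) as [M2 H2]. { intros; apply Hu. }
  exists (Rabs M1 + Rabs M2 + 1). split.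
  - pose proof (Rabs_pos M1). pose proof (Rabs_pos M2). lra.
  - intros t Ht. eapply Rle_trans. apply Cmod_le_Re_Im. specialize (H1 t Ht). specialize (H2 t Ht).
    pose proof (Rle_abs M1). pose proof (Rle_abs M2). lra.
Qed.

Definition cauchy_transform (phi : R -> CC) (a w : CC) : CC :=
  CInt (fun t => phi t * / (circle a 1 t - w))%C 0 (2 * PI).

Lemma cauchy_transform_cdiff phi a : rcont phi -> cdiff (cauchy_transform phi a) a.
Proof.
  intros Hphi.
  exists (CInt (fun t => phi t * (/ (circle a 1 t - a) * / (circle a 1 t - a)))%C 0 (2 * PI)).
  destruct (Rcont_bounded phi 0 (2 * PI) Hphi) as [M [HM BM]].
  pose proof PI_RGT_0 as Hpi.
  set (K0 := 2 * (2 * M) * (2 * PI)).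
  assert (HK0 : 0 < K0) by (unfold K0; nra).
  intros eps Heps. exists (Rmin (/ 2) (eps / K0)). split.
  { apply Rmin_pos. lra. now apply Rdiv_lt_0_compat. }
  intros w Hw.
  assert (H1 : Cmod (w - a) < / 2) by (eapply Rlt_le_trans; [exact Hw|apply Rmin_l]).
  assert (H2 : Cmod (w - a) < eps / K0) by (eapply Rlt_le_trans; [exact Hw|apply Rmin_r]).
  assert (Ha : Cmod (a - a) < 1) by (rewrite Cmod_self; lra).
  assert (Hw1 : Cmod (w - a) < 1) by lra.
  unfold cauchy_transform.
  (* With s on the circle, 1/(s - w) - 1/(s - a) - (w - a)/(s - a)^2 = (w - a)^2 / ((s - w)(s -
     a)^2): the remainder is quadratic in w - a. *)
  assert (E : (CInt (fun t => phi t * / (circle a 1 t - w)) 0 (2 * PI) -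
     CInt (fun t => phi t * / (circle a 1 t - a)) 0 (2 * PI) -
     CInt (fun t => phi t * (/ (circle a 1 t - a) * / (circle a 1 t - a))) 0 (2 * PI) * (w - a))%C =
    ((w - a) * (w - a) * CInt (fun t => phi t * (/ (circle a 1 t - w) * (/ (circle a 1 t - a) * / (circle a 1 t - a)))) 0 (2 * PI))%C).
  { assert (R0 := rcont_circle_inv a w Hw1). assert (R1 := rcont_circle_inv a a Ha).
    rewrite (Cmult_comm _ (w - a)).
    rewrite <- !CInt_scal by (repeat (apply rcont_mult; auto)).
    rewrite <- CInt_minus by (repeat (apply rcont_mult; auto)).
    rewrite <- CInt_minus.
    - apply CInt_ext. intros t. field. split; now apply circle_sub_neq.
    - apply (rcont_minus (fun t => phi t * / (circle a 1 t - w))%C (fun t => phi t * / (circle a 1 t - a))%C);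
        apply rcont_mult; auto.
    - apply (rcont_mult (fun _ => (w - a)%C)). apply rcont_const. repeat (apply rcont_mult; auto). }
  rewrite E, !Cmod_mult.
  assert (B : Cmod (CInt (fun t => phi t * (/ (circle a 1 t - w) * (/ (circle a 1 t - a) * / (circle a 1 t - a))))%C 0 (2 * PI)) <= K0).
  { unfold K0. eapply Rle_trans. apply (CInt_bound _ 0 (2 * PI) (2 * M)).
    - assert (R0 := rcont_circle_inv a w Hw1). assert (R1 := rcont_circle_inv a a Ha).
      repeat (apply rcont_mult; auto).
    - intros t Ht. rewrite !Cmod_mult, !Cmod_inv by now apply circle_sub_neq.
      rewrite circle_sub_center, Rinv_1, !Rmult_1_r.
      pose proof (circle_sub_lower a w t Hw1). specialize (BM t Ht).
      assert (/ Cmod (circle a 1 t - w) <= 2).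
      { replace 2 with (/ / 2) by field. apply Rinv_le_contravar; lra. }
      pose proof (Cmod_ge_0 (phi t)). 
      assert (0 < / Cmod (circle a 1 t - w)) by (apply Rinv_0_lt_compat; lra). nra.
    - rewrite Rabs_pos_eq by lra. lra. }
  apply (Rmult_lt_compat_r K0) in H2; auto. unfold Rdiv in H2. rewrite Rmult_assoc, Rinv_l, Rmult_1_r in H2 by lra.
  pose proof (Cmod_ge_0 (w - a)).
  set (x := Cmod (w - a)) in *. set (y := Cmod (CInt _ _ _)) in *.
  assert (x * y <= eps) by (apply Rle_trans with (x * K0); [apply Rmult_le_compat_l|]; lra).
  nra.
Qed.

(** Let H and C be the Cauchy transforms of h dz and dz. The vanishing integral of the slope at w
    gives H(w) = h(w) C(w). Since H(a) = 0, H(w) is w - a times the transform of [psi], so near a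
    the quotient h(w)/(w - a) equals a quotient of two transforms, both differentiable at a. Only
    C(a), which is 2 pi i, has to be computed. *)
Lemma slope_cdiff_at h a l : entire h -> h a = 0 -> cder h a l -> cdiff (slope h a l) a.
Proof.
  intros Hh Ha Hl.
  set (ga := fun t => (RtoC 1 * (Ci * circ t))%C).
  assert (Rga : rcont ga).
  { apply (rcont_mult (fun _ => RtoC 1)). apply rcont_const. apply (rcont_mult (fun _ => Ci)). apply rcont_const. apply rcont_circ. }
  set (hg := fun t => (h (circle a 1 t) * ga t)%C).
  assert (Rhg : rcont hg).
  { apply (rcont_mult (fun t => h (circle a 1 t))); auto. apply (rcont_comp h). intros; now apply entire_ccont. apply rcont_circle. }
  assert (Ha1 : Cmod (a - a) < 1) by (rewrite Cmod_self; lra).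
  assert (Cauchy : forall w, Cmod (w - a) < 1 -> cauchy_transform hg a w = (h w * cauchy_transform ga a w)%C).
  { intros w Hw. destruct (slope_circle_int h w a 1 Hh) as [m [_ HI]].
    rewrite (CInt_ext _ (fun t => hg t * / (circle a 1 t - w) - h w * (ga t * / (circle a 1 t - w)))%C) in HI.
    2: { intros t. rewrite slope_off. unfold hg, ga. field. now apply circle_sub_neq.
         intros E. apply (circle_sub_neq a w t Hw). rewrite E. ring. }
    assert (R0 := rcont_circle_inv a w Hw).
    rewrite CInt_minus in HI.
    - rewrite CInt_scal in HI by now apply rcont_mult. apply Ceq_minus. exact HI.
    - now apply rcont_mult.
    - apply (rcont_mult (fun _ => h w)). apply rcont_const. now apply rcont_mult. }
  set (psi := fun t => (hg t * / (circle a 1 t - a))%C).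
  assert (Rpsi : rcont psi) by (apply rcont_mult; auto; now apply rcont_circle_inv).
  assert (HK : forall w, Cmod (w - a) < 1 -> cauchy_transform hg a w = ((w - a) * cauchy_transform psi a w)%C).
  { intros w Hw.
    assert (E0 : cauchy_transform hg a a = 0) by (rewrite Cauchy, Ha by assumption; ring).
    assert (R0 := rcont_circle_inv a w Hw). assert (R1 := rcont_circle_inv a a Ha1).
    replace (cauchy_transform hg a w) with (cauchy_transform hg a w - cauchy_transform hg a a)%C by (rewrite E0; ring).
    unfold cauchy_transform. rewrite <- CInt_minus by now apply rcont_mult.
    rewrite <- CInt_scal by now apply rcont_mult.
    apply CInt_ext. intros t. unfold psi. field. split; now apply circle_sub_neq. }
  destruct (cauchy_transform_cdiff psi a Rpsi) as [k1 Hk1].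
  destruct (cauchy_transform_cdiff ga a Rga) as [k2 Hk2].
  assert (Na : cauchy_transform ga a a <> 0).
  { unfold cauchy_transform. rewrite (CInt_ext _ (fun _ => Ci)).
    2: { intros t. unfold ga. unfold circle. field. replace (a + circ t - a)%C with (circ t) by ring. apply circ_neq_0. }
    rewrite CInt_const. intros E. apply (f_equal Cmod) in E. rewrite Cmod_mult, Cmod_Ci, Cmod_R, Cmod_0 in E.
    pose proof PI_RGT_0. rewrite Rabs_pos_eq in E by lra. lra. }
  destruct (cder_div _ _ _ _ _ Na Hk1 Hk2) as [k Hk].
  destruct (cder_ccont _ _ _ Hk2 (Cmod (cauchy_transform ga a a))) as [d [Hd Bd]].
  { apply -> Cmod_gt_0. exact Na. }
  set (V := fun w => (cauchy_transform psi a w / cauchy_transform ga a w)%C) in *.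
  set (d1 := Rmin 1 d). assert (Hd1 : 0 < d1) by (apply Rmin_pos; lra).
  assert (HV : forall w, Cmod (w - a) < d1 -> h w = ((w - a) * V w)%C).
  { intros w Hw.
    assert (W1 : Cmod (w - a) < 1) by (eapply Rlt_le_trans; [exact Hw|apply Rmin_l]).
    assert (W2 : Cmod (w - a) < d) by (eapply Rlt_le_trans; [exact Hw|apply Rmin_r]).
    assert (Nw : cauchy_transform ga a w <> 0).
    { intros E. specialize (Bd w W2). rewrite E in Bd. replace (0 - cauchy_transform ga a a)%C with (- cauchy_transform ga a a)%C in Bd by ring.
      rewrite Cmod_opp in Bd. lra. }
    unfold V. unfold Cdiv. rewrite Cmult_assoc, <- HK, Cauchy by assumption. field. exact Nw. }
  exists k. apply (cder_ext_loc V _ a k d1); auto.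
  intros w Hw. destruct (Ceq_dec w a) as [->|Hwa].
  - rewrite slope_at. apply (cder_unique h a); auto.
    apply (cder_ext_loc (fun w => (w - a) * V w)%C h a _ d1 Hd1).
    + intros; symmetry; auto.
    + replace (V a) with ((1 - 0) * V a + (a - a) * k)%C by ring.
      apply (cder_mult (fun w => w - a)%C V); auto.
      apply (cder_minus (fun w => w) (fun _ => a)). apply cder_id. apply cder_const.
  - rewrite slope_off, Ha, (HV w Hw) by assumption. field. now apply Cminus_eq_contra.
Qed.

Lemma entire_slope f a l : entire f -> cder f a l -> entire (slope f a l).
Proof.
  intros Hf Hl. apply entire_cdiff. intros z. destruct (Ceq_dec z a) as [->|Hz].
  - set (h := fun w => (f w - f a)%C).
    destruct (slope_cdiff_at h a l) as [k Hk].
    + apply entire_minus; auto. apply entire_const.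
    + unfold h. ring.
    + replace l with (l - 0)%C by ring. apply (cder_minus f (fun _ => f a)); auto. apply cder_const.
    + exists k. eapply cder_ext; [|exact Hk]. intros w. unfold slope.
      destruct (Ceq_dec w a); auto. unfold h. f_equal. ring.
  - apply slope_cdiff; auto. rewrite entire_cdiff in Hf. auto.
Qed.

Lemma entire_div h (a : CC) : entire h -> h a = 0 ->
  exists v, entire v /\ forall z, h z = ((z - a) * v z)%C.
Proof.
  intros Hh Ha. assert (H := Hh). rewrite entire_cdiff in H. destruct (H a) as [l Hl].
  exists (slope h a l). split. now apply entire_slope.
  intros z. rewrite <- slope_mult, Ha. ring.
Qed.

(** Cauchy's estimate, as the mean value bound for the slope on the unit circle: one factor 2 comes
    from that bound, the other from h(z) - h(a). *)
Lemma derivative_bound h a l M : entire h -> cder h a l ->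
  (forall z, Cmod (z - a) <= 1 -> Cmod (h z) <= M) -> Cmod l <= 4 * M.
Proof.
  intros Hh Hl HM. rewrite <- (slope_at h a l).
  replace (4 * M) with (2 * (2 * M)) by ring.
  apply (mean_value_bound _ a 1). now apply entire_slope. lra.
  intros z Hz. assert (z <> a) by (intros ->; rewrite Cmod_self in Hz; lra).
  rewrite slope_off, Cmod_div, Hz by (auto; now apply Cminus_eq_contra).
  assert (A1 : Cmod (h z) <= M) by (apply HM; lra).
  assert (A2 : Cmod (h a) <= M) by (apply HM; rewrite Cmod_self; lra).
  pose proof (Cmod_sub_le (h z) (h a)). lra.
Qed.

(** * Factorization of zeros *)

Lemma disc_cover (R0 : R) (delta : CC -> R) : (forall z, 0 < delta z) ->
  exists l : list CC, forall z, Cmod z <= R0 -> exists t, In t l /\ Cmod (z - t) < delta t.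
Proof.
  intros Hd.
  (* Halved because the covering lemma controls the two coordinates separately, and their distances
     are added. *)
  assert (Hd2 : forall z, 0 < delta z / 2) by (intros z; specialize (Hd z); lra).
  set (dl := fun t : Tn 2 R => mkposreal _ (Hd2 (fst t, fst (snd t)))).
  (* [compactness_list] provides its finite list only under a double negation. *)
  apply NNPP. intros Hn.
  apply (compactness_list 2 (- R0, (- R0, tt)) (R0, (R0, tt)) dl).
  intros [l Hl]. apply Hn.
  exists (map (fun t : Tn 2 R => (fst t, fst (snd t)) : CC) l).
  intros z Hz. destruct (Hl (Re z, (Im z, tt))) as [t [Ht [_ Hc]]].
  - simpl. pose proof (re_le_Cmod z) as H1. pose proof (Im_le_Cmod z) as H2.
    apply Rabs_le_between in H1. apply Rabs_le_between in H2. repeat split; lra.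
  - exists (fst t, fst (snd t)). split.
    + apply (in_map (fun t : Tn 2 R => (fst t, fst (snd t)) : CC)). exact Ht.
    + destruct t as [x [y []]]. simpl in *. destruct Hc as [Hx [Hy _]].
      eapply Rle_lt_trans. apply Cmod_le_Re_Im. simpl. unfold Re, Im, Rminus in *. lra.
Qed.

(** Compactness in the one form used below: a parameter that may be shrunk freely has a minimum over
    a finite cover. It stands for the inverse of a bound, for a lower bound, or for a modulus of
    continuity. *)
Lemma disc_local_global (P : R -> CC -> Prop) (R0 : R) :
  (forall m m' z, m' <= m -> P m z -> P m' z) ->
  (forall z, exists d m, 0 < d /\ 0 < m /\ forall w, Cmod (w - z) < d -> Cmod w <= R0 -> P m w) ->
  exists m, 0 < m /\ forall w, Cmod w <= R0 -> P m w.
Proof.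
  intros Hm Hl.
  destruct (choice (fun z (dm : R * R) => 0 < fst dm /\ 0 < snd dm /\
     forall w, Cmod (w - z) < fst dm -> Cmod w <= R0 -> P (snd dm) w)) as [g Hg].
  { intros z. destruct (Hl z) as [d [m H]]. exists (d, m). exact H. }
  destruct (disc_cover R0 (fun z => fst (g z))) as [l Hl']. { intros z. apply Hg. }
  assert (E : exists m, 0 < m /\ forall t, In t l -> m <= snd (g t)).
  { clear Hl'. induction l as [|t l [m [H1 H2]]].
    - exists 1. split. lra. intros t [].
    - exists (Rmin m (snd (g t))). split. apply Rmin_pos; auto. apply Hg.
      intros t' [<-|H]. apply Rmin_r. eapply Rle_trans. apply Rmin_l. auto. }
  destruct E as [m [H1 H2]]. exists m. split; auto.
  intros w Hw. destruct (Hl' w Hw) as [t [Ht Hwt]].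
  apply Hm with (snd (g t)); auto. apply Hg; auto.
Qed.

Lemma disc_bounded f R0 : (forall z, ccont f z) ->
  exists M, 0 < M /\ forall z, Cmod z <= R0 -> Cmod (f z) <= M.
Proof.
  intros Hf. destruct (disc_local_global (fun m z => Cmod (f z) * m <= 1) R0) as [m [H1 H2]].
  - intros m m' z Hm H. pose proof (Cmod_ge_0 (f z)). nra.
  - intros z. destruct (Hf z 1 Rlt_0_1) as [d [Hd B]]. pose proof (Cmod_ge_0 (f z)).
    exists d, (/ (Cmod (f z) + 1)). repeat split; auto. apply Rinv_0_lt_compat; lra.
    intros w Hw _. specialize (B w Hw).
    assert (Cmod (f w) <= Cmod (f z) + 1).
    { pose proof (Cmod_sub_ge (f w) (f z)). lra. }
    apply Rmult_le_reg_r with (Cmod (f z) + 1). lra. rewrite Rmult_assoc, Rinv_l by lra. lra.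
  - exists (/ m). split. now apply Rinv_0_lt_compat. intros z Hz. specialize (H2 z Hz).
    apply Rmult_le_reg_r with m; auto. rewrite Rinv_l; lra.
Qed.

Lemma disc_bounded_below f R0 : (forall z, ccont f z) -> (forall z, Cmod z <= R0 -> f z <> 0) ->
  exists m, 0 < m /\ forall z, Cmod z <= R0 -> m <= Cmod (f z).
Proof.
  intros Hf Hnz. apply (disc_local_global (fun m z => m <= Cmod (f z)) R0).
  - intros; lra.
  - intros z. destruct (Ceq_dec (f z) 0) as [E|NE].
    + assert (Hz : R0 < Cmod z).
      { destruct (Rlt_dec R0 (Cmod z)); auto. exfalso. apply (Hnz z); auto. lra. }
      exists (Cmod z - R0), 1. repeat split; try lra. intros w Hw Hw2. exfalso.
      pose proof (Cmod_sub_ge z w). rewrite Cmod_minus_sym in H. lra.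
    + assert (Hp : 0 < Cmod (f z)) by (apply -> Cmod_gt_0; exact NE).
      destruct (Hf z (Cmod (f z) / 2)) as [d [Hd B]]. lra.
      exists d, (Cmod (f z) / 2). repeat split; auto. lra. intros w Hw _. specialize (B w Hw).
      pose proof (Cmod_sub_ge (f z) (f w)). rewrite Cmod_minus_sym in H. lra.
Qed.

Lemma disc_uniform f R0 eps : (forall z, ccont f z) -> 0 < eps ->
  exists d, 0 < d /\ forall z w, Cmod z <= R0 -> Cmod (w - z) < d -> Cmod (f w - f z) < eps.
Proof.
  intros Hf He.
  destruct (disc_local_global (fun d z => forall w, Cmod (w - z) < d -> Cmod (f w - f z) < eps) R0) as [m [H1 H2]].
  - intros m m' z Hm H w Hw. apply H. lra.
  - intros z. destruct (Hf z (eps / 2)) as [d [Hd B]]. lra.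
    exists (d / 2), (d / 2). repeat split; try lra. intros w Hw _ x Hx.
    assert (B1 := B w). assert (B2 := B x).
    pose proof (Cmod_le_via x w z). pose proof (Cmod_le_via (f x) (f z) (f w)).
    rewrite (Cmod_minus_sym (f z)) in H0.
    assert (Cmod (f w - f z) < eps / 2) by (apply B1; lra).
    assert (Cmod (f x - f z) < eps / 2) by (apply B2; lra). lra.
  - exists m. split; auto.
Qed.

Fixpoint prodl (l : list CC) (z : CC) : CC :=
  match l with nil => RtoC 1 | a :: l' => ((z - a) * prodl l' z)%C end.

Lemma entire_prodl l : entire (prodl l).
Proof.
  induction l; simpl. apply entire_const.
  apply (entire_mult (fun z => z - a)%C); auto. apply entire_minus. apply entire_id. apply entire_const.
Qed.

Lemma prodl_zero l (z : CC) : prodl l z = 0 <-> In z l.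
Proof.
  induction l; simpl.
  - split. intros H. exfalso. exact (C1_nz H). intros [].
  - rewrite <- IHl. split.
    + intros H. destruct (Ceq_dec z a) as [->|N]. auto. right.
      apply NNPP. intros N2. apply (Cmult_neq_0 (z - a) (prodl l z)); auto. now apply Cminus_eq_contra.
    + intros [->|H]. ring. rewrite H. ring.
Qed.

Lemma divide_distinct h l : entire h -> NoDup l -> (forall a : CC, In a l -> h a = 0) ->
  exists v, entire v /\ forall z, h z = (prodl l z * v z)%C.
Proof.
  intros Hh Hl Hz. induction l as [|a l IH].
  - exists h. split; auto. intros z; simpl; ring.
  - inversion_clear Hl. destruct IH as [v [Hv E]]; auto. { intros; apply Hz; now right. }
    destruct (entire_div v a Hv) as [w [Hw Ew]].
    { apply NNPP. intros N. apply (Cmult_neq_0 (prodl l a) (v a)); auto.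
      rewrite prodl_zero. auto. rewrite <- E. apply Hz. now left. }
    exists w. split; auto. intros z. rewrite E, Ew. simpl. ring.
Qed.

Lemma prodl_lower l (z : CC) r : 0 <= r -> (forall a : CC, In a l -> r <= Cmod (z - a)) -> r ^ length l <= Cmod (prodl l z).
Proof.
  intros Hr H. induction l; simpl. rewrite Cmod_1; lra.
  rewrite Cmod_mult. apply Rmult_le_compat; auto. now apply pow_le. apply H; now left.
  apply IHl. intros; apply H; now right.
Qed.

Lemma prodl_upper l (z : CC) r : 0 <= r -> (forall a : CC, In a l -> Cmod (z - a) <= r) -> Cmod (prodl l z) <= r ^ length l.
Proof.
  intros Hr H. induction l; simpl. rewrite Cmod_1; lra.
  rewrite Cmod_mult. apply Rmult_le_compat; auto using Cmod_ge_0. apply H; now left.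
  apply IHl. intros; apply H; now right.
Qed.

(** The circle of radius 2 R0 + 1 about c stays at distance at least 1 from all roots, so there |v|
    <= |h|. *)
Lemma quotient_bound h l v R0 (c : CC) M : entire v -> 0 <= R0 ->
  (forall z, h z = (prodl l z * v z)%C) -> (forall a, In a l -> Cmod a <= R0) -> Cmod c <= R0 ->
  (forall z, Cmod (z - c) = 2 * R0 + 1 -> Cmod (h z) <= M) -> Cmod (v c) <= 2 * M.
Proof.
  intros Hv HR E Hl Hc HM. apply (mean_value_bound v c (2 * R0 + 1)); auto. lra.
  intros z Hz. specialize (HM z Hz). rewrite E, Cmod_mult in HM.
  assert (1 <= Cmod (prodl l z)).
  { rewrite <- (pow1 (length l)). apply prodl_lower. lra. intros a Ha. specialize (Hl a Ha).
    pose proof (Cmod_le_via z a c). pose proof (Cmod_sub_le a c). lra. }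
  pose proof (Cmod_ge_0 (v z)). nra.
Qed.

(** Jensen's inequality without logarithms: the circle of radius 6 R0 about c is at distance at
    least 4 R0 from each root, while c is within 2 R0 of it. So each root gains a factor 2. *)
Lemma jensen h l v R0 (c : CC) M : entire v -> 0 < R0 ->
  (forall z, h z = (prodl l z * v z)%C) -> (forall a, In a l -> Cmod a <= R0) -> Cmod c <= R0 ->
  (forall z, Cmod (z - c) = 6 * R0 -> Cmod (h z) <= M) -> 2 ^ length l * Cmod (h c) <= 2 * M.
Proof.
  intros Hv HR E Hl Hc HM.
  set (k := length l).
  assert (Hr : 0 < (4 * R0) ^ k) by (apply pow_lt; lra).
  assert (B : Cmod (v c) <= 2 * (M / (4 * R0) ^ k)).
  { apply (mean_value_bound v c (6 * R0)); auto. lra.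
    intros z Hz. specialize (HM z Hz). rewrite E, Cmod_mult in HM.
    assert ((4 * R0) ^ k <= Cmod (prodl l z)).
    { apply prodl_lower. lra. intros a Ha. specialize (Hl a Ha).
      pose proof (Cmod_le_via z a c). pose proof (Cmod_sub_le a c). lra. }
    apply Rmult_le_reg_r with ((4 * R0) ^ k); auto. unfold Rdiv. rewrite Rmult_assoc, Rinv_l by lra.
    pose proof (Cmod_ge_0 (v z)). nra. }
  assert (U : Cmod (prodl l c) <= (2 * R0) ^ k).
  { apply prodl_upper. lra. intros a Ha. specialize (Hl a Ha). pose proof (Cmod_sub_le c a). lra. }
  rewrite E, Cmod_mult.
  assert (Q : (4 * R0) ^ k = 2 ^ k * (2 * R0) ^ k) by (rewrite <- Rpow_mult_distr; f_equal; ring).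
  rewrite Q in B, Hr.
  assert (0 < 2 ^ k) by (apply pow_lt; lra). assert (0 < (2 * R0) ^ k) by (apply pow_lt; lra).
  apply Rle_trans with (2 ^ k * ((2 * R0) ^ k * (2 * (M / (2 ^ k * (2 * R0) ^ k))))).
  - apply Rmult_le_compat_l. lra. apply Rmult_le_compat; auto using Cmod_ge_0.
  - right. field. split; lra.
Qed.

Lemma pow2_unbounded K : exists N : nat, K < 2 ^ N.
Proof.
  destruct (Pow_x_infinity 2) with (b := Rabs K + 1) as [N HN]. rewrite Rabs_pos_eq; lra.
  exists N. specialize (HN N (le_n N)). rewrite Rabs_pos_eq in HN by (apply pow_le; lra).
  pose proof (Rle_abs K). lra.
Qed.

(** N is fixed before h, because the count must hold for all maps near a given one at once. *)
Lemma jensen_length R0 m M : 0 < m ->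
  exists N : nat, forall h l v (c : CC), entire v -> 0 < R0 ->
  (forall z, h z = (prodl l z * v z)%C) -> (forall a, In a l -> Cmod a <= R0) -> Cmod c <= R0 ->
  (forall z, Cmod (z - c) = 6 * R0 -> Cmod (h z) <= M) -> m <= Cmod (h c) -> (length l <= N)%nat.
Proof.
  intros Hm. destruct (pow2_unbounded (2 * M / m)) as [N HN]. exists N.
  intros h l v c Hv HR E Hl Hc HM Hmc.
  destruct (Nat.le_gt_cases (length l) N) as [|Hgt]; auto. exfalso.
  pose proof (jensen h l v R0 c M Hv HR E Hl Hc HM) as J.
  assert (2 ^ N <= 2 ^ length l) by (apply Rle_pow; [lra|lia]).
  apply (Rmult_lt_compat_r m) in HN; auto. replace (2 * M / m * m) with (2 * M) in HN by (field; lra).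
  assert (0 < 2 ^ N) by (apply pow_lt; lra).
  assert (2 ^ N * m <= 2 ^ length l * Cmod (h c)) by (apply Rmult_le_compat; lra). lra.
Qed.

Lemma distinct_zeros_bound R0 m M : 0 < m ->
  exists N : nat, forall h l (c : CC), entire h -> 0 < R0 -> NoDup l ->
  (forall a : CC, In a l -> h a = 0 /\ Cmod a <= R0) -> Cmod c <= R0 ->
  (forall z, Cmod (z - c) = 6 * R0 -> Cmod (h z) <= M) -> m <= Cmod (h c) -> (length l <= N)%nat.
Proof.
  intros Hm. destruct (jensen_length R0 m M Hm) as [N HN]. exists N.
  intros h l c Hh HR Hl Hz Hc HM Hmc.
  destruct (divide_distinct h l Hh Hl) as [v [Hv E]]. { intros; now apply Hz. }
  apply (HN h l v c); auto. intros; now apply Hz.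
Qed.

Lemma zero_factorization h R0 (c : CC) : entire h -> 0 < R0 -> Cmod c <= R0 -> h c <> 0 ->
  exists l u, entire u /\ (forall z, h z = (prodl l z * u z)%C) /\
    (forall a, In a l -> Cmod a <= R0) /\ (forall z, Cmod z <= R0 -> u z <> 0).
Proof.
  intros Hh HR Hc Hnz. apply NNPP. intros Hno.
  (* If a zero in the disc always remained, linear factors could be split off without end, against
     [jensen_length]. *)
  assert (L : forall k, exists l u, length l = k /\ entire u /\ (forall z, h z = (prodl l z * u z)%C) /\
    (forall a, In a l -> Cmod a <= R0)).
  { induction k.
    - exists nil, h. repeat split; auto. intros; simpl; ring. intros a [].
    - destruct IHk as [l [u [Hk [Hu [E Hl]]]]].
      assert (Hz : exists z, Cmod z <= R0 /\ u z = 0).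
      { apply NNPP. intros N. apply Hno. exists l, u. repeat split; auto. intros z Hz Hz0. apply N. eauto. }
      destruct Hz as [a [Ha Ha0]]. destruct (entire_div u a Hu Ha0) as [w [Hw Ew]].
      exists (a :: l), w. simpl. repeat split; auto.
      + intros z. rewrite E, Ew. ring.
      + intros b [<-|Hb]; auto. }
  destruct (disc_bounded h (7 * R0)) as [M [HM BM]]. { intros; now apply entire_ccont. }
  destruct (jensen_length R0 (Cmod (h c)) M) as [N HN]. { apply -> Cmod_gt_0. exact Hnz. }
  destruct (L (S N)) as [l [u [Hk [Hu [E Hl]]]]].
  assert (length l <= N)%nat; [|lia]. apply (HN h l u c); auto; try lra.
  intros z Hz. apply BM. pose proof (Cmod_triangle (z - c) c).
  replace (z - c + c)%C with z in H by ring. lra.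
Qed.

(* The quantitative form survives pointwise limits, unlike the mere absence of new zeros. *)
Lemma zero_stability h l u R0 : entire h -> entire u -> 0 < R0 ->
  (forall z, h z = (prodl l z * u z)%C) ->
  (forall a, In a l -> Cmod a <= R0) -> (forall z, Cmod z <= R0 -> u z <> 0) ->
  exists d eps, 0 < d /\ 0 < eps /\
  forall G v, entire v -> (forall z, G z = (prodl l z * v z)%C) ->
   (forall z, Cmod z <= 3 * R0 + 1 -> Cmod (G z) <= eps) ->
   forall z, Cmod z <= R0 -> d * Cmod (prodl l z) <= Cmod (h z + G z).
Proof.
  intros Hh Hu HR E Hl Hnz.
  destruct (disc_bounded_below u R0) as [m [Hm Bm]]; auto. { intros; now apply entire_ccont. }
  (* [quotient_bound] doubles m / 4 to a bound m / 2 for |v|, which leaves |u + v| >= m / 2. It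
     needs G on circles of radius 2 R0 + 1 about points of the disc, hence the radius 3 R0 + 1. *)
  exists (m / 2), (m / 4). repeat split; try lra.
  intros G v Hv EG HG z Hz.
  assert (Bv : Cmod (v z) <= 2 * (m / 4)).
  { apply (quotient_bound G l v R0 z); auto. lra. intros w Hw. apply HG.
    pose proof (Cmod_triangle (w - z) z). replace (w - z + z)%C with w in H by ring. lra. }
  rewrite E, EG. replace (prodl l z * u z + prodl l z * v z)%C with (prodl l z * (u z - - v z))%C by ring.
  rewrite Cmod_mult. pose proof (Cmod_sub_ge (u z) (- v z)). rewrite Cmod_opp in H.
  specialize (Bm z Hz). pose proof (Cmod_ge_0 (prodl l z)). nra.
Qed.

(** * Real even polynomials *)

Fixpoint evr (c : list R) (s : CC) : CC :=
  match c with nil => RtoC 0 | a :: c' => (RtoC a + s * evr c' s)%C end.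

(** A real polynomial in z^2 is real and even by construction, so perturbations carry no symmetry
    condition. *)
Definition ev (c : list R) (z : CC) : CC := evr c (z * z).

(** This norm is submultiplicative, and on lists of bounded length it dominates every seminorm of
    the space; therefore lengths are tracked along with norms. *)
Fixpoint nrm (c : list R) : R :=
  match c with nil => 0 | a :: c' => Rabs a + nrm c' end.

Fixpoint padd (p q : list R) : list R :=
  match p, q with
  | nil, _ => q
  | _, nil => p
  | a :: p', b :: q' => (a + b) :: padd p' q'
  end.

Definition pscal (a : R) (q : list R) : list R := map (fun x => a * x) q.

Fixpoint pmul (p q : list R) : list R :=
  match p with nil => nil | a :: p' => padd (pscal a q) (0 :: pmul p' q) end.

Fixpoint ppow (p : list R) (n : nat) : list R :=
  match n with O => 1 :: nil | S m => pmul p (ppow p m) end.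

Lemma evr_add p q s : evr (padd p q) s = (evr p s + evr q s)%C.
Proof.
  revert q; induction p as [|a p IH]; intros [|b q]; simpl; try ring.
  rewrite IH, RtoC_plus. ring.
Qed.

Lemma evr_scal a q s : evr (pscal a q) s = (RtoC a * evr q s)%C.
Proof. induction q; simpl. ring. rewrite IHq, RtoC_mult. ring. Qed.

Lemma evr_mul p q s : evr (pmul p q) s = (evr p s * evr q s)%C.
Proof.
  induction p; simpl. ring. rewrite evr_add, evr_scal. simpl. rewrite IHp. ring.
Qed.

Lemma ev_add p q z : ev (padd p q) z = (ev p z + ev q z)%C.
Proof. apply evr_add. Qed.
Lemma ev_mul p q z : ev (pmul p q) z = (ev p z * ev q z)%C.
Proof. apply evr_mul. Qed.
Lemma ev_pow p n z : ev (ppow p n) z = (ev p z ^ n)%C.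
Proof. induction n; simpl. unfold ev; simpl. ring. rewrite ev_mul, IHn. ring. Qed.

Lemma nrm_pos c : 0 <= nrm c.
Proof. induction c; simpl. lra. pose proof (Rabs_pos a). lra. Qed.

Lemma nrm_add p q : nrm (padd p q) <= nrm p + nrm q.
Proof.
  revert q; induction p as [|a p IH]; intros [|b q]; simpl; try lra.
  pose proof (Rabs_triang a b). specialize (IH q). lra.
Qed.

Lemma nrm_scal a q : nrm (pscal a q) = Rabs a * nrm q.
Proof. induction q; simpl. ring. rewrite IHq, Rabs_mult. ring. Qed.

Lemma nrm_mul p q : nrm (pmul p q) <= nrm p * nrm q.
Proof.
  induction p; simpl. lra.
  eapply Rle_trans. apply nrm_add. simpl. rewrite nrm_scal, Rabs_R0. lra.
Qed.

Lemma length_add p q : (length (padd p q) <= Nat.max (length p) (length q))%nat.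
Proof.
  revert q; induction p as [|a p IH]; intros [|b q]; simpl; try lia.
  specialize (IH q). lia.
Qed.

Lemma length_mul p q : (length (pmul p q) <= length p + length q)%nat.
Proof.
  induction p; simpl. lia.
  pose proof (length_add (pscal a q) (0 :: pmul p q)). unfold pscal in H at 2.
  rewrite length_map in H. simpl in H. lia.
Qed.

Lemma evr_conj c s : evr c (Cconj s) = Cconj (evr c s).
Proof.
  induction c; simpl. apply C_ext; simpl; ring.
  rewrite IHc, Cplus_conj, Cmult_conj. f_equal. apply C_ext; simpl; ring.
Qed.

Lemma ev_real c : real_map (ev c).
Proof. intros z. unfold ev. rewrite <- Cmult_conj. apply evr_conj. Qed.

Lemma ev_even c : even_map (ev c).
Proof. intros z. unfold ev. f_equal. ring. Qed.

Lemma conj_fixed (y : CC) : Cconj y = y <-> Im y = 0.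
Proof.
  split.
  - intros H. apply (f_equal Im) in H. rewrite im_conj in H. lra.
  - intros H. apply C_ext. apply re_conj. rewrite im_conj. lra.
Qed.

(** z^2 is real exactly on the two axes, where real even maps take real values; only there are
    interpolation data constrained. *)
Definition on_axes (z : CC) : Prop := Im (z * z) = 0.

Lemma ev_on_axes c z : on_axes z -> Im (ev c z) = 0.
Proof.
  intros H. apply conj_fixed. unfold ev. rewrite <- evr_conj. f_equal. now apply conj_fixed.
Qed.

Lemma evr_bound c (s : CC) r : 1 <= r -> Cmod s <= r -> Cmod (evr c s) <= nrm c * r ^ length c.
Proof.
  intros Hr Hs. induction c; simpl. rewrite Cmod_0; lra.
  eapply Rle_trans. apply Cmod_triangle. rewrite Cmod_mult, Cmod_R.
  pose proof (Rabs_pos a). pose proof (nrm_pos c). pose proof (Cmod_ge_0 s). pose proof (Cmod_ge_0 (evr c s)).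
  assert (1 <= r ^ length c) by now apply pow_R1_Rle.
  assert (Cmod s * Cmod (evr c s) <= r * (nrm c * r ^ length c)) by (apply Rmult_le_compat; auto).
  assert (1 <= r * r ^ length c) by nra. nra.
Qed.

Lemma entire_evr c : entire (evr c).
Proof.
  induction c; simpl. apply entire_const. apply entire_plus. apply entire_const.
  apply (entire_mult (fun s => s)); auto. apply entire_id.
Qed.

Lemma entire_ev c : entire (ev c).
Proof.
  apply (entire_comp (evr c) (fun z => z * z)%C). apply entire_evr.
  apply (entire_mult (fun s => s)); apply entire_id.
Qed.

Fixpoint embed (c : list R) : list CC :=
  match c with nil => nil | a :: c' => RtoC a :: RtoC 0 :: embed c' end.

Lemma poly_map_embed c : poly_map (embed c) = ev c.
Proof.
  apply functional_extensionality. intros z. unfold ev.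
  induction c; simpl. reflexivity. rewrite IHc. ring.
Qed.

(* The roots of [symp a], as a polynomial in [s = z^2], are [a^2] and its conjugate. *)
Definition symp (a : CC) : list R := (Cmod (a * a) ^ 2) :: (- 2 * Re (a * a)) :: 1 :: nil.

Lemma ev_symp a z : ev (symp a) z = ((z * z - a * a) * (z * z - Cconj (a * a)))%C.
Proof.
  unfold ev, symp. set (s := (z * z)%C). set (t := (a * a)%C). rewrite Cmod2_alt.
  clearbody s t. destruct s as [s1 s2], t as [t1 t2].
  apply C_ext; cbn -[pow IZR]; ring.
Qed.

Fixpoint qa (A : list CC) : list R :=
  match A with nil => 1 :: nil | a :: A' => pmul (symp a) (qa A') end.

(* The nodes are the points a, -a, conj a, -conj a with a in A. *)
Definition node (A : list CC) (z : CC) : Prop :=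
  exists a, In a A /\ ((z * z)%C = (a * a)%C \/ (z * z)%C = Cconj (a * a)).

Lemma ev_qa_cons a A z : ev (qa (a :: A)) z = (ev (symp a) z * ev (qa A) z)%C.
Proof. apply ev_mul. Qed.

Lemma Cmult_eq_0 (a b : CC) : (a * b)%C = 0 -> a = 0 \/ b = 0.
Proof.
  intros H. destruct (Ceq_dec a 0); auto. destruct (Ceq_dec b 0); auto.
  exfalso. now apply (Cmult_neq_0 a b).
Qed.

Lemma ev_qa_zero A z : ev (qa A) z = 0 <-> node A z.
Proof.
  induction A as [|a A IH].
  - split. intros H. exfalso. apply C1_nz. rewrite <- H. unfold ev; simpl; ring. intros [a [[] _]].
  - rewrite ev_qa_cons, ev_symp. split.
    + intros H. apply Cmult_eq_0 in H. destruct H as [H|H].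
      * apply Cmult_eq_0 in H. exists a. split. now left.
        destruct H as [H|H]; [left|right]; now apply Ceq_minus.
      * apply IH in H. destruct H as [b [Hb H]]. exists b. split; auto. now right.
    + intros [b [[<-|Hb] H]].
      * destruct H as [H|H]; apply Ceq_minus in H; rewrite H; ring.
      * rewrite (proj2 IH). ring. exists b; auto.
Qed.

Lemma qa_app A B z : ev (qa (A ++ B)) z = (ev (qa A) z * ev (qa B) z)%C.
Proof.
  induction A. unfold ev at 2; simpl. ring. simpl app. rewrite !ev_qa_cons, IHA. ring.
Qed.

Lemma Csq_eq (z a : CC) : (z * z)%C = (a * a)%C -> z = a \/ z = (- a)%C.
Proof.
  intros H. assert (E : ((z - a) * (z + a))%C = 0).
  { replace ((z - a) * (z + a))%C with (z * z - a * a)%C by ring. rewrite H. ring. }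
  apply Cmult_eq_0 in E. destruct E as [E|E].
  - left. now apply Ceq_minus.
  - right. apply Ceq_minus. rewrite <- E. ring.
Qed.

Lemma node_cases A z : node A z <->
  exists a : CC, In a A /\ (z = a \/ z = (- a)%C \/ z = Cconj a \/ z = (- Cconj a)%C).
Proof.
  split; intros [a [Ha H]]; exists a; split; auto.
  - destruct H as [H|H].
    + apply Csq_eq in H. tauto.
    + rewrite Cmult_conj in H. apply Csq_eq in H. tauto.
  - destruct H as [->|[->|[->| ->]]].
    + now left.
    + left; ring.
    + right. now rewrite Cmult_conj.
    + right. rewrite Cmult_conj. ring.
Qed.

Lemma node_conj A z : node A (Cconj z) <-> node A z.
Proof.
  assert (H : forall z, node A z -> node A (Cconj z)).
  { intros w [a [Ha H]]. exists a. split; auto. rewrite <- Cmult_conj.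
    destruct H as [->| ->]; auto. rewrite Cconj_conj. auto. }
  split; intros Hz; auto. rewrite <- (Cconj_conj z). auto.
Qed.

Lemma node_cons a A z : node (a :: A) z <-> node (a :: nil) z \/ node A z.
Proof.
  split.
  - intros [b [[<-|Hb] H]]. left; exists a; split; auto; now left. right; exists b; auto.
  - intros [[b [[<-|[]] H]]|[b [Hb H]]]; [exists a|exists b]; split; auto. now left. now right.
Qed.

Lemma node_app A B z : node (A ++ B) z <-> node A z \/ node B z.
Proof.
  unfold node. split.
  - intros [b [Hb H]]. apply in_app_or in Hb. destruct Hb; eauto.
  - intros [[b [Hb H]]|[b [Hb H]]]; exists b; split; auto using in_or_app.
Qed.

(** * Small perturbations *)

Record space := Space {
  inF : (CC -> CC) -> Prop;
  sem : nat -> (CC -> CC) -> R;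
  space_frechet : frechet_real_even_entire inF sem;
  space_poly : forall c : list CC, real_map (poly_map c) -> even_map (poly_map c) -> inF (poly_map c);
  space_finer : finer_than_local_uniform inF sem }.

Definition small (X : space) (n : nat) (d : R) (q : CC -> CC) : Prop :=
  forall k, (k <= n)%nat -> sem X k q < d.

Section Space.
Variable X : space.

Lemma inF_entire f : inF X f -> entire f.
Proof. intros H. now apply (proj1 (space_frechet X)). Qed.
Lemma inF_real f : inF X f -> real_map f.
Proof. intros H. now apply (proj1 (space_frechet X)). Qed.
Lemma inF_even f : inF X f -> even_map f.
Proof. intros H. now apply (proj1 (space_frechet X)). Qed.
Lemma inF_add f g : inF X f -> inF X g -> inF X (fadd f g).
Proof. apply (space_frechet X). Qed.
Lemma inF_scal a f : inF X f -> inF X (fscal a f).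
Proof. apply (space_frechet X). Qed.
Lemma sem_pos k f : inF X f -> 0 <= sem X k f.
Proof. apply (space_frechet X). Qed.
Lemma sem_add k f g : inF X f -> inF X g -> sem X k (fadd f g) <= sem X k f + sem X k g.
Proof. apply (space_frechet X). Qed.
Lemma sem_scal k a f : inF X f -> sem X k (fscal a f) = Rabs a * sem X k f.
Proof. apply (space_frechet X). Qed.

Lemma fsub_as_add f g : fsub f g = fadd f (fscal (-1) g).
Proof.
  apply functional_extensionality. intros z. unfold fsub, fadd, fscal.
  replace (RtoC (-1)) with (- RtoC 1)%C by (apply C_ext; simpl; ring). ring.
Qed.

Lemma inF_sub f g : inF X f -> inF X g -> inF X (fsub f g).
Proof. intros. rewrite fsub_as_add. apply inF_add; auto. now apply inF_scal. Qed.

Lemma sem_sub_sym k f g : inF X f -> inF X g -> sem X k (fsub f g) = sem X k (fsub g f).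
Proof.
  intros Hf Hg. replace (fsub f g) with (fscal (-1) (fsub g f)).
  - rewrite sem_scal by now apply inF_sub. rewrite Rabs_left by lra. ring.
  - apply functional_extensionality. intros z. unfold fsub, fscal.
    replace (RtoC (-1)) with (- RtoC 1)%C by (apply C_ext; simpl; ring). ring.
Qed.

Lemma fsub_fadd f q : fsub (fadd f q) f = q.
Proof. apply functional_extensionality. intros z. unfold fsub, fadd. ring. Qed.

Lemma fadd_assoc f q r : fadd (fadd f q) r = fadd f (fadd q r).
Proof. apply functional_extensionality. intros z. unfold fadd. ring. Qed.

Lemma inF_ev c : inF X (ev c).
Proof.
  rewrite <- poly_map_embed. apply (space_poly X); rewrite poly_map_embed.
  apply ev_real. apply ev_even.
Qed.

(** The seminorms are arbitrary, but polynomials of bounded length form a finite-dimensional space: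
    M bounds the seminorms of the monomials z^(2i). The shift by i in [mono] makes the induction on
    the coefficients possible. *)
Lemma sem_ev_bound k L : exists M, 0 < M /\ forall c, (length c <= L)%nat -> sem X k (ev c) <= nrm c * M.
Proof.
  set (mono := fun i c => ev (repeat 0 i ++ c)).
  assert (HM : exists M, 0 < M /\ forall i, (i < L)%nat -> sem X k (mono i (1 :: nil)) <= M).
  { clear. induction L as [|L [M [HM H]]].
    - exists 1. split. lra. intros; lia.
    - exists (M + sem X k (mono L (1 :: nil))). pose proof (sem_pos k _ (inF_ev (repeat 0 L ++ 1 :: nil))) as HP.
      fold (mono L (1 :: nil)) in HP. split. lra. intros i Hi.
      destruct (Nat.eq_dec i L) as [->|]. lra. assert (sem X k (mono i (1 :: nil)) <= M) by (apply H; lia). lra. }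
  destruct HM as [M [HM B]]. exists M. split; auto.
  assert (G : forall c i, (i + length c <= L)%nat -> sem X k (mono i c) <= nrm c * M).
  { induction c as [|a c IH]; intros i Hi; simpl in *.
    - replace (mono i nil) with (fscal 0 (mono i nil)).
      + unfold mono. rewrite sem_scal by apply inF_ev. rewrite Rabs_R0. lra.
      + apply functional_extensionality. intros z. unfold fscal, mono, ev. clear.
        replace (evr (repeat 0 i ++ nil) (z * z)) with (RtoC 0). ring.
        rewrite app_nil_r. induction i; simpl. reflexivity. rewrite <- IHi. ring.
    - replace (mono i (a :: c)) with (fadd (fscal a (mono i (1 :: nil))) (mono (S i) c)).
      + eapply Rle_trans. apply sem_add. apply inF_scal, inF_ev. apply inF_ev.
        rewrite sem_scal by apply inF_ev. specialize (IH (S i)).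
        assert (sem X k (mono (S i) c) <= nrm c * M) by (apply IH; lia).
        assert (sem X k (mono i (1 :: nil)) <= M) by (apply B; lia).
        pose proof (Rabs_pos a). nra.
      + apply functional_extensionality. intros z. unfold fadd, fscal, mono, ev. clear.
        induction i; simpl. ring. simpl in IHi. rewrite <- IHi. ring. }
  intros c Hc. apply (G c O). simpl. exact Hc.
Qed.

Lemma small_coef L n d : 0 < d -> exists eta, 0 < eta /\
  forall c, (length c <= L)%nat -> nrm c <= eta -> small X n d (ev c).
Proof.
  intros Hd. induction n as [|n [e1 [H1 B1]]].
  - destruct (sem_ev_bound 0 L) as [M [HM B]]. exists (d / (2 * M)). split.
    apply Rdiv_lt_0_compat; lra. intros c Hc Hn k Hk. replace k with O by lia.
    specialize (B c Hc). apply (Rmult_le_compat_r M) in Hn; [|lra].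
    replace (d / (2 * M) * M) with (d / 2) in Hn by (field; lra). lra.
  - destruct (sem_ev_bound (S n) L) as [M [HM B]]. exists (Rmin e1 (d / (2 * M))). split.
    apply Rmin_pos; auto. apply Rdiv_lt_0_compat; lra.
    intros c Hc Hn k Hk. destruct (Nat.eq_dec k (S n)) as [->|].
    + specialize (B c Hc). assert (Hn2 : nrm c <= d / (2 * M)) by (eapply Rle_trans; [exact Hn|apply Rmin_r]).
      apply (Rmult_le_compat_r M) in Hn2; [|lra].
      replace (d / (2 * M) * M) with (d / 2) in Hn2 by (field; lra). lra.
    + apply (B1 c); auto. eapply Rle_trans; [exact Hn|apply Rmin_l]. lia.
Qed.

Lemma small_mono n n' d d' q : (n' <= n)%nat -> d <= d' -> small X n d q -> small X n' d' q.
Proof. intros Hn Hd H k Hk. specialize (H k). assert (sem X k q < d) by (apply H; lia). lra. Qed.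

Lemma small_add n d1 d2 q r : inF X q -> inF X r -> small X n d1 q -> small X n d2 r -> small X n (d1 + d2) (fadd q r).
Proof.
  intros Hq Hr H1 H2 k Hk. specialize (H1 k Hk). specialize (H2 k Hk).
  pose proof (sem_add k q r Hq Hr). lra.
Qed.

Lemma small_uniform r eps : 0 < eps -> exists n d, 0 < d /\
  forall q, inF X q -> small X n d q -> forall z, Cmod z <= r -> Cmod (q z) < eps.
Proof.
  intros He. destruct (space_finer X (Rmax r 1) eps) as [n [d [Hd H]]]; auto.
  { pose proof (Rmax_r r 1). lra. }
  exists n, d. split; auto. intros q Hq Hs z Hz. apply (H q Hq Hs).
  eapply Rle_trans. exact Hz. apply Rmax_l.
Qed.

Lemma small_zero n d : 0 < d -> small X n d fzero.
Proof.
  intros Hd k Hk. replace fzero with (fscal 0 fzero).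
  - rewrite sem_scal. rewrite Rabs_R0. lra. apply (space_frechet X).
  - apply functional_extensionality. intros z. unfold fscal, fzero. ring.
Qed.

End Space.

Lemma entire_pow (u : CC -> CC) n : entire u -> entire (fun w => u w ^ n)%C.
Proof. intros H. induction n; simpl. apply entire_const. now apply (entire_mult u). Qed.

(** The admissible perturbations, the ideal generated by the N-th power of the node polynomial. N =
    2 freezes values and derivatives at the nodes; larger N serve to divide by products in which
    nodes are repeated. *)
Definition vanishing (A : list CC) (N : nat) (q : CC -> CC) : Prop :=
  exists c, forall z, q z = (ev (qa A) z ^ N * ev c z)%C.

Lemma vanishing_ev A N q : vanishing A N q -> exists c, q = ev c.
Proof.
  intros [c Hc]. exists (pmul (ppow (qa A) N) c). apply functional_extensionality.
  intros z. rewrite Hc, ev_mul, ev_pow. reflexivity.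
Qed.

Lemma vanishing_inF X A N q : vanishing A N q -> inF X q.
Proof. intros H. apply vanishing_ev in H. destruct H as [c ->]. apply inF_ev. Qed.

Lemma vanishing_add A N q r : vanishing A N q -> vanishing A N r -> vanishing A N (fadd q r).
Proof.
  intros [c Hc] [d Hd]. exists (padd c d). intros z. unfold fadd. rewrite Hc, Hd, ev_add. ring.
Qed.

Lemma vanishing_zero A N : vanishing A N fzero.
Proof. exists nil. intros z. unfold fzero, ev; simpl. ring. Qed.

Lemma vanishing_weaken A B N N' q : (N <= N')%nat -> vanishing (B ++ A) N' q -> vanishing A N q.
Proof.
  intros HN [c Hc].
  exists (pmul (ppow (qa A) (N' - N)) (pmul (ppow (qa B) N') c)). intros z.
  rewrite Hc, qa_app, !ev_mul, !ev_pow, Cpow_mult_l.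
  replace N' with (N + (N' - N))%nat at 2 by lia. rewrite Cpow_add_r. ring.
Qed.

Lemma vanishing_node A N q z : (1 <= N)%nat -> vanishing A N q -> node A z -> q z = 0.
Proof.
  intros HN [c Hc] Hz. rewrite Hc. apply ev_qa_zero in Hz. rewrite Hz.
  destruct N; [lia|]. simpl. ring.
Qed.

Lemma vanishing_node_der A N q z : (2 <= N)%nat -> vanishing A N q -> node A z -> cder q z 0.
Proof.
  intros HN [c Hc] Hz. apply ev_qa_zero in Hz.
  set (u := ev (qa A)) in *.
  destruct N as [|[|N]]; [lia|lia|].
  assert (Hu : entire u) by apply entire_ev. rewrite entire_cdiff in Hu.
  assert (Hv : entire (fun w => u w ^ N * ev c w)%C).
  { apply (entire_mult (fun w => u w ^ N)%C). 2: apply entire_ev.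
    apply entire_pow. apply entire_ev. }
  rewrite entire_cdiff in Hv. destruct (Hu z) as [a Ha]. destruct (Hv z) as [b Hb].
  apply (cder_ext (fun w => u w * u w * (u w ^ N * ev c w))%C).
  { intros w. rewrite Hc. simpl. ring. }
  replace (RtoC 0) with ((a * u z + u z * a) * (u z ^ N * ev c z) + u z * u z * b)%C by (rewrite Hz; ring).
  apply (cder_mult (fun w => u w * u w)%C (fun w => u w ^ N * ev c w)%C); auto. now apply cder_mult.
Qed.

(** * Interpolation *)

(** A point on the axes may move only within them. Otherwise Im (w^2) could be nonzero but
    arbitrarily small, and no uniform bound for the interpolating coefficients would hold. *)
Definition near (eta : R) (z w : CC) : Prop := Cmod (w - z) < eta /\ (on_axes z -> on_axes w).

(** None of z', -z', conj z', -conj z' equals z: precisely then real even polynomials can take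
    independent values at the two points. *)
Definition unrelated (z z' : CC) : Prop := (z * z)%C <> (z' * z')%C /\ (z * z)%C <> Cconj (z' * z').

Lemma near_weaken eta eta' z w : eta <= eta' -> near eta z w -> near eta' z w.
Proof. intros H [H1 H2]. split; auto. lra. Qed.

Lemma sq_close (z : CC) e : 0 < e -> exists eta, 0 < eta /\ forall w : CC, Cmod (w - z) < eta -> Cmod (w * w - z * z) < e.
Proof.
  intros He. assert (H : entire (fun z => z * z)%C) by (apply (entire_mult (fun s => s)); apply entire_id).
  exact (entire_ccont _ z H e He).
Qed.

Lemma ccont_lower f (z : CC) : ccont f z -> f z <> 0 ->
  exists eta d, 0 < eta /\ 0 < d /\ forall w, Cmod (w - z) < eta -> d <= Cmod (f w).
Proof.
  intros Hf Hz. assert (Hp : 0 < Cmod (f z)) by (apply -> Cmod_gt_0; exact Hz).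
  destruct (Hf (Cmod (f z) / 2)) as [eta [He H]]. lra.
  exists eta, (Cmod (f z) / 2). repeat split; auto. lra.
  intros w Hw. specialize (H w Hw). pose proof (Cmod_sub_ge (f z) (f w)).
  rewrite Cmod_minus_sym in H0. lra.
Qed.

Lemma symp_lower (z z' : CC) : unrelated z z' ->
  exists eta d, 0 < eta /\ 0 < d /\ forall w w' : CC, Cmod (w - z) < eta -> Cmod (w' - z') < eta -> d <= Cmod (ev (symp w') w).
Proof.
  intros [H1 H2]. apply Cmod_pos_neq in H1. apply Cmod_pos_neq in H2.
  set (u1 := Cmod (z * z - z' * z')) in *. set (u2 := Cmod (z * z - Cconj (z' * z'))) in *.
  (* The squares of w and w' each move by at most a quarter of the gap, so half of it remains. *)
  set (e := Rmin (u1 / 4) (u2 / 4)).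
  assert (He : 0 < e) by (apply Rmin_pos; lra).
  assert (He1 : e <= u1 / 4) by apply Rmin_l. assert (He2 : e <= u2 / 4) by apply Rmin_r.
  destruct (sq_close z e He) as [e1 [P1 Q1]]. destruct (sq_close z' e He) as [e2 [P2 Q2]].
  exists (Rmin e1 e2), (u1 / 2 * (u2 / 2)). split. now apply Rmin_pos. split. nra.
  intros w w' Hw Hw'.
  specialize (Q1 w (Rlt_le_trans _ _ _ Hw (Rmin_l _ _))). specialize (Q2 w' (Rlt_le_trans _ _ _ Hw' (Rmin_r _ _))).
  rewrite ev_symp, Cmod_mult. apply Rmult_le_compat; try lra.
  - pose proof (Cmod_le_via (z * z) (w * w) (z' * z')). pose proof (Cmod_le_via (w * w) (w' * w') (z' * z')).
    fold u1 in H. rewrite (Cmod_minus_sym (z * z)) in H. lra.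
  - pose proof (Cmod_le_via (z * z) (w * w) (Cconj (z' * z'))).
    pose proof (Cmod_le_via (w * w) (Cconj (w' * w')) (Cconj (z' * z'))).
    fold u2 in H. rewrite (Cmod_minus_sym (z * z)) in H.
    rewrite <- (Cminus_conj (w' * w')), Cmod_conj in H0. lra.
Qed.

Lemma qa_lower (z : CC) zs : (forall z', In z' zs -> unrelated z z') ->
  exists eta d, 0 < eta /\ 0 < d /\ forall (w : CC) g, Cmod (w - z) < eta ->
    (forall z', In z' zs -> near eta z' (g z')) -> d <= Cmod (ev (qa (map g zs)) w).
Proof.
  induction zs as [|z' zs IH]; intros Hu.
  - exists 1, 1. repeat split; try lra. intros w g _ _. unfold ev; simpl.
    replace (1 + w * w * 0)%C with (RtoC 1) by ring. rewrite Cmod_1. lra.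
  - destruct IH as [e1 [d1 [H1 [H2 H3]]]]. { intros; apply Hu; now right. }
    destruct (symp_lower z z') as [e2 [d2 [H4 [H5 H6]]]]. { apply Hu; now left. }
    exists (Rmin e1 e2), (d2 * d1). split. now apply Rmin_pos. split. nra.
    intros w g Hw Hg. simpl map. rewrite ev_qa_cons, Cmod_mult.
    pose proof (Rmin_l e1 e2). pose proof (Rmin_r e1 e2).
    apply Rmult_le_compat; try lra.
    + apply H6. lra. destruct (Hg z'). now left. lra.
    + apply H3. lra. intros z'' Hz''. eapply near_weaken; [|apply Hg; now right]. lra.
Qed.

Lemma qa_norm (zs : list CC) : exists M L, 0 < M /\ forall g, (forall z, In z zs -> near 1 z (g z)) ->
  nrm (qa (map g zs)) <= M /\ (length (qa (map g zs)) <= L)%nat.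
Proof.
  induction zs as [|z zs [M [L [HM H]]]].
  - exists 1, 1%nat. split. lra. intros g _. simpl. rewrite Rabs_R1. split. lra. lia.
  - set (r := Cmod z + 1). assert (Hr : 0 < r) by (unfold r; pose proof (Cmod_ge_0 z); lra).
    exists (((r * r) ^ 2 + 2 * (r * r) + 1) * M), (3 + L)%nat. split. { apply Rmult_lt_0_compat; [nra|exact HM]. }
    intros g Hg. destruct (H g) as [H1 H2]. { intros; apply Hg; now right. }
    destruct (Hg z) as [Hz _]. now left.
    assert (Hw : Cmod (g z) <= r).
    { unfold r. pose proof (Cmod_sub_ge (g z) z). lra. }
    simpl map. change (qa (g z :: map g zs)) with (pmul (symp (g z)) (qa (map g zs))). split.
    + eapply Rle_trans. apply nrm_mul. apply Rmult_le_compat; auto using nrm_pos.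
      unfold symp. cbn [nrm]. rewrite Rplus_0_r, Rabs_R1.
      assert (Hm : Cmod (g z * g z) <= r * r) by (rewrite Cmod_mult; apply Rmult_le_compat; auto using Cmod_ge_0).
      rewrite (Rabs_pos_eq (Cmod _ ^ 2)). 2: { apply pow_le, Cmod_ge_0. }
      rewrite Rabs_mult. rewrite (Rabs_left (-2)) by lra.
      pose proof (re_le_Cmod (g z * g z)). pose proof (Cmod_ge_0 (g z * g z)).
      set (x := Cmod (g z * g z)) in *. assert (x ^ 2 <= (r * r) ^ 2) by (apply pow_incr; lra). lra.
    + pose proof (length_mul (symp (g z)) (qa (map g zs))). simpl length in H0 at 2. lia.
Qed.

(** Two real unknowns against one complex equation in s = w^2: off the axes be = Im Y / Im s, and on
    the axes Y is real and a constant does. *)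
Lemma two_coefficients (w Y : CC) d : 0 < d ->
  (on_axes w -> Im Y = 0) -> (on_axes w \/ d <= Rabs (Im (w * w))) ->
  exists al be : R, (RtoC al + RtoC be * (w * w))%C = Y /\
    Rabs al + Rabs be <= (1 + (1 + Cmod w * Cmod w) / d) * Cmod Y.
Proof.
  intros Hd HY Hw.
  assert (Hpos : 0 <= (1 + Cmod w * Cmod w) / d).
  { apply Rmult_le_pos. pose proof (Cmod_ge_0 w). nra. left; now apply Rinv_0_lt_compat. }
  pose proof (re_le_Cmod Y) as HR. pose proof (Cmod_ge_0 Y) as HP.
  destruct (Req_dec (Im (w * w)) 0) as [Hax|Hnax].
  - exists (Re Y), 0. split.
    + apply C_ext; simpl; fold (Im Y) (Re Y); rewrite ?(HY Hax); ring.
    + rewrite Rabs_R0. nra.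
  - destruct Hw as [Hw|Hw]; [contradiction|].
    set (be := Im Y / Im (w * w)). exists (Re Y - be * Re (w * w)), be. split.
    + set (s := (w * w)%C) in *. apply C_ext.
      * simpl. unfold Re. ring.
      * transitivity (be * Im s). simpl; unfold Im; ring. unfold be. field. exact Hnax.
    + assert (Hb : Rabs be <= Cmod Y / d).
      { unfold be, Rdiv. rewrite Rabs_mult, Rabs_inv. apply Rmult_le_compat.
        apply Rabs_pos. left; apply Rinv_0_lt_compat; lra. apply Im_le_Cmod. apply Rinv_le_contravar; auto. }
      assert (Rabs (Re Y - be * Re (w * w)) <= Cmod Y + Rabs be * (Cmod w * Cmod w)).
      { unfold Rminus. eapply Rle_trans. apply Rabs_triang. rewrite Rabs_Ropp, Rabs_mult.
        pose proof (re_le_Cmod (w * w)). rewrite Cmod_mult in H. pose proof (Rabs_pos be). nra. }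
      pose proof (Cmod_ge_0 w). pose proof (Rabs_pos be).
      replace ((1 + (1 + Cmod w * Cmod w) / d) * Cmod Y) with (Cmod Y + (1 + Cmod w * Cmod w) * (Cmod Y / d)) by (field; lra).
      nra.
Qed.

Lemma Im_div_real (a b : CC) : Im a = 0 -> Im b = 0 -> b <> 0 -> Im (a / b) = 0.
Proof.
  intros Ha Hb Hn. apply conj_fixed. rewrite Cdiv_conj by assumption.
  apply conj_fixed in Ha. apply conj_fixed in Hb. congruence.
Qed.

Lemma Im_mult_real (a b : CC) : Im a = 0 -> Im b = 0 -> Im (a * b) = 0.
Proof. intros Ha Hb. rewrite im_mult, Ha, Hb. ring. Qed.

(** Newton interpolation: the correction for a new point is multiplied by [qa] of the other moved
    points and so leaves their values alone. K and L are fixed before [g] and [Y], since the points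
    are moved into a dense set only after the tolerance is known. The weight [b] later becomes the
    power of the node polynomial. *)
Lemma interpolation b zs : (forall z, In z zs -> ev b z <> 0) -> ForallOrdPairs unrelated zs ->
  exists eta K L, 0 < eta /\ 0 <= K /\ forall g Y eps, 0 <= eps ->
    (forall z, In z zs -> near eta z (g z)) ->
    (forall z, In z zs -> Cmod (Y z) <= eps /\ (on_axes (g z) -> Im (Y z) = 0)) ->
    exists c, (length c <= L)%nat /\ nrm c <= K * eps /\
      forall z, In z zs -> (ev b (g z) * ev c (g z))%C = Y z.
Proof.
  induction zs as [|z zs IH]; intros Hb Hu.
  - exists 1, 0, O. repeat split; try lra. intros. exists nil. split; [simpl; lia|split; [simpl; lra|intros z []]].
  - inversion_clear Hu. rewrite Forall_forall in H.
    destruct IH as [e1 [K1 [L1 [He1 [HK1 HI]]]]]; auto. { intros; apply Hb; now right. }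
    destruct (qa_lower z zs H) as [e2 [d2 [He2 [Hd2 HL]]]].
    destruct (qa_norm zs) as [M [L2 [HM HN]]].
    destruct (ccont_lower (ev b) z) as [e3 [d3 [He3 [Hd3 HB]]]].
    { apply entire_ccont, entire_ev. } { apply Hb; now left. }
    assert (Hax : exists e4 d4, 0 < e4 /\ 0 < d4 /\ forall w, near e4 z w -> on_axes w \/ d4 <= Rabs (Im (w * w))).
    { destruct (Req_dec (Im (z * z)) 0) as [Hz|Hz].
      - exists 1, 1. repeat split; try lra. intros w [_ Hw]. left. now apply Hw.
      - apply Rabs_pos_lt in Hz. destruct (sq_close z (Rabs (Im (z * z)) / 2)) as [e4 [He4 H4]]. lra.
        exists e4, (Rabs (Im (z * z)) / 2). repeat split; auto. lra.
        intros w [Hw _]. right. specialize (H4 w Hw).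
        pose proof (Im_le_Cmod (w * w - z * z)) as Hi.
        change (Im (w * w - z * z)) with (Im (w * w) - Im (z * z)) in Hi.
        pose proof (Rabs_triang_inv (Im (z * z)) (Im (w * w))). rewrite Rabs_minus_sym in H1. lra. }
    destruct Hax as [e4 [d4 [He4 [Hd4 H4]]]].
    set (eta := Rmin 1 (Rmin (Rmin e1 e2) (Rmin e3 e4))).
    assert (Heta : 0 < eta) by (unfold eta; repeat apply Rmin_pos; auto; lra).
    assert (E0 : eta <= 1) by apply Rmin_l.
    assert (E1 : eta <= e1) by below_min.
    assert (E2 : eta <= e2) by below_min.
    assert (E3 : eta <= e3) by below_min.
    assert (E4 : eta <= e4) by below_min.
    set (r := (Cmod z + 1) * (Cmod z + 1)).
    assert (Hr : 1 <= r) by (unfold r; pose proof (Cmod_ge_0 z); nra).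
    set (B := nrm b * r ^ length b). assert (HB0 : 0 <= B).
    { apply Rmult_le_pos. apply nrm_pos. apply pow_le; lra. }
    (* Bounds the value required of the correction: numerator at most eps (1 + B K1 r^L1), with [B]
       for [b] and K1 r^L1 for the earlier interpolant, and denominator at least d3 d2. *)
    set (K2 := (1 + B * (K1 * r ^ L1)) / (d3 * d2)).
    assert (HrL : 1 <= r ^ L1) by now apply pow_R1_Rle.
    assert (HK2 : 0 <= K2).
    { apply Rmult_le_pos.
      - assert (0 <= B * (K1 * r ^ L1)); [|lra]. apply Rmult_le_pos; auto. apply Rmult_le_pos; lra.
      - left. apply Rinv_0_lt_compat. now apply Rmult_lt_0_compat. }
    set (K3 := 1 + (1 + r) / d4). assert (HK3 : 0 <= K3).
    { unfold K3. assert (0 <= (1 + r) / d4); [|lra]. apply Rmult_le_pos. lra. left; now apply Rinv_0_lt_compat. }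
    exists eta, (K1 + M * (K3 * K2)), (L1 + (L2 + 2))%nat. split; auto. split.
    { assert (0 <= M * (K3 * K2)); [|lra]. apply Rmult_le_pos. lra. now apply Rmult_le_pos. }
    intros g Y eps Heps Hg HY.
    destruct (HI g Y eps Heps) as [c1 [Hc1 [Hn1 Hv1]]].
    { intros z' Hz'. eapply near_weaken; [|apply Hg; now right]. auto. }
    { intros z' Hz'. apply HY; now right. }
    set (w := g z). destruct (Hg z) as [Hw Hwax]. now left. fold w in Hw, Hwax.
    assert (Hwr : Cmod w * Cmod w <= r).
    { pose proof (Cmod_sub_ge w z). pose proof (Cmod_ge_0 w). unfold r. nra. }
    destruct (HN g) as [HN1 HN2]. { intros z' Hz'. eapply near_weaken; [|apply Hg; now right]. auto. }
    set (Q := qa (map g zs)) in *.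
    assert (HD1 : d3 <= Cmod (ev b w)) by (apply HB; lra).
    assert (HD2 : d2 <= Cmod (ev Q w)).
    { apply HL. lra. intros z' Hz'. eapply near_weaken; [|apply Hg; now right]. auto. }
    set (D := (ev b w * ev Q w)%C).
    assert (HD : d3 * d2 <= Cmod D) by (unfold D; rewrite Cmod_mult; apply Rmult_le_compat; lra).
    assert (Hdd : 0 < d3 * d2) by now apply Rmult_lt_0_compat.
    assert (HD0 : D <> 0) by (apply <- Cmod_gt_0; lra).
    set (Y' := ((Y z - ev b w * ev c1 w) / D)%C).
    destruct (HY z) as [HY1 HY2]. now left. fold w in HY2.
    assert (HY'n : Cmod Y' <= K2 * eps).
    { unfold Y'. rewrite Cmod_div by assumption.
      assert (Hsq : Cmod (w * w) <= r) by (rewrite Cmod_mult; auto).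
      assert (Hbb : Cmod (ev b w) <= B) by (apply evr_bound; auto).
      assert (Hcc : Cmod (ev c1 w) <= K1 * eps * r ^ L1).
      { eapply Rle_trans. apply (evr_bound c1 (w * w) r Hr Hsq). apply Rmult_le_compat; auto using nrm_pos.
        apply pow_le; lra. apply Rle_pow; auto. }
      assert (Hnum : Cmod (Y z - ev b w * ev c1 w) <= (1 + B * (K1 * r ^ L1)) * eps).
      { eapply Rle_trans. apply Cmod_sub_le. rewrite Cmod_mult.
        assert (Cmod (ev b w) * Cmod (ev c1 w) <= B * (K1 * eps * r ^ L1)) by (apply Rmult_le_compat; auto using Cmod_ge_0).
        lra. }
      unfold K2, Rdiv. rewrite Rmult_assoc, (Rmult_comm (/ (d3 * d2))), <- Rmult_assoc.
      apply Rmult_le_compat; auto using Cmod_ge_0. left; apply Rinv_0_lt_compat; lra.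
      apply Rinv_le_contravar; auto. }
    assert (HY'r : on_axes w -> Im Y' = 0).
    { intros Hax. unfold Y'. apply Im_div_real; auto.
      - change (Im (Y z) - Im (ev b w * ev c1 w) = 0). rewrite (HY2 Hax), Im_mult_real by now apply ev_on_axes. ring.
      - apply Im_mult_real; now apply ev_on_axes. }
    destruct (two_coefficients w Y' d4 Hd4 HY'r) as [al [be [Hab Hnab]]].
    { apply H4. split; auto. lra. }
    exists (padd c1 (pmul Q (al :: be :: nil))). split; [|split].
    + pose proof (length_add c1 (pmul Q (al :: be :: nil))). pose proof (length_mul Q (al :: be :: nil)).
      simpl length in *. lia.
    + eapply Rle_trans. apply nrm_add. rewrite Rmult_plus_distr_r. apply Rplus_le_compat; auto.
      eapply Rle_trans. apply nrm_mul. rewrite Rmult_assoc. apply Rmult_le_compat; auto using nrm_pos.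
      simpl. rewrite Rplus_0_r. eapply Rle_trans. exact Hnab. rewrite Rmult_assoc.
      apply Rmult_le_compat; auto using Cmod_ge_0.
      * assert (0 <= (1 + Cmod w * Cmod w) / d4); [|lra]. apply Rmult_le_pos. pose proof (Cmod_ge_0 w). nra. left; now apply Rinv_0_lt_compat.
      * unfold K3. apply Rplus_le_compat_l. apply Rmult_le_compat_r. left; now apply Rinv_0_lt_compat. lra.
    + intros z' [<-|Hz'].
      * fold w. rewrite ev_add, ev_mul. 
        replace (ev (al :: be :: nil) w) with Y'. 2: { rewrite <- Hab. unfold ev; simpl. ring. }
        unfold Y', D. field. split; intros Ez; apply HD0; unfold D; rewrite Ez; ring.
      * rewrite ev_add, ev_mul. replace (ev Q (g z')) with (RtoC 0).
        -- rewrite <- (Hv1 z' Hz'). ring.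
        -- symmetry. apply ev_qa_zero. exists (g z'). split. now apply in_map. now left.
Qed.

(** The axes are closed. This turns the reality condition at the moved points, which interpolation
    needs, into one at the original points. *)
Lemma on_axes_open zs : exists e, 0 < e /\ forall z w, In z zs -> Cmod (w - z) < e -> on_axes w -> on_axes z.
Proof.
  induction zs as [|z zs [e1 [H1 H2]]].
  - exists 1. split. lra. intros z w [].
  - assert (Hz : exists e, 0 < e /\ forall w, Cmod (w - z) < e -> on_axes w -> on_axes z).
    { destruct (Req_dec (Im (z * z)) 0) as [Hz|Hz].
      - exists 1. split. lra. auto.
      - apply Rabs_pos_lt in Hz. destruct (sq_close z _ Hz) as [e [He H]]. exists e. split; auto.
        intros w Hw Ha. exfalso. specialize (H w Hw). pose proof (Im_le_Cmod (w * w - z * z)) as Hi.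
        change (Im (w * w - z * z)) with (Im (w * w) - Im (z * z)) in Hi. rewrite Ha in Hi.
        replace (0 - Im (z * z)) with (- Im (z * z)) in Hi by ring. rewrite Rabs_Ropp in Hi. lra. }
    destruct Hz as [e2 [H3 H4]]. exists (Rmin e1 e2). split. now apply Rmin_pos.
    pose proof (Rmin_l e1 e2). pose proof (Rmin_r e1 e2).
    intros z' w [<-|Hin] Hw Ha. apply (H4 w); auto; lra. apply (H2 z' w); auto; lra.
Qed.

Lemma vanishing_interpolation X A N zs n d : (forall z, In z zs -> ~ node A z) ->
  ForallOrdPairs unrelated zs -> 0 < d ->
  exists eta, 0 < eta /\ forall g Y,
    (forall z, In z zs -> near eta z (g z)) ->
    (forall z, In z zs -> Cmod (Y z) <= eta /\ (on_axes z -> Im (Y z) = 0)) ->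
    exists q, vanishing A N q /\ small X n d q /\ forall z, In z zs -> q (g z) = Y z.
Proof.
  intros HA Hu Hd. set (b := ppow (qa A) N).
  destruct (interpolation b zs) as [e [K [L [He [HK HI]]]]]; auto.
  { intros z Hz. unfold b. rewrite ev_pow. apply Cpow_nz. rewrite ev_qa_zero. auto. }
  destruct (small_coef X (length b + L) n d Hd) as [e2 [He2 HS]].
  assert (Hnb : 0 <= nrm b) by apply nrm_pos.
  (* Makes nrm b * K * e3 at most e2, the size of coefficients that keeps the polynomial small; the
     summand 1 keeps the denominator positive. *)
  set (e3 := e2 / (nrm b * K + 1)). assert (He3 : 0 < e3) by (apply Rdiv_lt_0_compat; nra).
  destruct (on_axes_open zs) as [e4 [He4 Hax]].
  exists (Rmin (Rmin e e4) e3). split. { repeat apply Rmin_pos; auto. }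
  assert (M1 : Rmin (Rmin e e4) e3 <= e) by below_min.
  assert (M2 : Rmin (Rmin e e4) e3 <= e4) by below_min.
  assert (M3 : Rmin (Rmin e e4) e3 <= e3) by apply Rmin_r.
  intros g Y Hg HY. destruct (HI g Y e3) as [c [Hc [Hn Hv]]].
  - lra.
  - intros z Hz. eapply near_weaken; [|now apply Hg]. exact M1.
  - intros z Hz. destruct (HY z Hz) as [H1 H2]. split. lra. intros Ha. apply H2.
    apply (Hax z (g z)); auto. destruct (Hg z Hz). lra.
  - exists (ev (pmul b c)). split; [|split].
    + exists c. intros z. rewrite ev_mul. unfold b. now rewrite ev_pow.
    + apply HS. pose proof (length_mul b c). lia.
      eapply Rle_trans. apply nrm_mul. apply Rle_trans with (nrm b * (K * e3)). now apply Rmult_le_compat_l.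
      apply Rmult_le_reg_r with (nrm b * K + 1). nra.
      replace (nrm b * (K * e3) * (nrm b * K + 1)) with (nrm b * K * e2) by (unfold e3; field; nra). nra.
    + intros z Hz. rewrite ev_mul. auto.
Qed.

(** * Targets and iterates *)

Record targets := Targets {
  tE : CC -> Prop;
  tL : CC -> Prop;
  tE_countable : countable_set tE;
  tE_dense : dense_in tE whole_plane;
  tE_conj : forall z, tE z -> tE (Cconj z);
  tE_refl : forall z, tE z -> tE (Copp (Cconj z));
  tE_axes : dense_in tE real_union_imag;
  tL_dense : dense_in tL whole_plane;
  tL_conj : forall z, tL z -> tL (Cconj z);
  tL_real : dense_in tL real_line }.

Lemma on_axes_iff z : on_axes z <-> Re z = 0 \/ Im z = 0.
Proof.
  unfold on_axes. rewrite im_mult. split.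
  - intros H. assert (E : Re z * Im z = 0) by lra. now apply Rmult_integral in E.
  - intros [H|H]; rewrite H; ring.
Qed.

(** Real points need a clause of their own: values at points of the axes are real and must be moved
    along the real line only. *)
Definition same_kind (z w : CC) : Prop := (Im z = 0 -> Im w = 0) /\ (on_axes z -> on_axes w).

Lemma shift_off (z b : CC) eta : 0 < eta ->
  exists t, Cmod (t - z) < eta /\ t <> b /\ same_kind z t.
Proof.
  intros He. destruct (Ceq_dec z b) as [->|H].
  - destruct (Req_dec (Im b) 0) as [Hi|Hi].
    + exists (b + RtoC (eta / 2))%C. replace (b + RtoC (eta / 2) - b)%C with (RtoC (eta / 2)) by ring.
      rewrite Cmod_R, Rabs_pos_eq by lra. repeat split. lra.
      * intros E. apply (f_equal Re) in E. rewrite re_plus in E. simpl in E. lra.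
      * intros _. rewrite im_plus, Hi. simpl. ring.
      * intros _. apply on_axes_iff. right. rewrite im_plus, Hi. simpl. ring.
    + exists (b + RtoC (eta / 2) * Ci)%C. replace (b + RtoC (eta / 2) * Ci - b)%C with (RtoC (eta / 2) * Ci)%C by ring.
      rewrite Cmod_mult, Cmod_R, Cmod_Ci, Rabs_pos_eq by lra. repeat split. lra.
      * intros E. apply (f_equal Im) in E. rewrite im_plus in E. simpl in E. lra.
      * intros; contradiction.
      * intros Ha. apply on_axes_iff in Ha. destruct Ha as [Ha|Ha]; [|contradiction].
        apply on_axes_iff. left. rewrite re_plus, Ha. simpl. ring.
  - exists z. rewrite Cmod_self. repeat split; auto.
Qed.

Section Targets.
Variable T : targets.

Lemma tE_opp z : tE T z -> tE T (- z)%C.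
Proof. intros H. apply tE_refl in H. apply tE_conj in H. rewrite Copp_conj, Cconj_conj in H. exact H. Qed.

Lemma tE_near (bad : list CC) (z : CC) eta : 0 < eta ->
  exists w, tE T w /\ Cmod (w - z) < eta /\ same_kind z w /\ ~ In w bad.
Proof.
  revert z eta. induction bad as [|b bad IH]; intros z eta He.
  (* Density in the union of the axes does not tell on which axis w lies. So 0 is left first: a
     point closer to t than |t| cannot lie on the other axis. *)
  - destruct (shift_off z 0 (eta / 2)) as [t [H1 [H2 [H3 H4]]]]. lra.
    assert (Ht : 0 < Cmod t) by (apply -> Cmod_gt_0; exact H2).
    assert (Hm : 0 < Rmin (eta / 2) (Cmod t)) by (apply Rmin_pos; lra).
    destruct (Req_dec (Im (z * z)) 0) as [Hz|Hz].
    + assert (Hta : Im t = 0 \/ Re t = 0) by (apply or_comm, on_axes_iff; auto).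
      destruct (tE_axes T t (Rmin (eta / 2) (Cmod t)) Hta Hm) as [w [Ew [Rw Hw]]].
      pose proof (Rmin_l (eta / 2) (Cmod t)). pose proof (Rmin_r (eta / 2) (Cmod t)).
      exists w. split; auto. split. { pose proof (Cmod_le_via w t z). lra. } split; [split|].
      * intros Hi. specialize (H3 Hi). destruct Rw as [Rw|Rw]; auto. exfalso.
        assert (Cmod t <= Cmod (w - t)); [|lra].
        eapply Rle_trans. apply Cmod_le_Re_Im. rewrite H3, Rabs_R0.
        pose proof (re_le_Cmod (w - t)). change (Re (w - t)) with (Re w - Re t) in H5.
        rewrite Rw in H5. replace (0 - Re t) with (- Re t) in H5 by ring. rewrite Rabs_Ropp in H5. lra.
      * intros _. apply on_axes_iff. unfold real_union_imag in Rw. tauto.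
      * intros [].
    + destruct (tE_dense T t (eta / 2)) as [w [Ew [_ Hw]]]. exact Logic.I. lra.
      exists w. split; auto. split. { pose proof (Cmod_le_via w t z). lra. } split; [split|]; auto.
      * intros Hi. exfalso. apply Hz. rewrite im_mult, Hi. ring.
      * intros Ha. contradiction.
  (* Leaving b first and then staying closer to t than |t - b| avoids b as well. *)
  - destruct (shift_off z b (eta / 2)) as [t [H1 [H2 [H3 H4]]]]. lra.
    assert (Ht := Cmod_pos_neq t b H2).
    destruct (IH t (Rmin (eta / 2) (Cmod (t - b)))) as [w [Ew [Hw [[K1 K2] Hn]]]]. apply Rmin_pos; lra.
    pose proof (Rmin_l (eta / 2) (Cmod (t - b))). pose proof (Rmin_r (eta / 2) (Cmod (t - b))).
    exists w. split; auto. split. { pose proof (Cmod_le_via w t z). lra. } split; [split; auto|].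
    intros [<-|Hin]; auto. rewrite Cmod_minus_sym in Hw. lra.
Qed.

Lemma generic_modulus (z : CC) eta : 0 < eta ->
  exists t, Cmod (t - z) < eta /\ Cmod t <> 1 /\ t <> 0 /\ (Im z = 0 -> Im t = 0).
Proof.
  intros He. set (e := Rmin (eta / 2) (/ 2)).
  assert (He1 : 0 < e) by (apply Rmin_pos; lra).
  assert (He2 : e <= eta / 2) by apply Rmin_l. assert (He3 : e <= / 2) by apply Rmin_r.
  destruct (Ceq_dec z 0) as [->|Hz].
  - exists (RtoC e). replace (e - 0)%C with (RtoC e) by ring. rewrite Cmod_R, Rabs_pos_eq by lra.
    repeat split; try lra. intros H. injection H. lra.
  - destruct (Req_dec (Cmod z) 1) as [H1|H1].
    + exists (z * RtoC (1 - e))%C.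
      replace (z * RtoC (1 - e) - z)%C with (z * RtoC (- e))%C by (rewrite RtoC_minus, RtoC_opp; ring).
      rewrite !Cmod_mult, !Cmod_R, H1, Rabs_Ropp, !Rabs_pos_eq by lra.
      repeat split; try lra.
      * apply Cmult_neq_0; auto. intros H. injection H. lra.
      * intros Hi. rewrite im_scal_r, Hi. ring.
    + exists z. rewrite Cmod_self. repeat split; auto.
Qed.

(** Modulus 1 and the value 0 are excluded by first moving the target off them and then
    approximating it more closely than its distance from them. A nonzero multiplier is what keeps
    the adjusted derivative nonzero. *)
Lemma tL_near (z : CC) eta : 0 < eta ->
  exists l, tL T l /\ Cmod (l - z) < eta /\ Cmod l <> 1 /\ l <> 0 /\ (Im z = 0 -> Im l = 0).
Proof.
  intros He. destruct (generic_modulus z (eta / 2)) as [t [H1 [H2 [H3 H4]]]]. lra.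
  assert (Ht : 0 < Cmod t) by (apply -> Cmod_gt_0; exact H3).
  set (d := Rmin (eta / 2) (Rmin (Cmod t) (Rabs (Cmod t - 1)))).
  assert (Hd : 0 < d). { unfold d. repeat apply Rmin_pos; try lra. apply Rabs_pos_lt. lra. }
  assert (D1 : d <= eta / 2) by apply Rmin_l.
  assert (D2 : d <= Cmod t) by below_min.
  assert (D3 : d <= Rabs (Cmod t - 1)) by below_min.
  assert (HL : exists l, tL T l /\ Cmod (l - t) < d /\ (Im z = 0 -> Im l = 0)).
  { destruct (Req_dec (Im z) 0) as [Hi|Hi].
    - destruct (tL_real T t d (H4 Hi) Hd) as [l [L1 [L2 L3]]]. exists l. auto.
    - destruct (tL_dense T t d Logic.I Hd) as [l [L1 [_ L3]]]. exists l. repeat split; auto. intros; contradiction. }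
  destruct HL as [l [L1 [L2 L3]]]. exists l. split; auto.
  split. { pose proof (Cmod_le_via l t z). lra. }
  assert (Hlt : Rabs (Cmod t - Cmod l) <= Cmod (l - t)).
  { apply Rabs_le. pose proof (Cmod_sub_ge l t). pose proof (Cmod_sub_ge t l). rewrite (Cmod_minus_sym t) in H0. lra. }
  repeat split; auto.
  - intros E. rewrite E in Hlt. lra.
  - intros ->. rewrite Cmod_0, Rminus_0_r, Rabs_pos_eq in Hlt by lra. lra.
Qed.

End Targets.

Definition deriv (f : CC -> CC) (z : CC) : CC := epsilon (inhabits (RtoC 0)) (cder f z).

Lemma deriv_correct f z : entire f -> cder f z (deriv f z).
Proof. intros H. unfold deriv; apply epsilon_spec. apply entire_cdiff. exact H. Qed.

Lemma deriv_unique f z l : cder f z l -> deriv f z = l.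
Proof. intros H. apply (cder_unique f z); auto. unfold deriv; apply epsilon_spec. exists l; auto. Qed.

Fixpoint iter_deriv (f : CC -> CC) (n : nat) (z : CC) : CC :=
  match n with O => RtoC 1 | S m => (deriv f (Nat.iter m f z) * iter_deriv f m z)%C end.

Lemma iter_deriv_correct f n z : entire f -> cder (Nat.iter n f) z (iter_deriv f n z).
Proof.
  intros H. induction n; simpl. apply cder_id.
  apply (cder_comp f (Nat.iter n f)); auto. now apply deriv_correct.
Qed.

Lemma iter_plus (f : CC -> CC) n m z : Nat.iter (n + m) f z = Nat.iter n f (Nat.iter m f z).
Proof. induction n; simpl; congruence. Qed.

Lemma iter_S_inside (f : CC -> CC) n z : Nat.iter (S n) f z = Nat.iter n f (f z).
Proof. rewrite <- (Nat.add_1_r n), iter_plus. reflexivity. Qed.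

Lemma iter_deriv_plus f n m z :
  iter_deriv f (n + m) z = (iter_deriv f n (Nat.iter m f z) * iter_deriv f m z)%C.
Proof. induction n; simpl. ring. rewrite IHn, iter_plus. ring. Qed.

Lemma iter_periodic (f : CC -> CC) m k z : Nat.iter m f z = z -> Nat.iter (k * m) f z = z.
Proof. intros H. induction k; simpl; auto. rewrite iter_plus, IHk. exact H. Qed.

Lemma iter_deriv_power f m k z : Nat.iter m f z = z -> iter_deriv f (k * m) z = (iter_deriv f m z ^ k)%C.
Proof.
  intros H. induction k; simpl. reflexivity.
  rewrite iter_deriv_plus, iter_periodic by assumption. now rewrite IHk.
Qed.

Lemma iter_agree (f g : CC -> CC) n z :
  (forall j, (j < n)%nat -> g (Nat.iter j f z) = f (Nat.iter j f z)) ->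
  forall j, (j <= n)%nat -> Nat.iter j g z = Nat.iter j f z.
Proof.
  intros H. induction j; intros Hj; simpl; auto. rewrite IHj by lia. apply H. lia.
Qed.

Lemma iter_deriv_agree (f g : CC -> CC) n z :
  (forall j, (j < n)%nat -> g (Nat.iter j f z) = f (Nat.iter j f z)) ->
  (forall j, (j < n)%nat -> deriv g (Nat.iter j f z) = deriv f (Nat.iter j f z)) ->
  iter_deriv g n z = iter_deriv f n z.
Proof.
  intros H Hd.
  assert (G : forall j, (j <= n)%nat -> iter_deriv g j z = iter_deriv f j z); [|apply G; lia].
  induction j; intros Hj; simpl; auto.
  rewrite IHj, (iter_agree f g n z H j), Hd by lia. reflexivity.
Qed.

Section RealEven.
Variable f : CC -> CC.
Hypothesis Hr : real_map f.
Hypothesis He : even_map f.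

Lemma iter_conj n z : Nat.iter n f (Cconj z) = Cconj (Nat.iter n f z).
Proof. induction n; simpl; auto. now rewrite IHn. Qed.

Lemma deriv_conj z : entire f -> deriv f (Cconj z) = Cconj (deriv f z).
Proof.
  intros Hf. apply deriv_unique. intros eps Heps.
  destruct (deriv_correct f z Hf eps Heps) as [d [Hd B]]. exists d. split; auto.
  intros w Hw. specialize (B (Cconj w)).
  assert (E : forall a : CC, Cmod (Cconj a - z) = Cmod (a - Cconj z)).
  { intros a. rewrite <- (Cmod_conj (Cconj a - z)), Cminus_conj, Cconj_conj. reflexivity. }
  rewrite E in B. specialize (B Hw). rewrite Hr in B.
  rewrite <- Cmod_conj, !Cminus_conj, Cmult_conj, Cminus_conj, !Cconj_conj in B.
  rewrite Hr. exact B.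
Qed.

Lemma iter_deriv_conj n z : entire f -> iter_deriv f n (Cconj z) = Cconj (iter_deriv f n z).
Proof.
  intros Hf. induction n; simpl. apply C_ext; simpl; ring.
  rewrite IHn, iter_conj, deriv_conj, Cmult_conj by assumption. reflexivity.
Qed.

(** On the imaginary axis conj z = -z, so evenness does there what conj z = z does on the real
    axis. *)
Lemma on_axes_value z : on_axes z -> Im (f z) = 0.
Proof.
  intros H. apply conj_fixed. rewrite <- Hr. apply on_axes_iff in H. destruct H as [H|H].
  - rewrite <- He. f_equal. apply C_ext; simpl; unfold Re, Im in *; lra.
  - f_equal. now apply conj_fixed.
Qed.

Lemma deriv_real z : entire f -> Im z = 0 -> Im (deriv f z) = 0.
Proof.
  intros Hf H. apply conj_fixed. rewrite <- deriv_conj by assumption. f_equal. now apply conj_fixed.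
Qed.

Lemma square_related_value (z a : CC) : (z * z)%C = (a * a)%C \/ (z * z)%C = Cconj (a * a) ->
  f z = f a \/ f z = Cconj (f a).
Proof.
  intros [H|H].
  - left. apply Csq_eq in H. destruct H as [->| ->]; auto.
  - right. rewrite Cmult_conj in H. rewrite <- Hr. apply Csq_eq in H. destruct H as [->| ->]; auto.
Qed.

End RealEven.

(** * Pinning values *)

(** The last clause speaks only of cycles consisting of nodes, the only ones whose multipliers are
    already fixed. *)
Definition Inv (X : space) (T : targets) (f : CC -> CC) (A : list CC) : Prop :=
  inF X f /\ f (RtoC 0) <> f (RtoC 1) /\
  (forall z, node A z -> tE T z /\ tE T (f z)) /\
  (forall z n, exact_period f n z -> (forall j, node A (Nat.iter j f z)) ->
     tL T (iter_deriv f n z) /\ Cmod (iter_deriv f n z) <> 1).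

Definition symlist (A : list CC) : list CC :=
  flat_map (fun a => a :: (- a)%C :: Cconj a :: (- Cconj a)%C :: nil) A.

Lemma node_symlist A z : node A z <-> In z (symlist A).
Proof.
  rewrite node_cases. unfold symlist. rewrite in_flat_map. split.
  - intros [a [Ha H]]. exists a. split; auto. simpl. destruct H as [->|[->|[->| ->]]]; tauto.
  - intros [a [Ha H]]. exists a. split; auto. simpl in H. destruct H as [<-|[<-|[<-|[<-|[]]]]]; tauto.
Qed.

Lemma node_single_sym z w : node (z :: nil) w <-> node (w :: nil) z.
Proof.
  assert (S : forall z w, node (z :: nil) w -> node (w :: nil) z).
  { clear. intros z w [a [[<-|[]] H]]. exists w. split. now left. destruct H as [H|H].
    - left. now rewrite H.
    - right. now rewrite H, Cconj_conj. }
  split; apply S.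
Qed.

Lemma node_self A a : In a A -> node A a.
Proof. intros H. exists a. split; auto. Qed.

Section Fixed.
Variable X : space.
Variable T : targets.

Lemma small_meet n1 d1 n2 d2 : 0 < d1 -> 0 < d2 -> exists n d, 0 < d /\
  forall q, small X n d q -> small X n1 d1 q /\ small X n2 d2 q.
Proof.
  intros H1 H2. exists (Nat.max n1 n2), (Rmin d1 d2). split. now apply Rmin_pos.
  intros q Hq. split; eapply small_mono; try exact Hq; try lia. apply Rmin_l. apply Rmin_r.
Qed.

Lemma fadd_zero f : fadd f fzero = f.
Proof. apply functional_extensionality. intros z. unfold fadd, fzero. ring. Qed.

Lemma small_separation f : f (RtoC 0) <> f (RtoC 1) -> exists n d, 0 < d /\
  forall q, inF X q -> small X n d q -> fadd f q (RtoC 0) <> fadd f q (RtoC 1).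
Proof.
  intros H. apply Cmod_pos_neq in H.
  destruct (small_uniform X 1 (Cmod (f (RtoC 0) - f (RtoC 1)) / 2)) as [n [d [Hd B]]]. lra.
  exists n, d. split; auto. intros q Hq Hs E.
  assert (B0 := B q Hq Hs (RtoC 0)). assert (B1 := B q Hq Hs (RtoC 1)).
  rewrite Cmod_0 in B0. rewrite Cmod_1 in B1.
  assert (E' : (f (RtoC 0) - f (RtoC 1))%C = (q (RtoC 1) - q (RtoC 0))%C).
  { apply Ceq_minus in E. apply Ceq_minus. etransitivity; [|exact E]. unfold fadd. ring. }
  pose proof (Cmod_sub_le (q (RtoC 1)) (q (RtoC 0))). rewrite <- E' in H0.
  assert (Cmod (q (RtoC 0)) < Cmod (f (RtoC 0) - f (RtoC 1)) / 2) by (apply B0; lra).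
  assert (Cmod (q (RtoC 1)) < Cmod (f (RtoC 0) - f (RtoC 1)) / 2) by (apply B1; lra). lra.
Qed.

Lemma vanishing_agree f A N q z : inF X f -> (2 <= N)%nat -> vanishing A N q -> node A z ->
  fadd f q z = f z /\ deriv (fadd f q) z = deriv f z.
Proof.
  intros Hf HN Hq Hz. split.
  - unfold fadd. rewrite (vanishing_node A N q z) by (auto; lia). ring.
  - apply deriv_unique. replace (deriv f z) with (deriv f z + 0)%C by ring.
    apply cder_plus. apply deriv_correct. eapply inF_entire; eauto.
    eapply vanishing_node_der; eauto.
Qed.

Lemma frozen_orbit f A N q z n : inF X f -> (2 <= N)%nat -> vanishing A N q ->
  (forall j, (j < n)%nat -> node A (Nat.iter j f z)) ->
  (forall j, (j <= n)%nat -> Nat.iter j (fadd f q) z = Nat.iter j f z) /\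
  iter_deriv (fadd f q) n z = iter_deriv f n z.
Proof.
  intros Hf HN Hq Hz. split.
  - apply iter_agree. intros j Hj. eapply vanishing_agree; eauto.
  - apply iter_deriv_agree; intros j Hj; eapply vanishing_agree; eauto.
Qed.

Lemma frozen_orbit_back f A N q z n : inF X f -> (2 <= N)%nat -> vanishing A N q ->
  (forall j, (j < n)%nat -> node A (Nat.iter j (fadd f q) z)) ->
  forall j, (j <= n)%nat -> Nat.iter j f z = Nat.iter j (fadd f q) z.
Proof.
  intros Hf HN Hq Hz. apply iter_agree. intros j Hj. symmetry. eapply vanishing_agree; eauto.
Qed.

(** A cycle of old nodes is a cycle of f with the same multiplier, because q vanishes there to
    second order. So only cycles that leave the old nodes have to be checked. *)
Lemma Inv_extend f A N q B : Inv X T f A -> vanishing A N q -> (2 <= N)%nat ->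
  fadd f q (RtoC 0) <> fadd f q (RtoC 1) ->
  (forall z, In z B -> tE T z /\ tE T (fadd f q z)) ->
  (forall z n, exact_period (fadd f q) n z -> (forall j, node (B ++ A) (Nat.iter j (fadd f q) z)) ->
     (exists j, ~ node A (Nat.iter j (fadd f q) z)) ->
     tL T (iter_deriv (fadd f q) n z) /\ Cmod (iter_deriv (fadd f q) n z) <> 1) ->
  Inv X T (fadd f q) (B ++ A).
Proof.
  intros [Hf [H01 [HA HC]]] Hq HN Hne HB Hcyc.
  assert (Hg : inF X (fadd f q)) by (apply inF_add; auto; eapply vanishing_inF; eauto).
  split; auto. split; auto. split.
  - intros z Hz. apply node_app in Hz. destruct Hz as [[b [Hb Hz]]|Hz].
    + destruct (HB b Hb) as [E1 E2]. split.
      * assert (Hn : node (b :: nil) z) by (exists b; split; auto; now left).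
        apply node_cases in Hn. destruct Hn as [a [[<-|[]] Hn]].
        destruct Hn as [->|[->|[->| ->]]]; auto using tE_opp, tE_conj.
      * destruct (square_related_value (fadd f q) (inF_real _ _ Hg) (inF_even _ _ Hg) z b Hz) as [->| ->]; auto.
        now apply tE_conj.
    + destruct (HA z Hz). split; auto. destruct (vanishing_agree f A N q z) as [-> _]; auto.
  - intros z n Hn Hj. destruct (classic (exists j, ~ node A (Nat.iter j (fadd f q) z))) as [He|He].
    + now apply Hcyc.
    + assert (HAj : forall j, node A (Nat.iter j (fadd f q) z)).
      { intros j. apply NNPP. intros N0. apply He. eauto. }
      assert (Hback : forall j, Nat.iter j f z = Nat.iter j (fadd f q) z).
      { intros j. apply (frozen_orbit_back f A N q z j Hf HN Hq); auto. }
      destruct (frozen_orbit f A N q z n Hf HN Hq) as [_ Hd].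
      { intros j _. rewrite Hback. auto. }
      rewrite Hd. apply HC.
      * destruct Hn as [N1 [N2 N3]]. repeat split; auto. now rewrite Hback.
        intros m M1 M2. rewrite Hback. auto.
      * intros j. rewrite Hback. auto.
Qed.

(** [eta] precedes [w] and [t], which are chosen within it afterwards: either the point or its value
    can be taken from E. *)
Lemma pin_value f A N z n d : inF X f -> ~ node A z -> 0 < d ->
  exists eta, 0 < eta /\ forall w t, near eta z w -> Cmod (t - f w) <= eta -> (on_axes z -> Im t = 0) ->
    exists q, vanishing A N q /\ small X n d q /\ fadd f q w = t.
Proof.
  intros Hf Hz Hd. destruct (vanishing_interpolation X A N (z :: nil) n d) as [eta [He H]]; auto.
  - intros z' [<-|[]]. exact Hz.
  - constructor. constructor. constructor.
  - exists eta. split; auto. intros w t Hw Ht Hax.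
    destruct (H (fun _ => w) (fun _ => (t - f w)%C)) as [q [Q1 [Q2 Q3]]].
    + intros z' [<-|[]]. exact Hw.
    + intros z' [<-|[]]. split; auto. intros Ha. change (Im t - Im (f w) = 0). assert (Haw : on_axes w) by now apply Hw.
      rewrite (Hax Ha), (on_axes_value f (inF_real _ _ Hf) (inF_even _ _ Hf) w Haw). ring.
    + exists q. split; auto. split; auto. unfold fadd. rewrite (Q3 z) by now left. ring.
Qed.

(** The value of e is chosen in E outside all nodes, e and its reflections included. The orbit of e
    thus leaves the nodes at once, and no cycle of nodes arises. *)
Lemma make_node f A N e n d : Inv X T f A -> (2 <= N)%nat -> tE T e -> 0 < d ->
  exists q B, vanishing A N q /\ small X n d q /\ Inv X T (fadd f q) (B ++ A) /\ node (B ++ A) e.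
Proof.
  intros HI HN He Hd. destruct (classic (node A e)) as [Hn|Hn].
  { exists fzero, nil. split. apply vanishing_zero. split. now apply small_zero.
    rewrite fadd_zero. auto. }
  assert (Hf : inF X f) by apply HI.
  destruct (small_separation f) as [n1 [d1 [Hd1 Hsep]]]. { apply HI. }
  destruct (small_meet n1 d1 n d Hd1 Hd) as [n2 [d2 [Hd2 Hm]]].
  destruct (pin_value f A N e n2 d2 Hf Hn Hd2) as [eta [Heta Hpin]].
  destruct (tE_near T (symlist (e :: A)) (f e) eta Heta) as [v [Ev [Hv [[Hk _] Hbad]]]].
  destruct (Hpin e v) as [q [Q1 [Q2 Q3]]].
  { split; auto. rewrite Cmod_self. exact Heta. } { lra. }
  { intros Ha. apply Hk. apply on_axes_value; auto. eapply inF_real; eauto. eapply inF_even; eauto. }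
  destruct (Hm q Q2) as [S1 S2].
  exists q, (e :: nil). split; auto. split; auto.
  assert (Hq : inF X q) by (eapply vanishing_inF; eauto).
  assert (Hg : inF X (fadd f q)) by now apply inF_add.
  split. 2: { apply node_self. now left. }
  apply Inv_extend with N; auto.
  - intros z [<-|[]]. split; auto. now rewrite Q3.
  - intros z k Hk' Hj [j Hnj]. exfalso.
    assert (Hj1 := Hj j). apply node_app in Hj1. destruct Hj1 as [[b [[<-|[]] Hb]]|]; [|contradiction].
    assert (HS := Hj (S j)). simpl Nat.iter in HS.
    apply (Hbad). apply node_symlist.
    destruct (square_related_value (fadd f q) (inF_real _ _ Hg) (inF_even _ _ Hg) _ _ Hb) as [E|E];
      rewrite E, Q3 in HS; [|apply (proj1 (node_conj _ _)) in HS]; exact HS.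
Qed.

(** Here the value e is prescribed, so it is the point w that must prevent cycles: it is kept
    unrelated to e and to all values at nodes, so that no node is mapped to w or to one of its
    reflections. *)
Lemma pin_preimage f A N e z n d : Inv X T f A -> (2 <= N)%nat -> tE T e -> 0 < d ->
  f z = e -> ~ node A z ->
  exists q w, vanishing A N q /\ small X n d q /\ Inv X T (fadd f q) (w :: A) /\
    fadd f q w = e /\ Cmod (w - z) < 1 /\ ~ node A w.
Proof.
  intros HI HN He Hd Hfz Hn.
  assert (Hf : inF X f) by apply HI.
  destruct (small_separation f) as [n1 [d1 [Hd1 Hsep]]]. { apply HI. }
  destruct (small_meet n1 d1 n d Hd1 Hd) as [n2 [d2 [Hd2 Hm]]].
  destruct (pin_value f A N z n2 d2 Hf Hn Hd2) as [eta [Heta Hpin]].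
  destruct (entire_ccont f z (inF_entire _ _ Hf) eta Heta) as [d3 [Hd3 Hc]].
  set (r := Rmin (Rmin 1 eta) d3). assert (Hr : 0 < r) by (unfold r; repeat apply Rmin_pos; lra).
  assert (R1 : r <= 1) by below_min.
  assert (R2 : r <= eta) by below_min.
  assert (R3 : r <= d3) by apply Rmin_r.
  destruct (tE_near T (symlist (e :: map f A ++ A)) z r Hr) as [w [Ew [Hw [[_ Hk] Hbad]]]].
  assert (Hbad' : ~ node (e :: map f A ++ A) w) by (intros H; apply Hbad; now apply node_symlist).
  clear Hbad.
  destruct (Hpin w e) as [q [Q1 [Q2 Q3]]].
  { split; auto. lra. } { rewrite <- Hfz, Cmod_minus_sym. left. apply Hc. lra. }
  { intros Ha. rewrite <- Hfz. apply on_axes_value; auto. eapply inF_real; eauto. eapply inF_even; eauto. }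
  destruct (Hm q Q2) as [S1 S2].
  exists q, w. split; auto. split; auto.
  assert (Hq : inF X q) by (eapply vanishing_inF; eauto).
  assert (Hg : inF X (fadd f q)) by now apply inF_add.
  assert (HwA : ~ node A w).
  { intros H. apply Hbad'. apply node_cons. right. apply node_app. now right. }
  split. 2: { split; auto. split; auto. lra. }
  apply (Inv_extend f A N q (w :: nil)); auto.
  - intros x [<-|[]]. split; auto. now rewrite Q3.
  - intros x k [K1 [K2 K3]] Hj [j Hnj]. exfalso.
    assert (Hj1 := Hj j). apply node_app in Hj1. destruct Hj1 as [Hj1|]; [|contradiction].
    (* [y] is the predecessor of the j-th point on the cycle; it is a node whose image is related to
       w. *)
    set (g := fadd f q) in *. set (y := Nat.iter (j + (k - 1)) g x).
    assert (Ey : g y = Nat.iter j g x).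
    { unfold y. change (g (Nat.iter (j + (k - 1)) g x)) with (Nat.iter (S (j + (k - 1))) g x).
      replace (S (j + (k - 1))) with (j + k)%nat by lia. rewrite iter_plus, K2. reflexivity. }
    assert (Hy : node ((w :: nil) ++ A) y) by apply Hj.
    assert (Key : forall u, In u (e :: map f A ++ A) -> ~ node (w :: nil) u).
    { intros u Hu Hnu. apply Hbad'. apply node_single_sym in Hnu. destruct Hnu as [b [[<-|[]] Hb]].
      exists u. auto. }
    rewrite <- Ey in Hj1. apply node_app in Hy. destruct Hy as [[b [[<-|[]] Hb]]|[a [Ha Hb]]].
    + apply (Key e). now left.
      destruct (square_related_value g (inF_real _ _ Hg) (inF_even _ _ Hg) _ _ Hb) as [E|E];
        rewrite E, Q3 in Hj1; [|apply (proj1 (node_conj _ _)) in Hj1]; exact Hj1.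
    + apply (Key (f a)). right. apply in_or_app. left. now apply in_map.
      assert (Ega : g a = f a). { apply (vanishing_agree f A N q a); auto. now apply node_self. }
      destruct (square_related_value g (inF_real _ _ Hg) (inF_even _ _ Hg) _ _ Hb) as [E|E];
        rewrite E, Ega in Hj1; [|apply (proj1 (node_conj _ _)) in Hj1]; exact Hj1.
Qed.

End Fixed.

(** * Separating nodes and adjusting derivatives *)

Section Separate.
Variable X : space.
Variable T : targets.

(** An auxiliary node, one of B but not of A, is never mapped into A: an orbit that has left A and
    runs through nodes of B cannot come back. *)
Definition escaping (A : list CC) (g : CC -> CC) (B : list CC) : Prop :=
  forall b, node B b -> node A b \/ ~ node A (g b).

Lemma escape_point A g B N n d y : inF X g -> escaping A g B -> (2 <= N)%nat -> 0 < d ->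
  exists q B', vanishing B N q /\ small X n d q /\ escaping A (fadd g q) (B' ++ B) /\ node (B' ++ B) y.
Proof.
  intros Hg HJ HN Hd. destruct (classic (node B y)) as [Hy|Hy].
  { exists fzero, nil. split. apply vanishing_zero. split. now apply small_zero.
    rewrite fadd_zero. auto. }
  destruct (pin_value X g B N y n d Hg Hy Hd) as [eta [Heta Hpin]].
  destruct (tE_near T (symlist A) (g y) eta Heta) as [v [_ [Hv [[Hk _] Hbad]]]].
  destruct (Hpin y v) as [q [Q1 [Q2 Q3]]].
  { split; auto. rewrite Cmod_self. exact Heta. } { lra. }
  { intros Ha. apply Hk. apply on_axes_value; auto. eapply inF_real; eauto. eapply inF_even; eauto. }
  exists q, (y :: nil). split; auto. split; auto. split. 2: { apply node_self. now left. }
  assert (Hg' : inF X (fadd g q)) by (apply inF_add; auto; eapply vanishing_inF; eauto).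
  intros b Hb. apply node_app in Hb. destruct Hb as [[a [[<-|[]] Hb]]|Hb].
  - right. intros Hn. apply Hbad. apply node_symlist.
    destruct (square_related_value (fadd g q) (inF_real _ _ Hg') (inF_even _ _ Hg') _ _ Hb) as [E|E];
      rewrite E, Q3 in Hn; [|apply (proj1 (node_conj _ _)) in Hn]; exact Hn.
  - destruct (vanishing_agree X g B N q b) as [-> _]; auto.
Qed.

Lemma escape_orbit A g B N n d x m : inF X g -> escaping A g B -> (2 <= N)%nat -> 0 < d ->
  exists q B', vanishing B N q /\ small X n d q /\ escaping A (fadd g q) (B' ++ B) /\
    forall j, (j < m)%nat -> node (B' ++ B) (Nat.iter j (fadd g q) x).
Proof.
  intros Hg HJ HN Hd. revert d Hd. induction m; intros d Hd.
  { exists fzero, nil. split. apply vanishing_zero. split. now apply small_zero.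
    rewrite fadd_zero. split; auto. intros; lia. }
  destruct (IHm (d / 2)) as [q1 [B1 [V1 [S1 [J1 O1]]]]]. lra.
  assert (Hq1 : inF X q1) by (eapply vanishing_inF; eauto).
  assert (Hg1 : inF X (fadd g q1)) by now apply inF_add.
  destruct (escape_point A (fadd g q1) (B1 ++ B) N n (d / 2) (Nat.iter m (fadd g q1) x)) as [q2 [B2 [V2 [S2 [J2 O2]]]]]; auto.
  lra.
  assert (Hq2 : inF X q2) by (eapply vanishing_inF; eauto).
  exists (fadd q1 q2), (B2 ++ B1). rewrite <- fadd_assoc, <- app_assoc. split; [|split; [|split]]; auto.
  - apply vanishing_add; auto. apply (vanishing_weaken B B1 N N); auto.
  - replace d with (d / 2 + d / 2) by lra. now apply small_add.
  - destruct (frozen_orbit X (fadd g q1) (B1 ++ B) N q2 x m) as [F1 _]; auto.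
    intros j Hj. rewrite F1 by lia. destruct (Nat.eq_dec j m) as [->|Hne]; auto.
    apply node_app. right. apply O1. lia.
Qed.

Lemma escape_list A g B N n d l m : inF X g -> escaping A g B -> (2 <= N)%nat -> 0 < d ->
  exists q B', vanishing B N q /\ small X n d q /\ escaping A (fadd g q) (B' ++ B) /\
    forall x j, In x l -> (j < m)%nat -> node (B' ++ B) (Nat.iter j (fadd g q) x).
Proof.
  intros Hg HJ HN Hd. revert d Hd. induction l as [|y l IH]; intros d Hd.
  { exists fzero, nil. split. apply vanishing_zero. split. now apply small_zero.
    rewrite fadd_zero. split; auto. intros x j []. }
  destruct (IH (d / 2)) as [q1 [B1 [V1 [S1 [J1 O1]]]]]. lra.
  assert (Hq1 : inF X q1) by (eapply vanishing_inF; eauto).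
  assert (Hg1 : inF X (fadd g q1)) by now apply inF_add.
  destruct (escape_orbit A (fadd g q1) (B1 ++ B) N n (d / 2) y m) as [q2 [B2 [V2 [S2 [J2 O2]]]]]; auto.
  lra.
  assert (Hq2 : inF X q2) by (eapply vanishing_inF; eauto).
  exists (fadd q1 q2), (B2 ++ B1). rewrite <- fadd_assoc, <- app_assoc. split; [|split; [|split]]; auto.
  - apply vanishing_add; auto. apply (vanishing_weaken B B1 N N); auto.
  - replace d with (d / 2 + d / 2) by lra. now apply small_add.
  - intros x j [<-|Hx] Hj; auto.
    destruct (frozen_orbit X (fadd g q1) (B1 ++ B) N q2 x m) as [F1 _]; auto.
    rewrite F1 by lia. apply node_app. right. auto.
Qed.

Lemma iter_commute (f : CC -> CC) i j z : Nat.iter i f (Nat.iter j f z) = Nat.iter j f (Nat.iter i f z).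
Proof. rewrite <- !iter_plus. f_equal. lia. Qed.

Lemma iter_mod (f : CC -> CC) n z j : (1 <= n)%nat -> Nat.iter n f z = z ->
  Nat.iter j f z = Nat.iter (j mod n) f z.
Proof.
  intros Hn H. transitivity (Nat.iter (j mod n + j / n * n) f z).
  { f_equal. pose proof (Nat.div_mod_eq j n). lia. }
  rewrite iter_plus, iter_periodic; auto.
Qed.

(* The auxiliary nodes that force the orbits of the old nodes to leave are forgotten afterwards. *)
Lemma separate_nodes f A N k n d : Inv X T f A -> (2 <= N)%nat -> (1 <= k)%nat -> 0 < d ->
  exists q, vanishing A N q /\ small X n d q /\ Inv X T (fadd f q) A /\
    forall x, node A x -> Nat.iter k (fadd f q) x = x -> forall j, node A (Nat.iter j (fadd f q) x).
Proof.
  intros HI HN Hk Hd. assert (Hf : inF X f) by apply HI.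
  destruct (small_separation X f) as [n1 [d1 [Hd1 Hsep]]]. { apply HI. }
  destruct (small_meet X n1 d1 n d Hd1 Hd) as [n2 [d2 [Hd2 Hm]]].
  destruct (escape_list A f A N n2 d2 (symlist A) k) as [q [B [V [S [J O]]]]]; auto.
  { intros b Hb; now left. }
  destruct (Hm q S) as [S1 S2].
  assert (Hq : inF X q) by (eapply vanishing_inF; eauto).
  exists q. split; auto. split; auto. split.
  - apply (Inv_extend X T f A N q nil); auto. intros z []. intros z m Hz Hj [j Hn]. exfalso. apply Hn, Hj.
  - intros x Hx Hper.
    assert (Hle : forall j, (j <= k)%nat -> node A (Nat.iter j (fadd f q) x)).
    { intros j Hj. apply NNPP. intros Hno.
      (* Having left A, the orbit stays outside as long as its points are auxiliary nodes, that is
         up to time k; but at time k it is back at x, a node of A. *)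
      assert (Hst : forall i, (j + i <= k)%nat -> ~ node A (Nat.iter (j + i) (fadd f q) x)).
      { induction i; intros Hi. now rewrite Nat.add_0_r.
        replace (j + Datatypes.S i)%nat with (Datatypes.S (j + i)) by lia. simpl.
        destruct (J (Nat.iter (j + i) (fadd f q) x)) as [Hc|Hc]; auto.
        - apply O. now apply node_symlist. lia.
        - exfalso. apply IHi; auto. lia. }
      apply (Hst (k - j)%nat). lia. replace (j + (k - j))%nat with k by lia. now rewrite Hper. }
    intros j. rewrite (iter_mod _ k) by auto. apply Hle.
    pose proof (Nat.mod_upper_bound j k). lia.
Qed.

End Separate.

Section DerivativePass.
Variable X : space.

Lemma cder_symp (a : CC) : cder (ev (symp a)) a (2 * a * (a * a - Cconj (a * a)))%C.
Proof.
  apply (cder_ext (fun z => (z * z - a * a) * (z * z - Cconj (a * a)))%C).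
  { intros z. now rewrite ev_symp. }
  replace (2 * a * (a * a - Cconj (a * a)))%C with
    (((1 * a + a * 1) - 0) * (a * a - Cconj (a * a)) + (a * a - a * a) * ((1 * a + a * 1) - 0))%C.
  2: { replace (RtoC 2) with (1 + 1)%C by (apply C_ext; simpl; ring). ring. }
  assert (S : cder (fun z => z * z)%C a (1 * a + a * 1)) by (apply (cder_mult (fun z => z) (fun z => z)); apply cder_id).
  apply (cder_mult (fun z => z * z - a * a)%C (fun z => z * z - Cconj (a * a))%C).
  - apply (cder_minus (fun z => z * z)%C (fun _ => (a * a)%C)); auto. apply cder_const.
  - apply (cder_minus (fun z => z * z)%C (fun _ => Cconj (a * a))); auto. apply cder_const.
Qed.

(** On the axes w^2 is real and [symp w] has a double root in z^2, so z^2 - w^2 is used instead. At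
    0 every even map has derivative 0. The imaginary axis is excluded since derivatives are
    imaginary there; adjusted cycles that meet the axes are real. *)
Lemma simple_factor (w : CC) : w <> 0 -> (on_axes w -> Im w = 0) ->
  exists l k, ev l w = 0 /\ cder (ev l) w k /\ k <> 0 /\ (on_axes w -> Im k = 0).
Proof.
  intros Hw Ha. destruct (Req_dec (Im (w * w)) 0) as [Hz|Hz].
  - exists ((- Re (w * w)) :: 1 :: nil), (2 * w)%C.
    assert (E : forall z, ev ((- Re (w * w)) :: 1 :: nil) z = (z * z - w * w)%C).
    { intros z. unfold ev. set (s := (w * w)%C) in *. cbn [evr]. rewrite RtoC_opp.
      replace (RtoC (Re s)) with s. ring. apply C_ext; simpl; auto. }
    split; [|split; [|split]].
    + rewrite E. ring.
    + apply (cder_ext (fun z => z * z - w * w)%C). { intros z. now rewrite E. }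
      replace (2 * w)%C with ((1 * w + w * 1) - 0)%C.
      2: { replace (RtoC 2) with (1 + 1)%C by (apply C_ext; simpl; ring). ring. }
      apply (cder_minus (fun z => z * z)%C (fun _ => (w * w)%C)). 2: apply cder_const.
      apply (cder_mult (fun z => z) (fun z => z)); apply cder_id.
    + apply Cmult_neq_0; auto. intros H. injection H. lra.
    + intros H. rewrite im_scal_l, (Ha H). ring.
  - exists (symp w), (2 * w * (w * w - Cconj (w * w)))%C. split; [|split; [|split]].
    + rewrite ev_symp. ring.
    + apply cder_symp.
    + apply Cmult_neq_0. apply Cmult_neq_0; auto. intros H; injection H; lra.
      apply Cminus_eq_contra. intros H. apply Hz. apply conj_fixed. now symmetry.
    + intros H. contradiction.
Qed.

(** The product of a factor [l] with a simple zero at w, the weight [b] and [c] has derivative k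
    b(w) c(w) at w; so [c] is interpolated to give b(w) c(w) = eta / k. *)
Lemma derivative_one A N w n d : ~ node A w -> w <> RtoC 0 -> (on_axes w -> Im w = 0) -> 0 < d ->
  exists dl, 0 < dl /\ forall eta, Cmod eta < dl -> (on_axes w -> Im eta = 0) ->
    exists q, vanishing A N q /\ small X n d q /\ q w = 0 /\ cder q w eta.
Proof.
  intros HA Hw Hax Hd. destruct (simple_factor w Hw Hax) as [l [k [L0 [L1 [L2 L3]]]]].
  set (b := ppow (qa A) N).
  destruct (interpolation b (w :: nil)) as [e [K [L [He [HK HI]]]]].
  { intros z [<-|[]]. unfold b. rewrite ev_pow. apply Cpow_nz. rewrite ev_qa_zero. auto. }
  { constructor. constructor. constructor. }
  set (lb := pmul l b).
  destruct (small_coef X (length lb + L) n d Hd) as [e2 [He2 HS]].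
  assert (Hn : 0 <= nrm lb * K) by (apply Rmult_le_pos; auto using nrm_pos).
  assert (Hkp : 0 < Cmod k) by (apply -> Cmod_gt_0; exact L2).
  set (e3 := e2 / (nrm lb * K + 1)). assert (He3 : 0 < e3) by (apply Rdiv_lt_0_compat; lra).
  exists (e3 * Cmod k). split. now apply Rmult_lt_0_compat.
  intros eta Heta Hr.
  destruct (HI (fun _ => w) (fun _ => (eta / k)%C) e3) as [c [C1 [C2 C3]]].
  - lra.
  - intros z [<-|[]]. split; auto. rewrite Cmod_self. exact He.
  - intros z [<-|[]]. split.
    + rewrite Cmod_div by assumption. apply Rmult_le_reg_r with (Cmod k); auto.
      unfold Rdiv. rewrite Rmult_assoc, Rinv_l by lra. lra.
    + intros Ha. apply Im_div_real; auto.
  - specialize (C3 w (or_introl eq_refl)). simpl in C3.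
    exists (ev (pmul lb c)). split; [|split; [|split]].
    + exists (pmul l c). intros z. unfold lb, b. rewrite !ev_mul, ev_pow. ring.
    + apply HS. pose proof (length_mul lb c). lia.
      eapply Rle_trans. apply nrm_mul. apply Rle_trans with (nrm lb * (K * e3)). apply Rmult_le_compat_l; auto using nrm_pos.
      apply Rmult_le_reg_r with (nrm lb * K + 1). lra.
      replace (nrm lb * (K * e3) * (nrm lb * K + 1)) with (nrm lb * K * e2) by (unfold e3; field; lra). nra.
    + unfold lb. rewrite !ev_mul, L0. ring.
    + destruct (proj1 (entire_cdiff (fun z => ev b z * ev c z)%C)) with (z := w) as [m Hm].
      { apply (entire_mult (ev b) (ev c)); apply entire_ev. }
      apply (cder_ext (fun z => ev l z * (ev b z * ev c z))%C).
      { intros z. unfold lb. rewrite !ev_mul. ring. }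
      replace eta with (k * (ev b w * ev c w) + ev l w * m)%C.
      2: { rewrite C3, L0. field. exact L2. }
      apply (cder_mult (ev l) (fun z => ev b z * ev c z)%C); auto.
Qed.

(** Each summand vanishes to order N >= 2 at the points of the others, so the derivatives are
    adjusted independently of each other. *)
Lemma derivative_pass A N ws n d : (2 <= N)%nat -> 0 < d ->
  (forall w, In w ws -> ~ node A w /\ w <> RtoC 0 /\ (on_axes w -> Im w = 0)) ->
  ForallOrdPairs unrelated ws ->
  exists dl, 0 < dl /\ forall eta : CC -> CC,
    (forall w, In w ws -> Cmod (eta w) < dl /\ (on_axes w -> Im (eta w) = 0)) ->
    exists q, vanishing A N q /\ small X n d q /\ forall w, In w ws -> q w = 0 /\ cder q w (eta w).
Proof.
  intros HN. revert A d. induction ws as [|w ws IH]; intros A d Hd Hws Hu.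
  { exists 1. split. lra. intros eta _. exists fzero. split. apply vanishing_zero. split.
    now apply small_zero. intros w []. }
  inversion_clear Hu. rewrite Forall_forall in H.
  assert (Hrel : forall w', In w' ws -> ~ node (w' :: nil) w).
  { intros w' Hw' [a [[<-|[]] Ha]]. destruct (H w' Hw'). tauto. }
  destruct (IH (w :: A) (d / 2)) as [d1 [Hd1 H1]]; auto. lra.
  { intros w' Hw'. destruct (Hws w') as [P1 [P2 P3]]. now right. split; auto.
    intros Hn. apply node_cons in Hn. destruct Hn as [Hn|Hn]; auto.
    apply node_single_sym in Hn. now apply (Hrel w'). }
  destruct (Hws w) as [P1 [P2 P3]]. now left.
  destruct (derivative_one (ws ++ A) N w n (d / 2)) as [d2 [Hd2 H2]]; auto.
  { intros Hn. apply node_app in Hn. destruct Hn as [[a [Ha Hb]]|Hn]; auto.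
    apply (Hrel a Ha). exists a. split; auto. now left. } lra.
  exists (Rmin d1 d2). split. now apply Rmin_pos.
  pose proof (Rmin_l d1 d2). pose proof (Rmin_r d1 d2).
  intros eta Heta.
  destruct (H1 eta) as [q1 [A1 [A2 A3]]].
  { intros w' Hw'. destruct (Heta w'). now right. split; auto. lra. }
  destruct (Heta w) as [E1 E2]. now left.
  destruct (H2 (eta w)) as [q2 [B1 [B2 [B3 B4]]]]; auto. lra.
  assert (Hq1 : inF X q1) by (eapply vanishing_inF; eauto).
  assert (Hq2 : inF X q2) by (eapply vanishing_inF; eauto).
  exists (fadd q1 q2). split; [|split].
  - apply vanishing_add. apply (vanishing_weaken A (w :: nil) N N); auto. apply (vanishing_weaken A ws N N); auto.
  - replace d with (d / 2 + d / 2) by lra. now apply small_add.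
  - intros w' [<-|Hw'].
    + assert (Hnw : node (w :: A) w) by (apply node_self; now left). split.
      * unfold fadd. rewrite B3, (vanishing_node (w :: A) N q1 w) by (auto; lia). ring.
      * replace (eta w) with (0 + eta w)%C by ring. apply cder_plus; auto.
        eapply vanishing_node_der; eauto.
    + assert (Hnw : node (ws ++ A) w') by (apply node_self, in_or_app; now left).
      destruct (A3 w' Hw') as [A4 A5]. split.
      * unfold fadd. rewrite A4, (vanishing_node (ws ++ A) N q2 w') by (auto; lia). ring.
      * replace (eta w') with (eta w' + 0)%C by ring. apply cder_plus; auto.
        eapply vanishing_node_der; eauto.
Qed.

End DerivativePass.

(** * Cycles up to conjugation *)

Lemma least_nat (P : nat -> Prop) : (exists k, P k) -> exists k, P k /\ forall j, (j < k)%nat -> ~ P j.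
Proof.
  intros [k Hk]. induction k as [k IH] using (well_founded_induction Wf_nat.lt_wf).
  destruct (classic (exists j, (j < k)%nat /\ P j)) as [[j [Hj HPj]]|Hno].
  - now apply (IH j).
  - exists k. split; auto. intros j Hj HPj. apply Hno. eauto.
Qed.

Lemma ForallOrdPairs_seq (Rl : CC -> CC -> Prop) (x : nat -> CC) m s :
  (forall i j, (s <= i)%nat -> (i < j)%nat -> (j < s + m)%nat -> Rl (x i) (x j)) ->
  ForallOrdPairs Rl (map x (seq s m)).
Proof.
  revert s. induction m; intros s H; simpl; constructor.
  - apply Forall_forall. intros y Hy. apply in_map_iff in Hy. destruct Hy as [j [<- Hj]].
    apply in_seq in Hj. apply H; lia.
  - apply IHm. intros i j H1 H2 H3. apply H; lia.
Qed.

Lemma ForallOrdPairs_unrelated_open zs : ForallOrdPairs unrelated zs ->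
  exists e, 0 < e /\ forall g, (forall z, In z zs -> near e z (g z)) -> ForallOrdPairs unrelated (map g zs).
Proof.
  induction zs as [|z zs IH]; intros H.
  - exists 1. split. lra. intros; constructor.
  - inversion_clear H. rewrite Forall_forall in H0.
    destruct (IH H1) as [e1 [He1 Hg1]].
    destruct (qa_lower z zs H0) as [e2 [d2 [He2 [Hd2 H2]]]].
    exists (Rmin e1 e2). split. now apply Rmin_pos. intros g Hg.
    assert (M1 := Rmin_l e1 e2). assert (M2 := Rmin_r e1 e2).
    simpl. constructor.
    + apply Forall_forall. intros w' Hw'.
      assert (Hn : ~ node (map g zs) (g z)).
      { intros Hn. apply ev_qa_zero in Hn. specialize (H2 (g z) g). rewrite Hn, Cmod_0 in H2.
        assert (d2 <= 0); [|lra]. apply H2.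
        - destruct (Hg z). now left. lra.
        - intros z' Hz'. eapply near_weaken; [|apply Hg; now right]. lra. }
      split; intros E; apply Hn; exists w'; auto.
    + apply Hg1. intros z' Hz'. eapply near_weaken; [|apply Hg; now right]. lra.
Qed.

Definition good (T : targets) (l : CC) : Prop := tL T l /\ Cmod l <> 1.

Lemma good_conj T l : good T l -> good T (Cconj l).
Proof. intros [H1 H2]. split. now apply tL_conj. now rewrite Cmod_conj. Qed.

(** K collects the other derivatives along the cycle. The product K d is chosen in Lambda and d is
    obtained by division. *)
Lemma choose_factor T (K d0 : CC) dl : K <> RtoC 0 -> 0 < dl ->
  exists d, Cmod (d - d0) < dl /\ d <> RtoC 0 /\ good T (K * d) /\ (Im K = 0 -> Im d0 = 0 -> Im d = 0).
Proof.
  intros HK Hd. assert (Hp : 0 < Cmod K) by (apply -> Cmod_gt_0; exact HK).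
  destruct (tL_near T (K * d0) (dl * Cmod K)) as [l [L1 [L2 [L3 [L4 L5]]]]]. now apply Rmult_lt_0_compat.
  exists (l / K)%C. split; [|split; [|split; [split|]]].
  - replace (l / K - d0)%C with ((l - K * d0) / K)%C by (field; exact HK).
    rewrite Cmod_div by assumption. apply Rmult_lt_reg_r with (Cmod K); auto.
    unfold Rdiv. rewrite Rmult_assoc, Rinv_l by lra. lra.
  - intros E. apply L4. replace l with (K * (l / K))%C by (field; exact HK). rewrite E. ring.
  - replace (K * (l / K))%C with l by (field; exact HK). exact L1.
  - replace (K * (l / K))%C with l by (field; exact HK). exact L3.
  - intros H1 H2. apply Im_div_real; auto. apply L5. now apply Im_mult_real.
Qed.

(* A cycle invariant under conjugation has multiplier |D|^2, where D is the derivative along half of it. *)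
Lemma choose_factor_selfconj T (K d0 : CC) dl : K <> RtoC 0 -> 0 < dl ->
  exists d, Cmod (d - d0) < dl /\ d <> RtoC 0 /\ good T (RtoC (Cmod (K * d) ^ 2)).
Proof.
  intros HK Hd. assert (Hp : 0 < Cmod K) by (apply -> Cmod_gt_0; exact HK).
  pose proof (Cmod_ge_0 d0) as H0.
  (* As |d| runs from |d0| to |d0| + dl, |K d|^2 runs from a^2 to b^2; a real element of Lambda is
     taken strictly in between. *)
  set (a := Cmod K * Cmod d0). set (b := Cmod K * (Cmod d0 + dl)).
  assert (Ha : 0 <= a) by (unfold a; apply Rmult_le_pos; lra).
  assert (Hab : a < b) by (unfold a, b; apply Rmult_lt_compat_l; lra).
  destruct (tL_near T (RtoC ((a ^ 2 + b ^ 2) / 2)) ((b ^ 2 - a ^ 2) / 2)) as [l [L1 [L2 [L3 [L4 L5]]]]]. nra.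
  specialize (L5 eq_refl).
  assert (Hl : l = RtoC (Re l)) by (apply C_ext; simpl; auto).
  rewrite Hl in L2. rewrite <- RtoC_minus, Cmod_R in L2. apply Rabs_def2 in L2.
  set (x := Re l) in *.
  assert (X1 : a ^ 2 < x) by lra. assert (X2 : x < b ^ 2) by lra.
  assert (X0 : 0 < x) by nra.
  set (s := sqrt x). assert (Hs : s * s = x) by (apply sqrt_sqrt; lra).
  assert (Hs0 : 0 < s) by now apply sqrt_lt_R0.
  assert (S1 : a < s) by nra. assert (S2 : s < b) by nra.
  set (r := s / Cmod K).
  assert (Hr : r * Cmod K = s) by (unfold r; field; lra).
  assert (R1 : Cmod d0 < r) by (apply Rmult_lt_reg_r with (Cmod K); unfold a in S1; lra).
  assert (R2 : r < Cmod d0 + dl) by (apply Rmult_lt_reg_r with (Cmod K); unfold b in S2; lra).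
  (* Only the modulus of d0 is changed: its direction is kept, and any direction serves if d0 =
     0. *)
  assert (Hu : exists u, Cmod u = 1 /\ d0 = (RtoC (Cmod d0) * u)%C).
  { destruct (Ceq_dec d0 0) as [->|Hn].
    - exists (RtoC 1). rewrite Cmod_1, Cmod_0. split; auto. ring.
    - assert (Hn' : 0 < Cmod d0) by (apply -> Cmod_gt_0; exact Hn).
      exists (d0 / RtoC (Cmod d0))%C.
      assert (RtoC (Cmod d0) <> 0) by (intros E; injection E; lra).
      split. rewrite Cmod_div, Cmod_R, Rabs_pos_eq by (auto; lra). field. lra. field. auto. }
  destruct Hu as [u [U1 U2]].
  exists (RtoC r * u)%C.
  assert (Hm : Cmod (RtoC r * u) = r) by (rewrite Cmod_mult, U1, Cmod_R, Rabs_pos_eq; lra).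
  split; [|split].
  - rewrite U2. replace (RtoC r * u - RtoC (Cmod d0) * u)%C with (RtoC (r - Cmod d0) * u)%C by (rewrite RtoC_minus; ring).
    rewrite Cmod_mult, U1, Cmod_R, Rabs_pos_eq by lra. lra.
  - apply <- Cmod_gt_0. lra.
  - rewrite Cmod_mult, Hm. replace ((Cmod K * r) ^ 2) with x.
    + rewrite <- Hl. split; auto.
    + replace (Cmod K * r) with s by lra. rewrite <- Hs. ring.
Qed.

Definition cj (sg : bool) (z : CC) : CC := if sg then Cconj z else z.

Lemma cj_minus sg a b : cj sg (a - b)%C = (cj sg a - cj sg b)%C.
Proof. destruct sg; simpl; auto. apply Cminus_conj. Qed.

Lemma Cmod_cj sg a : Cmod (cj sg a) = Cmod a.
Proof. destruct sg; simpl; auto. apply Cmod_conj. Qed.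

Lemma exact_period_shift (g : CC -> CC) m y s : exact_period g m y -> exact_period g m (Nat.iter s g y).
Proof.
  intros [H1 [H2 H3]]. split; auto. split.
  - rewrite iter_commute, H2. reflexivity.
  - intros l L1 L2 E. apply (H3 l L1 L2).
    assert (Ey : Nat.iter (s * m - s) g (Nat.iter s g y) = y).
    { rewrite <- iter_plus. replace (s * m - s + s)%nat with (s * m)%nat by nia. now apply iter_periodic. }
    rewrite <- Ey at 1. rewrite iter_commute, E. exact Ey.
Qed.

Lemma iter_deriv_nz (g : CC -> CC) y t : (forall j, deriv g (Nat.iter j g y) <> RtoC 0) -> iter_deriv g t y <> RtoC 0.
Proof.
  intros H. induction t; simpl. apply C1_nz. apply Cmult_neq_0; auto.
Qed.

Section Cycle.
Variable g : CC -> CC.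
Hypothesis Hent : entire g.
Hypothesis Hr : real_map g.
Variable T : targets.
Variable k : nat.
Variable w : nat -> CC.
Variable sg : bool.
Hypothesis Hk : (1 <= k)%nat.
Hypothesis Hstep : forall i, (S i < k)%nat -> g (w i) = w (S i).
Hypothesis Hlast : g (w (k - 1)%nat) = cj sg (w O).
Hypothesis Hunrel : forall i j, (i < j)%nat -> (j < k)%nat -> unrelated (w i) (w j).
Hypothesis Hder : forall i, (i < k)%nat -> deriv g (w i) <> RtoC 0.
Hypothesis Hgood : good T (if sg then RtoC (Cmod (iter_deriv g k (w O)) ^ 2) else iter_deriv g k (w O)).
Hypothesis Hnonreal : sg = true -> Cconj (w O) <> w O.

Lemma cycle_iter j : (j < k)%nat -> Nat.iter j g (w O) = w j.
Proof. induction j; intros H; simpl; auto. rewrite IHj by lia. now apply Hstep. Qed.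

Lemma cycle_close : Nat.iter k g (w O) = cj sg (w O).
Proof.
  replace k with (S (k - 1)) by lia. simpl. rewrite cycle_iter by lia. exact Hlast.
Qed.

Lemma cycle_orbit j : exists i, (i < k)%nat /\ (Nat.iter j g (w O) = w i \/ Nat.iter j g (w O) = Cconj (w i)).
Proof.
  assert (S1 : forall i, (i < k)%nat -> exists i', (i' < k)%nat /\ (g (w i) = w i' \/ g (w i) = Cconj (w i'))).
  { intros i Hi. destruct (Nat.eq_dec i (k - 1)) as [->|Hn].
    - exists O. split. lia. rewrite Hlast. unfold cj. case sg; auto.
    - exists (S i). split. lia. left. apply Hstep. lia. }
  induction j.
  - exists O. split. lia. now left.
  - destruct IHj as [i [Hi IH]]. destruct (S1 i Hi) as [i' [Hi' H']]. exists i'. split; auto.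
    simpl. destruct IH as [-> | ->]; auto. rewrite Hr.
    destruct H' as [-> | ->]; auto. rewrite Cconj_conj. auto.
Qed.

Lemma cycle_return i : (i < k)%nat -> exists s, Nat.iter s g (w i) = cj sg (w O).
Proof.
  intros Hi. exists (k - i)%nat. rewrite <- (cycle_iter i Hi), <- iter_plus.
  replace (k - i + i)%nat with k by lia. apply cycle_close.
Qed.

Lemma unrelated_neq (a b : CC) : unrelated a b -> a <> b /\ a <> Cconj b.
Proof.
  intros [H1 H2]. split; intros ->. now apply H1. apply H2. now rewrite Cmult_conj.
Qed.

(** If [sg] holds, the period is exactly 2k: a shorter one is excluded by unrelatedness below k and
    between k and 2k, and at k because [w 0] is not real. The second half of the orbit is the
    conjugate of the first. *)
Lemma cycle_multiplier m : exact_period g m (w O) -> good T (iter_deriv g m (w O)).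
Proof.
  intros [M1 [M2 M3]]. assert (Esg : sg = true \/ sg = false) by (case sg; auto).
  pose proof Hgood as HG. destruct Esg as [Esg|Esg]; rewrite Esg in HG.
  - assert (Hc : Nat.iter k g (w O) = Cconj (w O)) by (rewrite cycle_close, Esg; reflexivity).
    assert (H2k : Nat.iter (k + k) g (w O) = w O).
    { rewrite iter_plus, Hc, (iter_conj g Hr), Hc, Cconj_conj. reflexivity. }
    assert (m = (k + k)%nat) as ->.
    { destruct (Nat.lt_trichotomy m (k + k)) as [Hlt|[E|Hgt]]; auto.
      - exfalso. destruct (Nat.lt_trichotomy m k) as [L|[E|G]].
        + rewrite cycle_iter in M2 by assumption. destruct (unrelated_neq _ _ (Hunrel O m M1 L)). congruence.
        + subst m. rewrite Hc in M2. now apply Hnonreal.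
        + replace m with ((m - k) + k)%nat in M2 by lia. rewrite iter_plus, Hc, (iter_conj g Hr), cycle_iter in M2 by lia.
          destruct (unrelated_neq _ _ (Hunrel O (m - k)%nat ltac:(lia) ltac:(lia))). congruence.
      - exfalso. apply (M3 (k + k)%nat); auto. lia. }
    rewrite iter_deriv_plus, Hc, iter_deriv_conj, Cmult_comm by assumption. rewrite <- Cmod2_conj.
    exact HG.
  - assert (Hc : Nat.iter k g (w O) = w O) by (rewrite cycle_close, Esg; reflexivity).
    assert (m = k) as ->; auto.
    destruct (Nat.lt_trichotomy m k) as [L|[E|G]]; auto; exfalso.
    + rewrite cycle_iter in M2 by assumption. destruct (unrelated_neq _ _ (Hunrel O m M1 L)). congruence.
    + apply (M3 k); auto.
Qed.

(** The multiplier does not depend on the point of the cycle. With t steps leading from y2 back to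
    y, the derivative of g^(m + t) at y2 is expanded in two ways, and the derivative of g^t at y2,
    which is nonzero, is cancelled. *)
Lemma cycle_multiplier_any y m s : exact_period g m y ->
  Nat.iter s g y = w O \/ Nat.iter s g y = Cconj (w O) -> good T (iter_deriv g m y).
Proof.
  intros Hm Hs. set (y2 := Nat.iter s g y) in *.
  assert (Hm2 : exact_period g m y2) by now apply exact_period_shift.
  assert (Hd : forall j, deriv g (Nat.iter j g y2) <> RtoC 0).
  { intros j. destruct (cycle_orbit j) as [i [Hi Ho]].
    assert (Hcn : forall a : CC, a <> RtoC 0 -> Cconj a <> RtoC 0).
    { intros a Ha E. apply Ha. apply (f_equal Cconj) in E. rewrite Cconj_conj in E. rewrite E. apply C_ext; simpl; ring. }
    destruct Hs as [-> | ->].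
    - destruct Ho as [-> | ->]; auto. rewrite (deriv_conj g Hr) by assumption. auto.
    - rewrite (iter_conj g Hr), (deriv_conj g Hr) by assumption. apply Hcn.
      destruct Ho as [-> | ->]; auto. rewrite (deriv_conj g Hr) by assumption. auto. }
  assert (E : iter_deriv g m y = iter_deriv g m y2).
  { destruct Hm as [M1 [M2 _]]. destruct Hm2 as [_ [M4 _]].
    set (t := (s * m - s)%nat).
    assert (Ey : Nat.iter t g y2 = y).
    { unfold t, y2. rewrite <- iter_plus. replace (s * m - s + s)%nat with (s * m)%nat by nia. now apply iter_periodic. }
    pose proof (iter_deriv_plus g m t y2) as E1. pose proof (iter_deriv_plus g t m y2) as E2.
    rewrite Nat.add_comm, E1, Ey, M4 in E2.
    pose proof (iter_deriv_nz g y2 t Hd) as Hnz.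
    apply (f_equal (fun u => u / iter_deriv g t y2)%C) in E2.
    replace (iter_deriv g m y * iter_deriv g t y2 / iter_deriv g t y2)%C with (iter_deriv g m y) in E2 by (field; exact Hnz).
    rewrite E2. field. exact Hnz. }
  rewrite E. destruct Hs as [Hs|Hs]; rewrite Hs in *.
  - now apply cycle_multiplier.
  - rewrite (iter_deriv_conj g Hr) by assumption. apply good_conj. apply cycle_multiplier.
    destruct Hm2 as [M1 [M2 M3]]. split; auto. split.
    + rewrite (iter_conj g Hr) in M2. apply (f_equal Cconj) in M2. now rewrite !Cconj_conj in M2.
    + intros l L1 L2 E'. apply (M3 l L1 L2). rewrite (iter_conj g Hr), E'. reflexivity.
Qed.

End Cycle.

(** k is the least positive time at which the orbit meets z or conj z. Two related points before
    time k would have equal or conjugate images; skipping the stretch between them would bring the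
    orbit back to z or conj z too early. *)
Lemma cycle_representatives f n z : real_map f -> even_map f -> (1 <= n)%nat -> Nat.iter n f z = z ->
  exists k sg, (1 <= k)%nat /\ Nat.iter k f z = cj sg z /\ (sg = true -> Cconj z <> z) /\
    (forall j, (1 <= j)%nat -> (j < k)%nat -> Nat.iter j f z <> z /\ Nat.iter j f z <> Cconj z) /\
    (forall i j, (i < j)%nat -> (j < k)%nat -> unrelated (Nat.iter i f z) (Nat.iter j f z)).
Proof.
  intros Hr He Hn Hz.
  destruct (least_nat (fun k => (1 <= k)%nat /\ (Nat.iter k f z = z \/ Nat.iter k f z = Cconj z))) as [k [[Hk Hkz] Hmin]].
  { exists n. auto. }
  assert (Hmin' : forall j, (1 <= j)%nat -> (j < k)%nat -> Nat.iter j f z <> z /\ Nat.iter j f z <> Cconj z).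
  { intros j J1 J2. specialize (Hmin j J2). tauto. }
  assert (Hsg : exists sg, Nat.iter k f z = cj sg z /\ (sg = true -> Cconj z <> z)).
  { destruct (Ceq_dec (Cconj z) z) as [E|NE].
    - exists false. split. destruct Hkz; simpl; congruence. discriminate.
    - destruct Hkz as [E|E]. exists false. split; auto. exists true. split; auto. }
  destruct Hsg as [sg [S1 S2]].
  assert (G : forall i j, (i < j)%nat -> (j < k)%nat ->
  (Nat.iter i f z * Nat.iter i f z)%C = (Nat.iter j f z * Nat.iter j f z)%C \/
      (Nat.iter i f z * Nat.iter i f z)%C = Cconj (Nat.iter j f z * Nat.iter j f z) -> False).
  { intros i j Hij Hjk Hrel. apply (square_related_value f Hr He) in Hrel.
    assert (E : Nat.iter (k - (j - i)) f z = Nat.iter k f z \/ Nat.iter (k - (j - i)) f z = Cconj (Nat.iter k f z)).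
    { replace (k - (j - i))%nat with ((k - j - 1) + S i)%nat by lia.
      replace (Nat.iter k f z) with (Nat.iter ((k - j - 1) + S j) f z) by (f_equal; lia).
      rewrite !iter_plus. simpl. destruct Hrel as [-> | ->]; auto. right. now apply iter_conj. }
    destruct (Hmin' (k - (j - i))%nat) as [N1 N2]; try lia.
    rewrite S1 in E. destruct sg; simpl in E; rewrite ?Cconj_conj in E; tauto. }
  exists k, sg. repeat split; auto; try (apply (Hmin' j); assumption); intros E; apply (G i j); auto.
Qed.

(** The period n is a multiple of k, and an even multiple if the orbit closes up only to
    conjugation. The moved orbit closes in the same way, so the same n is a period of it. *)
Lemma period_transfer f g n k sg (z u : CC) : real_map f -> real_map g -> (1 <= k)%nat ->
  Nat.iter k f z = cj sg z -> (sg = true -> Cconj z <> z) ->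
  (forall j, (1 <= j)%nat -> (j < k)%nat -> Nat.iter j f z <> z /\ Nat.iter j f z <> Cconj z) ->
  Nat.iter n f z = z -> Nat.iter k g u = cj sg u -> Nat.iter n g u = u.
Proof.
  intros Hf Hg Hk Hz Hsg Hmin Hn Hu.
  assert (P : forall h v, real_map h -> Nat.iter k h v = cj sg v ->
    forall a, Nat.iter (a * k) h v = cj (andb sg (Nat.odd a)) v).
  { intros h v Hh Hv. induction a.
    - simpl. now rewrite Bool.andb_false_r.
    - simpl Nat.mul. rewrite iter_plus, IHa. rewrite Nat.odd_succ, <- Nat.negb_odd.
      destruct sg; simpl in *; auto. destruct (Nat.odd a); simpl; auto.
      rewrite (iter_conj h Hh), Hv, Cconj_conj. reflexivity. }
  assert (En : n = (n mod k + n / k * k)%nat) by (pose proof (Nat.div_mod_eq n k); lia).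
  pose proof (Nat.mod_upper_bound n k ltac:(lia)) as Hb.
  rewrite En in Hn |- *. rewrite iter_plus in Hn |- *.
  rewrite (P f z Hf Hz) in Hn. rewrite (P g u Hg Hu).
  set (b := (n mod k)%nat) in *. set (a := (n / k)%nat) in *. clearbody a b. clear En.
  assert (b = O) as ->.
  { destruct b; auto. exfalso. destruct (Hmin (S b)) as [N1 N2]; try lia.
    destruct (andb sg (Nat.odd a)); simpl cj in Hn.
    - rewrite (iter_conj f Hf) in Hn. apply N2. apply (f_equal Cconj) in Hn. now rewrite Cconj_conj in Hn.
    - contradiction. }
  simpl in Hn |- *. destruct sg; simpl in *; auto. destruct (Nat.odd a); simpl in *; auto.
  exfalso. now apply Hsg.
Qed.

(** * Pinning cycles *)

Section PinCycle.
Variable X : space.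
Variable T : targets.

Lemma finite_modulus_bound (l : list CC) : exists r, forall z, In z l -> Cmod z <= r.
Proof.
  induction l as [|a l [r H]]. exists 0. intros z [].
  exists (Rmax r (Cmod a)). intros z [<-|Hz]. apply Rmax_r. eapply Rle_trans; [|apply Rmax_l]. auto.
Qed.

Lemma periodic_off_nodes f A n z : (1 <= n)%nat -> Nat.iter n f z = z ->
  (forall x, node A x -> Nat.iter n f x = x -> forall j, node A (Nat.iter j f x)) ->
  (exists j, ~ node A (Nat.iter j f z)) -> forall j, ~ node A (Nat.iter j f z).
Proof.
  intros Hn Hz Hsep [j0 Hj0] j Hj. apply Hj0.
  assert (Hp : Nat.iter n f (Nat.iter j f z) = Nat.iter j f z) by (rewrite iter_commute, Hz; reflexivity).
  pose proof (Hsep _ Hj Hp (j0 + j * n - j)%nat) as H. rewrite <- iter_plus in H.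
  replace (j0 + j * n - j + j)%nat with (j0 + j * n)%nat in H by nia.
  rewrite iter_plus, iter_periodic in H by assumption. exact H.
Qed.

(** Values on the axes are real and real points stay real; running once around, a cycle that meets
    an axis is seen to be real. *)
Lemma periodic_axes f n z i j : real_map f -> even_map f -> (1 <= n)%nat -> Nat.iter n f z = z ->
  on_axes (Nat.iter i f z) -> Im (Nat.iter j f z) = 0.
Proof.
  intros Hr He Hn Hz Ha.
  assert (Hsucc : forall m, Im (Nat.iter (S m) f (Nat.iter i f z)) = 0).
  { induction m.
    - simpl. now apply on_axes_value.
    - simpl. simpl in IHm. apply on_axes_value; auto. apply on_axes_iff. now right. }
  destruct (Nat.eq_dec n 0) as [|Hn0]; [lia|].
  assert (E : Nat.iter j f z = Nat.iter (S (j + (i + 1) * n - i - 1)) f (Nat.iter i f z)).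
  { rewrite <- iter_plus. replace (S (j + (i + 1) * n - i - 1) + i)%nat with (j + (i + 1) * n)%nat by nia.
    rewrite iter_plus, iter_periodic; auto. }
  rewrite E. apply Hsucc.
Qed.

(** Only the representatives [x i] are moved, and q is interpolated to map each new point to the
    next. The conjugate half of the orbit follows because the perturbed map is real. *)
Lemma move_points f A N k (x : nat -> CC) sg m d r : inF X f -> 0 < d -> 0 < r -> (1 <= k)%nat ->
  (forall i, (i < k)%nat -> ~ node A (x i)) ->
  (forall i j, (i < j)%nat -> (j < k)%nat -> unrelated (x i) (x j)) ->
  (forall i, (S i < k)%nat -> f (x i) = x (S i)) -> f (x (k - 1)%nat) = cj sg (x O) ->
  exists q w, vanishing A N q /\ small X m d q /\
    (forall i, (i < k)%nat -> tE T (w i) /\ Cmod (w i - x i) < r /\ w i <> RtoC 0 /\ ~ node A (w i) /\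
       (Im (x i) = 0 -> Im (w i) = 0) /\ (on_axes (w i) -> on_axes (x i))) /\
    (forall i j, (i < j)%nat -> (j < k)%nat -> unrelated (w i) (w j)) /\
    (forall i, (S i < k)%nat -> fadd f q (w i) = w (S i)) /\ fadd f q (w (k - 1)%nat) = cj sg (w O).
Proof.
  intros Hf Hd Hr Hk HA Hu Hstep Hlast.
  set (zs := map x (seq 0 k)).
  assert (Hzs : forall z, In z zs <-> exists i, (i < k)%nat /\ z = x i).
  { intros z. unfold zs. rewrite in_map_iff. split.
    - intros [i [<- Hi]]. apply in_seq in Hi. exists i. split; auto. lia.
    - intros [i [Hi ->]]. exists i. split; auto. apply in_seq. lia. }
  assert (Hord : ForallOrdPairs unrelated zs) by (apply ForallOrdPairs_seq; intros; apply Hu; lia).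
  assert (Hinj : forall i j, (i < k)%nat -> (j < k)%nat -> x i = x j -> i = j).
  { intros i j Hi Hj E. destruct (Nat.lt_trichotomy i j) as [L|[E'|G]]; auto; exfalso.
    - destruct (unrelated_neq _ _ (Hu i j L Hj)). contradiction.
    - destruct (unrelated_neq _ _ (Hu j i G Hi)). congruence. }
  destruct (vanishing_interpolation X A N zs m d) as [eta [Heta Hint]]; auto.
  { intros z Hz. apply Hzs in Hz. destruct Hz as [i [Hi ->]]. auto. }
  destruct (finite_modulus_bound zs) as [R0 HR0].
  destruct (disc_uniform f R0 (eta / 2)) as [dc [Hdc Hc]]. { intros; eapply entire_ccont, inF_entire; eauto. } lra.
  destruct (ForallOrdPairs_unrelated_open zs Hord) as [e1 [He1 Hop]].
  destruct (on_axes_open zs) as [e2 [He2 Hax]].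
  set (rr := Rmin (Rmin r (eta / 2)) (Rmin dc (Rmin e1 e2))).
  assert (Hrr : 0 < rr) by (unfold rr; repeat apply Rmin_pos; lra).
  assert (B1 : rr <= r) by below_min.
  assert (B2 : rr <= eta / 2) by below_min.
  assert (B3 : rr <= dc) by below_min.
  assert (B4 : rr <= e1) by below_min.
  assert (B5 : rr <= e2) by below_min.
  destruct (choice (fun u w => tE T w /\ Cmod (w - u) < rr /\ same_kind u w /\ ~ In w (RtoC 0 :: symlist A))) as [g Hg].
  { intros u. apply tE_near. exact Hrr. }
  assert (Hfr := inF_real _ _ Hf). assert (Hfe := inF_even _ _ Hf).
  (* [g] is a function of the point, so [g (f u)] is already the choice made for the successor. At
     the last index [g] need not commute with conjugation, so the value that closes the orbit is
     prescribed separately. *)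
  destruct (Hint g (fun u => if Ceq_dec u (x (k - 1)%nat) then (cj sg (g (x O)) - f (g u))%C else (g (f u) - f (g u))%C))
    as [q [Q1 [Q2 Q3]]].
  - intros z Hz. destruct (Hg z) as [_ [G1 [[_ G2] _]]]. split; auto. lra.
  - intros z Hz. destruct (Hg z) as [_ [G1 [[G2 G3] _]]].
    assert (Hfz : Cmod (f (g z) - f z) < eta / 2) by (apply Hc; auto; lra).
    rewrite Cmod_minus_sym in Hfz.
    destruct (Ceq_dec z (x (k - 1)%nat)) as [->|Hne].
    + destruct (Hg (x O)) as [_ [G1' [[G2' _] _]]]. split.
      * pose proof (Cmod_le_via (cj sg (g (x O))) (f (x (k - 1)%nat)) (f (g (x (k - 1)%nat)))) as Hv.
        rewrite Hlast, <- cj_minus, Cmod_cj in Hv. rewrite Hlast in Hfz. lra.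
      * intros Ha. change (Im (cj sg (g (x O))) - Im (f (g (x (k - 1)%nat))) = 0).
        rewrite (on_axes_value f Hfr Hfe (g (x (k - 1)%nat))) by auto.
        pose proof (on_axes_value f Hfr Hfe _ Ha) as Hi. rewrite Hlast in Hi.
        assert (Hi0 : Im (x O) = 0) by (destruct sg; cbn [cj] in Hi; [rewrite im_conj in Hi; lra|exact Hi]).
        specialize (G2' Hi0). destruct sg; cbn [cj]; rewrite ?im_conj, G2'; ring.
    + destruct (Hg (f z)) as [_ [G1' [[G2' _] _]]]. split.
      * pose proof (Cmod_le_via (g (f z)) (f z) (f (g z))). lra.
      * intros Ha. change (Im (g (f z)) - Im (f (g z)) = 0).
        rewrite (on_axes_value f Hfr Hfe (g z)) by auto. rewrite G2'. ring. now apply on_axes_value.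
  - exists q, (fun i => g (x i)). split; auto. split; auto.
    assert (Hval : forall i, (i < k)%nat -> q (g (x i)) = if Ceq_dec (x i) (x (k - 1)%nat) then (cj sg (g (x O)) - f (g (x i)))%C else (g (f (x i)) - f (g (x i)))%C).
    { intros i Hi. rewrite (Q3 (x i)); auto. apply Hzs. eauto. }
    split; [|split; [|split]].
    + intros i Hi. destruct (Hg (x i)) as [G0 [G1 [[G2 G3] G4]]]. repeat split; auto.
      * lra.
      * intros E. apply G4. left. now symmetry.
      * intros Hn. apply G4. right. now apply node_symlist.
      * apply Hax. apply Hzs; eauto. lra.
    + assert (Hop2 : ForallOrdPairs unrelated (map g zs)).
      { apply Hop. intros z Hz. destruct (Hg z) as [_ [G1 [[_ G2] _]]]. split; auto. lra. }
      unfold zs in Hop2. rewrite map_map in Hop2. clear - Hop2.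
      assert (G : forall (y : nat -> CC) m s, ForallOrdPairs unrelated (map y (seq s m)) ->
        forall i j, (s <= i)%nat -> (i < j)%nat -> (j < s + m)%nat -> unrelated (y i) (y j)).
      { clear. intros y m. induction m; intros s H i j H1 H2 H3. lia.
        simpl in H. inversion_clear H. destruct (Nat.eq_dec s i) as [->|Hne].
        - rewrite Forall_forall in H0. apply H0. apply in_map. apply in_seq. lia.
        - apply (IHm (S s)); auto; lia. }
      intros i j H1 H2. apply (G (fun i => g (x i)) k 0%nat); auto; lia.
    + intros i Hi. unfold fadd. rewrite Hval by lia. destruct (Ceq_dec (x i) (x (k - 1)%nat)) as [E|NE].
      * apply Hinj in E; lia.
      * rewrite Hstep by assumption. ring.
    + unfold fadd. rewrite Hval by lia. destruct (Ceq_dec (x (k - 1)%nat) (x (k - 1)%nat)) as [E|NE]; [ring|congruence].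
Qed.

(** The factor of index 0 is left out: it is the free one with which the multiplier is tuned. *)
Fixpoint partial_product (e : nat -> CC) (m : nat) : CC :=
  match m with O => RtoC 1 | S m' => (e (S m') * partial_product e m')%C end.

Lemma partial_product_neq_0 e m : (forall i, (1 <= i <= m)%nat -> e i <> RtoC 0) -> partial_product e m <> RtoC 0.
Proof.
  induction m; intros H; simpl. apply C1_nz. apply Cmult_neq_0. apply H; lia. apply IHm. intros; apply H; lia.
Qed.

Lemma partial_product_real e m : (forall i, (1 <= i <= m)%nat -> Im (e i) = 0) -> Im (partial_product e m) = 0.
Proof.
  induction m; intros H; simpl partial_product. reflexivity. apply Im_mult_real. apply H; lia. apply IHm. intros; apply H; lia.
Qed.

(** Away from [w 0] derivatives are only made nonzero; the one at [w 0] then puts the multiplier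
    into Lambda. As q vanishes at all the points, the orbit is kept. *)
Lemma adjust_derivatives f A N k (w : nat -> CC) sg m d : inF X f -> (2 <= N)%nat -> 0 < d -> (1 <= k)%nat ->
  (forall i, (i < k)%nat -> ~ node A (w i) /\ w i <> RtoC 0 /\ (on_axes (w i) -> forall j, (j < k)%nat -> Im (w j) = 0)) ->
  (forall i j, (i < j)%nat -> (j < k)%nat -> unrelated (w i) (w j)) ->
  (forall i, (S i < k)%nat -> f (w i) = w (S i)) -> f (w (k - 1)%nat) = cj sg (w O) ->
  (sg = true -> Cconj (w O) <> w O) ->
  exists q, vanishing A N q /\ small X m d q /\ (forall i, (i < k)%nat -> fadd f q (w i) = f (w i)) /\
    (forall i, (i < k)%nat -> deriv (fadd f q) (w i) <> RtoC 0) /\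
    good T (if sg then RtoC (Cmod (iter_deriv (fadd f q) k (w O)) ^ 2) else iter_deriv (fadd f q) k (w O)).
Proof.
  intros Hf HN Hd Hk Hw Hu Hstep Hlast Hsg.
  assert (Hent := inF_entire _ _ Hf). assert (Hfr := inF_real _ _ Hf).
  set (ws := map w (seq 0 k)).
  assert (Hws : forall u, In u ws <-> exists i, (i < k)%nat /\ u = w i).
  { intros z. unfold ws. rewrite in_map_iff. split.
    - intros [i [<- Hi]]. apply in_seq in Hi. exists i. split; auto. lia.
    - intros [i [Hi ->]]. exists i. split; auto. apply in_seq. lia. }
  destruct (derivative_pass X A N ws m d) as [dl [Hdl Hpass]]; auto.
  { intros u Hu'. apply Hws in Hu'. destruct Hu' as [i [Hi ->]]. destruct (Hw i Hi) as [W1 [W2 W3]].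
    split; auto. }
  { apply ForallOrdPairs_seq. intros; apply Hu; lia. }
  (* A vanishing derivative is replaced by dl / 2, which is real and hence permitted on the real
     axis too; other derivatives stay. *)
  set (e1 := fun u => if Ceq_dec (deriv f u) 0 then RtoC (dl / 2) else RtoC 0).
  assert (He1 : forall u, Cmod (e1 u) < dl /\ Im (e1 u) = 0 /\ (deriv f u + e1 u)%C <> RtoC 0).
  { intros u. unfold e1. destruct (Ceq_dec (deriv f u) 0) as [E|NE]; rewrite Cmod_R.
    - rewrite Rabs_pos_eq by lra. rewrite E. repeat split. lra. replace (0 + RtoC (dl / 2))%C with (RtoC (dl / 2)) by ring.
      intros H. injection H. lra.
    - rewrite Rabs_R0. repeat split; auto. replace (deriv f u + 0)%C with (deriv f u) by ring. exact NE. }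
  set (K := partial_product (fun i => (deriv f (w i) + e1 (w i))%C) (k - 1)).
  assert (HK : K <> RtoC 0) by (apply partial_product_neq_0; intros; apply He1).
  assert (HKr : on_axes (w O) -> Im K = 0 /\ Im (deriv f (w O)) = 0).
  { intros Ha. destruct (Hw O) as [_ [_ W3]]. lia. specialize (W3 Ha). split.
    - apply partial_product_real. intros i Hi. rewrite im_plus.
      rewrite (proj1 (proj2 (He1 (w i)))). rewrite (deriv_real f Hfr) by (auto; apply W3; lia). ring.
    - apply (deriv_real f Hfr (w O) Hent). apply W3. lia. }
  assert (Hd0 : exists d0, Cmod (d0 - deriv f (w O)) < dl /\ d0 <> RtoC 0 /\
    good T (if sg then RtoC (Cmod (K * d0) ^ 2) else (K * d0)%C) /\ (on_axes (w O) -> Im d0 = 0)).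
  { destruct sg.
    - destruct (choose_factor_selfconj T K (deriv f (w O)) dl HK Hdl) as [d0 [D1 [D2 D3]]].
      exists d0. repeat split; auto; try apply D3. intros Ha. exfalso. apply Hsg; auto. apply conj_fixed.
      destruct (Hw O) as [_ [_ W3]]. lia. apply W3; auto.
    - destruct (choose_factor T K (deriv f (w O)) dl HK Hdl) as [d0 [D1 [D2 [D3 D4]]]].
      exists d0. repeat split; auto; try apply D3. intros Ha. destruct (HKr Ha). auto. }
  destruct Hd0 as [d0 [D1 [D2 [D3 D4]]]].
  destruct (Hpass (fun u => if Ceq_dec u (w O) then (d0 - deriv f (w O))%C else e1 u)) as [q [Q1 [Q2 Q3]]].
  { intros u _. destruct (Ceq_dec u (w O)) as [->|Hne].
    - split; auto. intros Ha. change (Im d0 - Im (deriv f (w O)) = 0). rewrite (D4 Ha), (proj2 (HKr Ha)). ring.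
    - split. apply He1. intros _. apply He1. }
  exists q. split; auto. split; auto.
  assert (Hq : inF X q) by (eapply vanishing_inF; eauto).
  assert (Hv : forall i, (i < k)%nat -> fadd f q (w i) = f (w i)).
  { intros i Hi. unfold fadd. destruct (Q3 (w i)) as [-> _]. apply Hws; eauto. ring. }
  assert (Hdv : forall i, (i < k)%nat -> deriv (fadd f q) (w i) = if Nat.eq_dec i 0 then d0 else (deriv f (w i) + e1 (w i))%C).
  { intros i Hi. apply deriv_unique. destruct (Q3 (w i)) as [_ Qd]. apply Hws; eauto.
    assert (Hc := cder_plus f q (w i) _ _ (deriv_correct f (w i) Hent) Qd).
    destruct (Ceq_dec (w i) (w O)) as [E|NE].
    - destruct (Nat.eq_dec i 0) as [->|Hi0].
      + replace d0 with (deriv f (w O) + (d0 - deriv f (w O)))%C by ring. exact Hc.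
      + exfalso. destruct (unrelated_neq _ _ (Hu O i ltac:(lia) Hi)). congruence.
    - destruct (Nat.eq_dec i 0) as [->|Hi0]; [congruence|]. exact Hc. }
  split; auto. split.
  { intros i Hi. rewrite Hdv by assumption. destruct (Nat.eq_dec i 0); auto. apply He1. }
  assert (Hit : forall i, (i < k)%nat -> Nat.iter i (fadd f q) (w O) = w i).
  { intros i Hi. refine (cycle_iter (fadd f q) k w Hk _ i Hi). intros i1 Hi1. rewrite Hv by lia. auto. }
  assert (HD : iter_deriv (fadd f q) k (w O) = (K * d0)%C).
  { assert (G : forall i, (i < k)%nat -> iter_deriv (fadd f q) (S i) (w O) = (partial_product (fun i => (deriv f (w i) + e1 (w i))%C) i * d0)%C).
    { induction i; intros Hi.
      - simpl. rewrite (Hdv O Hi). simpl. ring.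
      - change (iter_deriv (fadd f q) (S (S i)) (w O)) with
          (deriv (fadd f q) (Nat.iter (S i) (fadd f q) (w O)) * iter_deriv (fadd f q) (S i) (w O))%C.
        rewrite IHi, Hit, Hdv by lia. simpl. ring. }
    replace k with (S (k - 1)) by lia. rewrite G by lia. reflexivity. }
  rewrite HD. exact D3.
Qed.

Lemma pin_cycle f A N n z m d : Inv X T f A -> (2 <= N)%nat -> (1 <= n)%nat -> 0 < d ->
  Nat.iter n f z = z ->
  (forall x, node A x -> Nat.iter n f x = x -> forall j, node A (Nat.iter j f x)) ->
  (exists j, ~ node A (Nat.iter j f z)) ->
  exists q B w, vanishing A N q /\ small X m d q /\ Inv X T (fadd f q) (B ++ A) /\
    Nat.iter n (fadd f q) w = w /\ (forall j, node (B ++ A) (Nat.iter j (fadd f q) w)) /\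
    Cmod (w - z) < 1 /\ ~ node A w.
Proof.
  intros HI HN Hn Hd Hz Hsep Hex. assert (Hf : inF X f) by apply HI.
  assert (Hfr := inF_real _ _ Hf). assert (Hfe := inF_even _ _ Hf).
  assert (Hoff := periodic_off_nodes f A n z Hn Hz Hsep Hex).
  destruct (small_separation X f) as [n1 [d1 [Hd1 Hs1]]]. { apply HI. }
  destruct (small_meet X n1 d1 m d Hd1 Hd) as [n2 [d2 [Hd2 Hm]]].
  destruct (cycle_representatives f n z Hfr Hfe Hn Hz) as [k [sg [Hk [Hcl [Hsg [Hmin Hunr]]]]]].
  (* Half of the allowance moves the points, the other half adjusts the derivatives. The radius 1
     keeps the new periodic point within 1 of z. *)
  destruct (move_points f A N k (fun i => Nat.iter i f z) sg n2 (d2 / 2) 1) as [q1 [w [V1 [S1 [W1 [W2 [W3 W4]]]]]]]; auto; try lra.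
  { simpl. replace k with (S (k - 1)) in Hcl by lia. exact Hcl. }
  assert (Hq1 : inF X q1) by (eapply vanishing_inF; eauto).
  assert (Hg1 : inF X (fadd f q1)) by now apply inF_add.
  assert (Hsg' : sg = true -> Cconj (w O) <> w O).
  { intros Es E. apply (Hsg Es). apply conj_fixed. apply conj_fixed in E.
    destruct (W1 O) as [_ [_ [_ [_ [_ Hax]]]]]. lia.
    apply (periodic_axes f n z O O); auto. apply Hax. apply on_axes_iff. now right. }
  destruct (adjust_derivatives (fadd f q1) A N k w sg n2 (d2 / 2)) as [q2 [V2 [S2 [Y1 [Y2 Y3]]]]]; auto; try lra.
  { intros i Hi. destruct (W1 i Hi) as [U1 [U2 [U3 [U4 [U5 U6]]]]]. split; auto. split; auto.
    intros Ha j Hj. apply (W1 j Hj). apply (periodic_axes f n z i j); auto. }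
  assert (Hq2 : inF X q2) by (eapply vanishing_inF; eauto).
  set (q := fadd q1 q2).
  assert (Hq : inF X q) by now apply inF_add.
  assert (Hsm : small X n2 d2 q).
  { unfold q. replace d2 with (d2 / 2 + d2 / 2) by lra. now apply small_add. }
  destruct (Hm q Hsm) as [Sm1 Sm2].
  assert (Eg : fadd (fadd f q1) q2 = fadd f q) by apply fadd_assoc.
  rewrite Eg in *.
  set (g := fadd f q) in *.
  assert (Hg : inF X g) by now apply inF_add.
  assert (Hgr := inF_real _ _ Hg). assert (Hge := inF_even _ _ Hg). assert (Hgent := inF_entire _ _ Hg).
  assert (Hstep : forall i, (S i < k)%nat -> g (w i) = w (S i)).
  { intros i Hi. rewrite Y1 by lia. auto. }
  assert (Hlast : g (w (k - 1)%nat) = cj sg (w O)) by (rewrite Y1 by lia; auto).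
  set (B := map w (seq 0 k)).
  assert (HB : forall u, In u B <-> exists i, (i < k)%nat /\ u = w i).
  { intros u. unfold B. rewrite in_map_iff. split.
    - intros [i [<- Hi]]. apply in_seq in Hi. exists i. split; auto. lia.
    - intros [i [Hi ->]]. exists i. split; auto. apply in_seq. lia. }
  exists q, B, (w O). fold g.
  assert (Horb : forall j, node (B ++ A) (Nat.iter j g (w O))).
  { intros j. destruct (cycle_orbit g Hgr k w sg Hk Hstep Hlast j) as [i [Hi Ho]].
    assert (Hni : node (B ++ A) (w i)) by (apply node_self, in_or_app; left; apply HB; eauto).
    destruct Ho as [-> | ->]; auto. now apply node_conj. }
  split. { now apply vanishing_add. } split; auto. split; [|split; [|split; [|split]]].
  - apply (Inv_extend X T f A N q B); auto.
    + now apply vanishing_add.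
    + intros u Hu. apply HB in Hu. destruct Hu as [i [Hi ->]]. split. now apply W1.
      fold g. destruct (Nat.eq_dec i (k - 1)) as [->|Hne].
      * rewrite Hlast. destruct sg; simpl. apply tE_conj, W1; lia. apply W1; lia.
      * rewrite Hstep by lia. apply W1. lia.
    (* A new node on a cycle of nodes is related to some [w i], so its image is some [w i'] or its
       conjugate, from where the orbit reaches [w 0] or its conjugate. Hence the cycle is the one
       just built or its mirror image. *)
    + fold g. intros y p Hp Hj [j Hnj]. assert (Hjj := Hj j). apply node_app in Hjj.
      destruct Hjj as [[b [Hb Hrel]]|]; [|contradiction]. apply HB in Hb. destruct Hb as [i [Hi ->]].
      assert (Ho : exists i', (i' < k)%nat /\ (g (w i) = w i' \/ g (w i) = Cconj (w i'))).
      { destruct (Nat.eq_dec i (k - 1)) as [->|Hne].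
        exists O. split. lia. rewrite Hlast. destruct sg; simpl; auto.
        exists (S i). split. lia. left. apply Hstep. lia. }
      destruct Ho as [i' [Hi' Ho]].
      destruct (cycle_return g k w sg Hk Hstep Hlast i' Hi') as [s Hs].
      apply (cycle_multiplier_any g Hgent Hgr T k w sg Hk Hstep Hlast W2 Y2 Y3 Hsg' y p (s + S j)); auto.
      rewrite iter_plus. simpl.
      destruct (square_related_value g Hgr Hge _ _ Hrel) as [E|E]; rewrite E; destruct Ho as [-> | ->];
        rewrite ?Cconj_conj, ?(iter_conj g Hgr), Hs; destruct sg; simpl; rewrite ?Cconj_conj; auto.
  - apply (period_transfer f g n k sg z (w O)); auto.
    apply (cycle_close g k w sg Hk Hstep Hlast).
  - exact Horb.
  - apply (W1 O). lia.
  - apply (W1 O). lia.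
Qed.

End PinCycle.

(** * Pinning all zeros in a disc *)

Section Task.
Variable X : space.
Variable T : targets.
Variable Phi : (CC -> CC) -> CC -> CC.
Variable Pinned : (CC -> CC) -> list CC -> CC -> Prop.
Variable R0 : R.
Hypothesis HR0 : 1 <= R0.
Hypothesis Phi_entire : forall f, inF X f -> entire (Phi f).
Hypothesis Phi_close : forall f R1 eps, inF X f -> 0 < eps ->
  exists m d, 0 < d /\ forall q, inF X q -> small X m d q ->
    forall z, Cmod z <= R1 -> Cmod (Phi (fadd f q) z - Phi f z) < eps.
Hypothesis Phi_nonzero : forall f A, Inv X T f A -> exists c, Cmod c <= 1 /\ Phi f c <> RtoC 0.
Hypothesis Pinned_zero : forall f A z, Pinned f A z -> Phi f z = RtoC 0.
Hypothesis Pinned_stable : forall f A N q B z, Inv X T f A -> (2 <= N)%nat -> vanishing A N q ->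
  Pinned f A z -> Pinned (fadd f q) (B ++ A) z.
Hypothesis Pin_step : forall f A N m d, Inv X T f A -> (2 <= N)%nat -> 0 < d ->
  exists q B, vanishing A N q /\ small X m d q /\ Inv X T (fadd f q) (B ++ A) /\
   ((forall z, Cmod z <= R0 -> Phi (fadd f q) z = RtoC 0 -> Pinned (fadd f q) (B ++ A) z) \/
    exists z, Cmod z <= R0 + 1 /\ Pinned (fadd f q) (B ++ A) z /\ ~ Pinned f A z).
Hypothesis Phi_divides : forall f A l u, Inv X T f A -> entire u ->
  (forall z, Phi f z = (prodl l z * u z)%C) -> (forall a, In a l -> Pinned f A a) ->
  exists N, forall q, vanishing A N q -> exists v, entire v /\
    forall z, (Phi (fadd f q) z - Phi f z)%C = (prodl l z * v z)%C.

(* Each step pins a new zero; Jensen's bound, uniform near [f], stops the process. *)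
Lemma pin_all f A N m d : Inv X T f A -> (2 <= N)%nat -> 0 < d ->
  exists q B, vanishing A N q /\ small X m d q /\ Inv X T (fadd f q) (B ++ A) /\
    forall z, Cmod z <= R0 -> Phi (fadd f q) z = RtoC 0 -> Pinned (fadd f q) (B ++ A) z.
Proof.
  intros HI HN Hd. assert (Hf : inF X f) by apply HI.
  destruct (Phi_nonzero f A HI) as [c [Hc1 Hc2]].
  assert (Hc0 : 0 < Cmod (Phi f c)) by (apply -> Cmod_gt_0; exact Hc2).
  set (mm := Cmod (Phi f c) / 2). assert (Hmm : 0 < mm) by (unfold mm; lra).
  (* Contains the circle of radius 6 (R0 + 1) about c used in the count, since |c| <= 1. The count
     runs over the disc of radius R0 + 1, because a pinned zero may lie up to 1 away from the zero
     it replaces. *)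
  destruct (disc_bounded (Phi f) (6 * (R0 + 1) + 1)) as [M [HM BM]].
  { intros z. apply entire_ccont. auto. }
  destruct (Phi_close f (6 * (R0 + 1) + 1) (Rmin mm 1) Hf) as [m0 [d0 [Hd0 Hcl]]]. { apply Rmin_pos; lra. }
  destruct (small_meet X m d m0 d0 Hd Hd0) as [m1 [D [HD Hmeet]]].
  destruct (distinct_zeros_bound (R0 + 1) mm (M + 1) Hmm) as [K HK].
  assert (Hbound : forall q L, inF X q -> small X m1 D q -> NoDup L ->
     (forall a, In a L -> Phi (fadd f q) a = RtoC 0 /\ Cmod a <= R0 + 1) -> (length L <= K)%nat).
  { intros q L Hq Hs HL HLz. destruct (Hmeet q Hs) as [_ Hs0].
    assert (Hg : inF X (fadd f q)) by now apply inF_add.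
    apply (HK (Phi (fadd f q)) L c); auto; try lra.
    - intros z Hz. assert (Hz' : Cmod z <= 6 * (R0 + 1) + 1).
      { pose proof (Cmod_triangle (z - c) c). replace (z - c + c)%C with z in H by ring. lra. }
      specialize (Hcl q Hq Hs0 z Hz'). specialize (BM z Hz'). pose proof (Rmin_r mm 1).
      pose proof (Cmod_sub_ge (Phi (fadd f q) z) (Phi f z)). lra.
    - assert (Hc' : Cmod c <= 6 * (R0 + 1) + 1) by lra.
      specialize (Hcl q Hq Hs0 c Hc'). pose proof (Rmin_l mm 1).
      pose proof (Cmod_sub_ge (Phi f c) (Phi (fadd f q) c)). rewrite Cmod_minus_sym in H0. unfold mm in *. lra. }
  (* One share per step: [L] never has more than K + 1 entries, and [fzero] takes a share too
     because [small] is strict. So K + 3 shares suffice. *)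
  set (de := D / INR (K + 3)).
  assert (HK3 : 0 < INR (K + 3)) by (apply lt_0_INR; lia).
  assert (Hde : 0 < de) by now apply Rdiv_lt_0_compat.
  assert (Hbud : forall i, (i <= K + 3)%nat -> INR i * de <= D).
  { intros i Hi. apply le_INR in Hi. unfold de. apply Rmult_le_reg_r with (INR (K + 3)); auto.
    replace (INR i * (D / INR (K + 3)) * INR (K + 3)) with (INR i * D) by (field; lra). nra. }
  assert (Loop : forall fuel q B L, (length L + fuel = K + 1)%nat -> vanishing A N q ->
     small X m1 (INR (S (length L)) * de) q -> Inv X T (fadd f q) (B ++ A) -> NoDup L ->
     (forall a, In a L -> Pinned (fadd f q) (B ++ A) a /\ Cmod a <= R0 + 1) ->
     exists q B, vanishing A N q /\ small X m d q /\ Inv X T (fadd f q) (B ++ A) /\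
       forall z, Cmod z <= R0 -> Phi (fadd f q) z = RtoC 0 -> Pinned (fadd f q) (B ++ A) z).
  { induction fuel; intros q B L Hlen Hq Hs Hinv HL HLp.
    - exfalso. assert (length L <= K)%nat; [|lia].
      apply (Hbound q); auto. eapply vanishing_inF; eauto.
      eapply small_mono; [apply Nat.le_refl| |exact Hs]. apply Hbud. lia.
      intros a Ha. destruct (HLp a Ha). split; eauto.
    - destruct (Pin_step (fadd f q) (B ++ A) N m1 de Hinv HN Hde) as [q' [B' [V' [S' [I' Hor]]]]].
      rewrite fadd_assoc, app_assoc in *.
      assert (Hq1 : inF X q) by (eapply vanishing_inF; eauto).
      assert (Hq2 : inF X q') by (eapply vanishing_inF; eauto).
      assert (Vq : vanishing A N (fadd q q')).
      { apply vanishing_add; auto. apply (vanishing_weaken A B N N); auto. }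
      assert (Sq : small X m1 (INR (S (S (length L))) * de) (fadd q q')).
      { rewrite S_INR, Rmult_plus_distr_r, Rmult_1_l. now apply small_add. }
      destruct Hor as [Hdone|[z [Z1 [Z2 Z3]]]].
      + exists (fadd q q'), (B' ++ B). split; auto. split; auto.
        apply (Hmeet (fadd q q')). eapply small_mono; [apply Nat.le_refl| |exact Sq]. apply Hbud. lia.
      + apply (IHfuel (fadd q q') (B' ++ B) (z :: L)); auto.
        * simpl. lia.
        * constructor; auto. intros Hin. apply Z3. now apply HLp.
        * intros a [<-|Ha]; auto. destruct (HLp a Ha) as [P1 P2]. split; auto.
          rewrite <- fadd_assoc, <- app_assoc. now apply (Pinned_stable _ (B ++ A) N). }
  apply (Loop (K + 1)%nat fzero nil nil).
  - reflexivity.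
  - apply vanishing_zero.
  - simpl. apply small_zero. lra.
  - rewrite fadd_zero. exact HI.
  - constructor.
  - intros a [].
Qed.

(** N', m' and d' are what later perturbations must respect: the order makes the change of Phi
    divisible by [prodl l], the size keeps the quotient below the zero-free factor. *)
Lemma complete_task f A N m d : Inv X T f A -> (2 <= N)%nat -> 0 < d ->
  exists q B N' m' d' l dl, vanishing A N q /\ small X m d q /\ Inv X T (fadd f q) (B ++ A) /\
    (N <= N')%nat /\ 0 < d' /\ 0 < dl /\ (forall a, In a l -> Pinned (fadd f q) (B ++ A) a) /\
    forall q', vanishing (B ++ A) N' q' -> small X m' d' q' ->
      forall z, Cmod z <= R0 -> dl * Cmod (prodl l z) <= Cmod (Phi (fadd (fadd f q) q') z).
Proof.
  intros HI HN Hd. destruct (pin_all f A N m d HI HN Hd) as [q [B [V [S1 [I1 Hall]]]]].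
  set (g := fadd f q) in *. assert (Hg : inF X g) by apply I1.
  destruct (Phi_nonzero g (B ++ A) I1) as [c [Hc1 Hc2]].
  destruct (zero_factorization (Phi g) R0 c) as [l [u [Hu [E [Hl Hnz]]]]]; auto; try lra.
  assert (Hpin : forall a, In a l -> Pinned g (B ++ A) a).
  { intros a Ha. apply Hall; auto. rewrite E. apply prodl_zero in Ha. rewrite Ha. ring. }
  destruct (Phi_divides g (B ++ A) l u I1 Hu E Hpin) as [N1 HN1].
  destruct (zero_stability (Phi g) l u R0) as [dl [eps [Hdl [Heps Hst]]]]; auto. lra.
  destruct (Phi_close g (3 * R0 + 1) eps Hg Heps) as [m' [d' [Hd' Hcl]]].
  exists q, B, (Nat.max N N1), m', d', l, dl. fold g.
  split; [exact V|]. split; [exact S1|]. split; [exact I1|]. split; [lia|]. do 2 (split; [assumption|]). split; [exact Hpin|].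
  intros q' V' S' z Hz.
  destruct (HN1 q') as [v [Hv Ev]]. { apply (vanishing_weaken (B ++ A) nil N1 (Nat.max N N1)); auto. lia. }
  assert (Hq' : inF X q') by (eapply vanishing_inF; eauto).
  replace (Phi (fadd g q') z) with (Phi g z + (Phi (fadd g q') z - Phi g z))%C by ring.
  apply (Hst (fun z => Phi (fadd g q') z - Phi g z)%C v); auto.
  intros w Hw. left. now apply Hcl.
Qed.

End Task.

(** * The two kinds of zeros: preimages of a point, fixed points of an iterate *)

Section Instances.
Variable X : space.
Variable T : targets.

(** A node may be repeated in [l] when f - e has a multiple zero there. One factor [qa A] for each
    entry absorbs any multiplicity. *)
Lemma qa_power_divisible A l : (forall a, In a l -> node A a) ->
  exists v, entire v /\ forall z, (ev (qa A) z ^ length l)%C = (prodl l z * v z)%C.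
Proof.
  induction l as [|a l IH]; intros H.
  - exists (fun _ => RtoC 1). split. apply entire_const. intros z; simpl; ring.
  - destruct IH as [v [Hv E]]. { intros; apply H; now right. }
    destruct (entire_div (ev (qa A)) a) as [w [Hw Ew]]. apply entire_ev. apply ev_qa_zero, H; now left.
    exists (fun z => w z * v z)%C. split. now apply entire_mult.
    intros z. simpl. rewrite E. rewrite Ew at 1. ring.
Qed.

Lemma preimage_task f A N m d e R0 : 1 <= R0 -> tE T e -> Inv X T f A -> (2 <= N)%nat -> 0 < d ->
  exists q B N' m' d' l dl, vanishing A N q /\ small X m d q /\ Inv X T (fadd f q) (B ++ A) /\
    (N <= N')%nat /\ 0 < d' /\ 0 < dl /\ (forall a, In a l -> node (B ++ A) a /\ fadd f q a = e) /\
    forall q', vanishing (B ++ A) N' q' -> small X m' d' q' ->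
      forall z, Cmod z <= R0 -> dl * Cmod (prodl l z) <= Cmod (fadd (fadd f q) q' z - e).
Proof.
  intros HR He HI HN Hd.
  apply (complete_task X T (fun f z => (f z - e)%C) (fun f A z => node A z /\ f z = e) R0 HR); auto; clear f A N m d HI HN Hd.
  - intros f Hf. apply entire_minus. eapply inF_entire; eauto. apply entire_const.
  - intros f R1 eps Hf Heps. destruct (small_uniform X R1 eps Heps) as [m [d [Hd H]]]. exists m, d. split; auto.
    intros q Hq Hs z Hz. unfold fadd. replace (f z + q z - e - (f z - e))%C with (q z) by ring. now apply H.
  (* f(0) and f(1) differ, so at least one of them is not e. *)
  - intros f A HI. destruct (Ceq_dec (f (RtoC 0)) e) as [E|NE].
    + exists (RtoC 1). rewrite Cmod_1. split. lra. apply Cminus_eq_contra. rewrite <- E.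
      destruct HI as [_ [H _]]. congruence.
    + exists (RtoC 0). rewrite Cmod_0. split. lra. now apply Cminus_eq_contra.
  - intros f A z [_ ->]. ring.
  - intros f A N q B z HI HN Hq [H1 H2]. split. apply node_app; auto.
    destruct (vanishing_agree X f A N q z) as [-> _]; auto. apply HI.
  - intros f A N m d HI HN Hd.
    destruct (classic (exists z, Cmod z <= R0 /\ f z = e /\ ~ node A z)) as [[z [Z1 [Z2 Z3]]]|Hno].
    + destruct (pin_preimage X T f A N e z m d HI HN He Hd Z2 Z3) as [q [w [V [S1 [I1 [W1 [W2 W3]]]]]]].
      exists q, (w :: nil). split; auto. split; auto. split; auto. right. exists w. split; [|split].
      * pose proof (Cmod_triangle (w - z) z). replace (w - z + z)%C with w in H by ring. lra.
      * split; auto. apply node_self. now left.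
      * intros [H _]. auto.
    + exists fzero, nil. split. apply vanishing_zero. split. now apply small_zero. rewrite fadd_zero. split; auto.
      left. intros z Hz E. apply (proj2 (Ceq_minus _ _)) in E. split; auto. apply NNPP. intros Hn. apply Hno. eauto.
  - intros f A l u HI Hu E Hl. exists (length l). intros q [c Hc].
    destruct (qa_power_divisible A l) as [v [Hv Ev]]. { intros; now apply Hl. }
    exists (fun z => v z * ev c z)%C. split. apply entire_mult; auto. apply entire_ev.
    intros z. unfold fadd. rewrite Hc, Ev. ring.
Qed.

Lemma iter_close f n R1 eps : inF X f -> 0 < eps ->
  exists m d, 0 < d /\ forall q, inF X q -> small X m d q ->
    forall z, Cmod z <= R1 -> Cmod (Nat.iter n (fadd f q) z - Nat.iter n f z) < eps.
Proof.
  intros Hf. revert eps. induction n; intros eps He.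
  - exists O, 1. split. lra. intros. simpl. rewrite Cmod_self. exact He.
  - destruct (disc_bounded (Nat.iter n f) R1) as [R2 [HR2 B2]].
    { intros z. apply entire_ccont, entire_iter. eapply inF_entire; eauto. }
    destruct (disc_uniform f R2 (eps / 2)) as [de [Hde Hu]]. { intros z. eapply entire_ccont, inF_entire; eauto. } lra.
    destruct (IHn (Rmin de 1)) as [m1 [d1 [Hd1 H1]]]. apply Rmin_pos; lra.
    destruct (small_uniform X (R2 + 1) (eps / 2)) as [m2 [d2 [Hd2 H2]]]. lra.
    destruct (small_meet X m1 d1 m2 d2 Hd1 Hd2) as [m [d [Hd Hm]]].
    exists m, d. split; auto. intros q Hq Hs z Hz. destruct (Hm q Hs) as [S1 S2].
    specialize (H1 q Hq S1 z Hz). specialize (B2 z Hz). simpl.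
    set (y' := Nat.iter n (fadd f q) z) in *. set (y := Nat.iter n f z) in *.
    pose proof (Rmin_l de 1). pose proof (Rmin_r de 1).
    assert (Hy' : Cmod y' <= R2 + 1).
    { pose proof (Cmod_triangle (y' - y) y). replace (y' - y + y)%C with y' in H3 by ring. lra. }
    assert (K1 : Cmod (q y') < eps / 2) by (apply H2; auto).
    assert (K2 : Cmod (f y' - f y) < eps / 2) by (apply Hu; auto; lra).
    unfold fadd at 1. replace (f y' + q y' - f y)%C with ((f y' - f y) + q y')%C by ring.
    eapply Rle_lt_trans. apply Cmod_triangle. lra.
Qed.

(** A repeated root would make the derivative vanish. Without repetitions, vanishing at the roots
    already implies divisibility by their product. *)
Lemma nodup_of_simple_zeros h l u : entire u -> (forall z, h z = (prodl l z * u z)%C) ->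
  (forall a, In a l -> ~ cder h a (RtoC 0)) -> NoDup l.
Proof.
  revert u. induction l as [|a l IH]; intros u Hu E Hd; constructor.
  - intros Hin. apply (Hd a). now left.
    assert (Hr : entire (fun z => prodl l z * u z)%C) by (apply entire_mult; auto; apply entire_prodl).
    destruct (proj1 (entire_cdiff _) Hr a) as [k Hk].
    apply (cder_ext (fun z => (z - a) * (prodl l z * u z))%C). { intros z. rewrite E. simpl. ring. }
    replace (RtoC 0) with ((1 - 0) * (prodl l a * u a) + (a - a) * k)%C.
    + apply (cder_mult (fun z => z - a)%C (fun z => prodl l z * u z)%C); auto.
      apply (cder_minus (fun z => z) (fun _ => a)). apply cder_id. apply cder_const.
    + apply prodl_zero in Hin. rewrite Hin. ring.
  - apply (IH (fun z => (z - a) * u z)%C).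
    + apply (entire_mult (fun z => z - a)%C); auto. apply entire_minus. apply entire_id. apply entire_const.
    + intros z. rewrite E. simpl. ring.
    + intros b Hb. apply Hd. now right.
Qed.

Lemma pow_eq_1 x k : 0 <= x -> (1 <= k)%nat -> x ^ k = 1 -> x = 1.
Proof.
  intros Hx Hk H. destruct (Rtotal_order x 1) as [L|[E|G]]; auto; exfalso.
  - destruct k; [lia|]. simpl in H. assert (x ^ k <= 1) by (rewrite <- (pow1 k); apply pow_incr; lra).
    pose proof (pow_le x k Hx). nra.
  - destruct k; [lia|]. simpl in H. assert (1 <= x ^ k) by (apply pow_R1_Rle; lra). nra.
Qed.

Lemma exact_period_exists (f : CC -> CC) n z : (1 <= n)%nat -> Nat.iter n f z = z ->
  exists m k, exact_period f m z /\ n = (k * m)%nat.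
Proof.
  intros Hn Hz. destruct (least_nat (fun m => (1 <= m)%nat /\ Nat.iter m f z = z)) as [m [[M1 M2] M3]]. { eauto. }
  exists m, (n / m)%nat. split.
  - repeat split; auto. intros j J1 J2 E. apply (M3 j); auto.
  - pose proof (Nat.div_mod_eq n m) as E. destruct (n mod m)%nat eqn:Er; [lia|].
    exfalso. apply (M3 (n mod m)%nat). pose proof (Nat.mod_upper_bound n m). lia.
    split. lia. rewrite <- (iter_mod f m z n); auto.
Qed.

(** n is a multiple of the exact period, so the derivative is a power of the multiplier. A root of
    unity would pass the test of being different from 1 and fail here; a modulus different from 1
    survives powers. *)
Lemma periodic_node_multiplier f A n a : Inv X T f A -> (1 <= n)%nat -> Nat.iter n f a = a ->
  (forall j, node A (Nat.iter j f a)) -> Cmod (iter_deriv f n a) <> 1.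
Proof.
  intros HI Hn Ha Hj. destruct (exact_period_exists f n a Hn Ha) as [m [k [Hm Ek]]].
  destruct HI as [_ [_ [_ HC]]]. destruct (HC a m Hm Hj) as [_ HL].
  destruct Hm as [M1 [M2 M3]]. rewrite Ek, iter_deriv_power, Cmod_pow by assumption.
  intros E. apply HL. apply (pow_eq_1 _ k); auto using Cmod_ge_0. nia.
Qed.

Lemma cycle_task f A N m d n R0 : 1 <= R0 -> (1 <= n)%nat -> Inv X T f A -> (2 <= N)%nat -> 0 < d ->
  exists q B N' m' d' l dl, vanishing A N q /\ small X m d q /\ Inv X T (fadd f q) (B ++ A) /\
    (N <= N')%nat /\ 0 < d' /\ 0 < dl /\
    (forall a, In a l -> Nat.iter n (fadd f q) a = a /\ forall j, node (B ++ A) (Nat.iter j (fadd f q) a)) /\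
    forall q', vanishing (B ++ A) N' q' -> small X m' d' q' ->
      forall z, Cmod z <= R0 -> dl * Cmod (prodl l z) <= Cmod (Nat.iter n (fadd (fadd f q) q') z - z).
Proof.
  intros HR Hn HI HN Hd.
  assert (Hstab : forall f A N q B z, Inv X T f A -> (2 <= N)%nat -> vanishing A N q ->
    Nat.iter n f z = z /\ (forall j, node A (Nat.iter j f z)) ->
    Nat.iter n (fadd f q) z = z /\ forall j, node (B ++ A) (Nat.iter j (fadd f q) z)).
  { clear. intros f A N q B z HI HN Hq [H1 H2].
    assert (HF : forall j, Nat.iter j (fadd f q) z = Nat.iter j f z).
    { intros j. destruct (frozen_orbit X f A N q z j) as [F _]; auto. apply HI. }
    split. now rewrite HF. intros j. rewrite HF. apply node_app. auto. }
  assert (Hent : forall f, inF X f -> entire (fun z => Nat.iter n f z - z)%C).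
  { intros g Hg. apply entire_minus. eapply entire_iter, inF_entire; eauto. apply entire_id. }
  apply (complete_task X T (fun f z => (Nat.iter n f z - z)%C)
    (fun f A z => Nat.iter n f z = z /\ forall j, node A (Nat.iter j f z)) R0 HR); auto; clear f A N m d HI HN Hd.
  - intros f R1 eps Hf Heps. destruct (iter_close f n R1 eps Hf Heps) as [m [d [Hd H]]]. exists m, d. split; auto.
    intros q Hq Hs z Hz.
    replace (Nat.iter n (fadd f q) z - z - (Nat.iter n f z - z))%C with (Nat.iter n (fadd f q) z - Nat.iter n f z)%C by ring.
    now apply H.
  - intros f A HI. assert (Hf : inF X f) by apply HI. assert (Hev := inF_even _ _ Hf).
    (* If the iterate fixes 1, it sends -1, which has the same image under f, to 1 as well, and so
       does not fix -1. *)
    destruct (Ceq_dec (Nat.iter n f (RtoC 1)) (RtoC 1)) as [E|NE].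
    + exists (- RtoC 1)%C. rewrite Cmod_opp, Cmod_1. split. lra.
      assert (E2 : Nat.iter n f (- RtoC 1)%C = RtoC 1).
      { destruct n as [|n']; [lia|]. rewrite iter_S_inside, Hev, <- iter_S_inside. exact E. }
      rewrite E2. apply Cminus_eq_contra. intros H. apply (f_equal Re) in H. simpl in H. lra.
    + exists (RtoC 1). rewrite Cmod_1. split. lra. now apply Cminus_eq_contra.
  - intros f A z [-> _]. ring.
  - intros f A N m d HI HN Hd.
    (* Afterwards a periodic orbit of period n lies in the nodes entirely or not at all, so no
       pinned point is on a cycle that has to be moved. *)
    destruct (separate_nodes X T f A N n m (d / 2)) as [q1 [V1 [S1 [I1 Hsep]]]]; auto. lra.
    assert (Hq1 : inF X q1) by (eapply vanishing_inF; eauto).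
    destruct (classic (exists z, Cmod z <= R0 /\ Nat.iter n (fadd f q1) z = z /\ exists j, ~ node A (Nat.iter j (fadd f q1) z)))
      as [[z [Z1 [Z2 Z3]]]|Hno].
    + destruct (pin_cycle X T (fadd f q1) A N n z m (d / 2)) as [q2 [B [w [V2 [S2 [I2 [W1 [W2 [W3 W4]]]]]]]]]; auto. lra.
      assert (Hq2 : inF X q2) by (eapply vanishing_inF; eauto).
      exists (fadd q1 q2), B. rewrite <- fadd_assoc. split. now apply vanishing_add. split.
      { replace d with (d / 2 + d / 2) by lra. now apply small_add. }
      split; auto. right. exists w. split; [|split].
      * pose proof (Cmod_triangle (w - z) z). replace (w - z + z)%C with w in H by ring. lra.
      * split; auto.
      * intros [_ H]. apply W4. apply (H O).
    + exists q1, nil. split; auto. split. { eapply small_mono; [apply Nat.le_refl| |exact S1]. lra. }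
      split; auto. left. intros z Hz E. apply (proj2 (Ceq_minus _ _)) in E. split; auto.
      intros j. apply NNPP. intros Hnj. apply Hno. exists z. eauto.
  - intros f A l u HI Hu E Hl. assert (Hf : inF X f) by apply HI.
    (* Order 2 suffices whatever [l] is: its points have multipliers different from 1, so [l] has no
       repetitions, and the change of f^n - id only has to vanish there. *)
    exists 2%nat. intros q Hq. assert (HqF : inF X q) by (eapply vanishing_inF; eauto).
    destruct (divide_distinct (fun z => (Nat.iter n (fadd f q) z - z) - (Nat.iter n f z - z))%C l) as [v [Hv Ev]].
    + apply (entire_minus (fun z => Nat.iter n (fadd f q) z - z)%C (fun z => Nat.iter n f z - z)%C); apply Hent; auto.
      now apply inF_add.
    + apply (nodup_of_simple_zeros _ l u Hu E). intros a Ha Hc. destruct (Hl a Ha) as [L1 L2].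
      apply (periodic_node_multiplier f A n a HI Hn L1 L2).
      assert (Hc2 : cder (fun z => Nat.iter n f z - z)%C a (iter_deriv f n a - 1)).
      { apply (cder_minus (Nat.iter n f) (fun z => z)). apply iter_deriv_correct. eapply inF_entire; eauto. apply cder_id. }
      pose proof (cder_unique _ _ _ _ Hc Hc2) as E0.
      replace (iter_deriv f n a) with ((iter_deriv f n a - 1) + 1)%C by ring. rewrite <- E0.
      replace (0 + 1)%C with (RtoC 1) by ring. apply Cmod_1.
    + intros a Ha. destruct (Hl a Ha) as [L1 L2].
      destruct (Hstab f A 2%nat q nil a HI (Nat.le_refl 2) Hq (conj L1 L2)) as [-> _]. rewrite L1. ring.
    + exists v. split; auto.
Qed.

End Instances.

(** * The limit *)

(* Current map and nodes, the order to which later perturbations vanish at the nodes, and the number of seminorms and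
   the bound to which the sum of all later perturbations is kept. *)
Record stage := Stage {
  sf : CC -> CC; sA : list CC; sN : nat; sn : nat; sd : R }.

Section Final.
Variable X : space.
Variable T : targets.

Definition stage_ok (s : stage) : Prop := Inv X T (sf s) (sA s) /\ (2 <= sN s)%nat /\ 0 < sd s.

Definition stage_next (s s' : stage) : Prop :=
  stage_ok s' /\ (exists q, sf s' = fadd (sf s) q /\ vanishing (sA s) (sN s) q /\ small X (sn s) (sd s / 2) q) /\
  (exists B, sA s' = B ++ sA s) /\ (sN s <= sN s')%nat /\ (S (sn s) <= sn s')%nat /\ sd s' <= sd s / 2.

Definition future (s : stage) (q : CC -> CC) : Prop := vanishing (sA s) (sN s) q /\ small X (sn s) (sd s) q.

Definition node_goal (e : CC) (s : stage) : Prop := tE T e -> node (sA s) e.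

Definition preimage_goal (e : CC) (R0 : R) (s : stage) : Prop := tE T e ->
  exists l dl, 0 < dl /\ (forall a, In a l -> node (sA s) a) /\
  forall q, future s q -> forall z, Cmod z <= R0 -> dl * Cmod (prodl l z) <= Cmod (fadd (sf s) q z - e).

Definition cycle_goal (n : nat) (R0 : R) (s : stage) : Prop :=
  exists l dl, 0 < dl /\ (forall a j, In a l -> node (sA s) (Nat.iter j (sf s) a)) /\
  forall q, future s q -> forall z, Cmod z <= R0 -> dl * Cmod (prodl l z) <= Cmod (Nat.iter n (fadd (sf s) q) z - z).

(** Cantor unpairing runs through all triples (a, x, y): the kind of requirement, the index of a
    point of E or the period S x, and the radius y + 1. A triple need not recur, since a goal met
    once binds all [future] perturbations. *)
Definition goal (enum : nat -> CC) (j : nat) (s : stage) : Prop :=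
  let (a, b) := of_nat j in let (x, y) := of_nat b in
  match a with
  | O => node_goal (enum x) s
  | 1%nat => preimage_goal (enum x) (INR y + 1) s
  | _ => cycle_goal (S x) (INR y + 1) s
  end.

(** q takes half of [sd] and later perturbations get at most the other half, so their total stays
    within [sd]. The seminorm index grows at each stage, so every seminorm is eventually
    controlled. *)
Lemma stage_keep s m' d' q B N' : stage_ok s -> 0 < d' -> vanishing (sA s) (sN s) q -> small X (sn s) (sd s / 2) q ->
  Inv X T (fadd (sf s) q) (B ++ sA s) -> (sN s <= N')%nat ->
  let s' := Stage (fadd (sf s) q) (B ++ sA s) N' (Nat.max (S (sn s)) m') (Rmin (sd s / 2) d') in
  stage_next s s' /\ forall q', future s' q' -> vanishing (B ++ sA s) N' q' /\ small X m' d' q'.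
Proof.
  intros [H1 [H2 H3]] Hd V S1 I HN s'. unfold s'; clear s'. split.
  - split; [|split; [|split; [|split; [|split]]]]; cbn [sf sA sN sn sd].
    + split; [exact I|]. split; simpl. lia. apply Rmin_pos; lra.
    + exists q. auto.
    + exists B. reflexivity.
    + exact HN.
    + lia.
    + apply Rmin_l.
  - intros q' [V' S']. cbn [sf sA sN sn sd] in *. split; auto. eapply small_mono; [| |exact S']. lia. apply Rmin_r.
Qed.

Lemma stage_step enum j s : stage_ok s -> exists s', stage_next s s' /\ goal enum j s'.
Proof.
  intros Hs. assert (H := Hs). destruct H as [H1 [H2 H3]]. unfold goal.
  destruct (of_nat j) as [a b]. destruct (of_nat b) as [x y].
  assert (Hd : 0 < sd s / 2) by lra.
  assert (HR : 1 <= INR y + 1) by (pose proof (pos_INR y); lra).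
  assert (Triv : exists s', stage_next s s').
  { eexists. apply (stage_keep s O 1 fzero nil (sN s)); auto. lra. apply vanishing_zero. now apply small_zero. now rewrite fadd_zero. }
  destruct a as [|[|a]].
  - destruct (classic (tE T (enum x))) as [He|He].
    + destruct (make_node X T (sf s) (sA s) (sN s) (enum x) (sn s) (sd s / 2) H1 H2 He Hd) as [q [B [V [S1 [I Hn]]]]].
      destruct (stage_keep s O 1 q B (sN s) Hs Rlt_0_1 V S1 I (le_n _)) as [Hnext _].
      eexists. split. exact Hnext. intros _. exact Hn.
    + destruct Triv as [s' Hs']. exists s'. split; auto. intros H. contradiction.
  - destruct (classic (tE T (enum x))) as [He|He].
    + destruct (preimage_task X T (sf s) (sA s) (sN s) (sn s) (sd s / 2) (enum x) (INR y + 1) HR He H1 H2 Hd)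
        as [q [B [N' [m' [d' [l [dl [V [S1 [I [HN [Hd' [Hdl [Hl Hq]]]]]]]]]]]]]].
      destruct (stage_keep s m' d' q B N' Hs Hd' V S1 I HN) as [Hnext Hfut].
      eexists. split. exact Hnext. intros _. exists l, dl. split; auto. split. { intros; now apply Hl. }
      intros q' Hq' z Hz. destruct (Hfut q' Hq'). now apply Hq.
    + destruct Triv as [s' Hs']. exists s'. split; auto. intros H. contradiction.
  - destruct (cycle_task X T (sf s) (sA s) (sN s) (sn s) (sd s / 2) (S x) (INR y + 1) HR ltac:(lia) H1 H2 Hd)
      as [q [B [N' [m' [d' [l [dl [V [S1 [I [HN [Hd' [Hdl [Hl Hq]]]]]]]]]]]]]].
    destruct (stage_keep s m' d' q B N' Hs Hd' V S1 I HN) as [Hnext Hfut].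
    eexists. split. exact Hnext. exists l, dl. split; auto. split. { intros a0 i Ha. now apply Hl. }
    intros q' Hq' z Hz. destruct (Hfut q' Hq'). now apply Hq.
Qed.

Lemma stage_sequence enum s0 : stage_ok s0 ->
  exists st : nat -> stage, st O = s0 /\ forall j, stage_next (st j) (st (S j)) /\ goal enum j (st (S j)).
Proof.
  intros H0.
  destruct (choice (fun (p : nat * stage) s' => stage_ok (snd p) -> stage_next (snd p) s' /\ goal enum (fst p) s')) as [g Hg].
  { intros [j s]. simpl. destruct (classic (stage_ok s)) as [H|H].
    - destruct (stage_step enum j s H) as [s' Hs']. exists s'. auto.
    - exists s. intros; contradiction. }
  set (st := fix st j := match j with O => s0 | S i => g (i, st i) end).
  exists st. split; auto.
  assert (Hok : forall j, stage_ok (st j)).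
  { induction j; auto. destruct (Hg (j, st j) IHj) as [[H _] _]. exact H. }
  intros j. apply (Hg (j, st j)). apply Hok.
Qed.

Section Limit.
Variable enum : nat -> CC.
Variable st : nat -> stage.
Hypothesis H0 : stage_ok (st O).
Hypothesis Hst : forall j, stage_next (st j) (st (S j)) /\ goal enum j (st (S j)).

Lemma st_ok j : stage_ok (st j).
Proof. destruct j; auto. apply (Hst j). Qed.

Lemma st_inF j : inF X (sf (st j)).
Proof. apply (st_ok j). Qed.

Lemma st_sn j : (j <= sn (st j))%nat.
Proof. induction j. lia. destruct (Hst j) as [[_ [_ [_ [_ [H _]]]]] _]. lia. Qed.

Lemma st_sd j : sd (st j) <= sd (st O) * (/ 2) ^ j.
Proof.
  induction j. simpl. lra. destruct (Hst j) as [[_ [_ [_ [_ [_ H]]]]] _]. simpl. lra.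
Qed.

Lemma st_sd_small k eps : 0 < eps -> exists j, (k <= j)%nat /\ sd (st j) < eps.
Proof.
  intros He. assert (Hp : 0 < sd (st O)) by apply H0.
  destruct (pow_lt_1_zero (/ 2)) with (y := eps / sd (st O)) as [N HN].
  { rewrite Rabs_pos_eq; lra. } { now apply Rdiv_lt_0_compat. }
  exists (Nat.max k N). split. lia. specialize (HN (Nat.max k N) ltac:(lia)).
  rewrite Rabs_pos_eq in HN by (apply pow_le; lra).
  eapply Rle_lt_trans. apply st_sd. apply (Rmult_lt_compat_l (sd (st O))) in HN; auto.
  replace (sd (st O) * (eps / sd (st O))) with eps in HN by (field; lra). exact HN.
Qed.

Lemma sem_zero k : sem X k fzero = 0.
Proof.
  replace fzero with (fscal 0 fzero).
  - rewrite sem_scal. rewrite Rabs_R0. ring. apply (space_frechet X).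
  - apply functional_extensionality. intros z. unfold fscal, fzero. ring.
Qed.

Lemma st_future j i : exists q, sf (st (i + j)%nat) = fadd (sf (st j)) q /\ future (st j) q.
Proof.
  (* The difference of the bounds [sd] is what the induction carries: a step costs less than sd / 2,
     and [sd] drops by at least that much. *)
  assert (G : exists q B, sf (st (i + j)%nat) = fadd (sf (st j)) q /\ vanishing (sA (st j)) (sN (st j)) q /\
    sA (st (i + j)%nat) = B ++ sA (st j) /\ (sN (st j) <= sN (st (i + j)%nat))%nat /\ (sn (st j) <= sn (st (i + j)%nat))%nat /\
    forall k, (k <= sn (st j))%nat -> sem X k q <= sd (st j) - sd (st (i + j)%nat)).
  { induction i.
    - exists fzero, nil. simpl. rewrite fadd_zero. repeat split; auto. apply vanishing_zero.
      intros k _. rewrite sem_zero. lra.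
    - destruct IHi as [q [B [E [V [EA [EN [En S1]]]]]]].
      destruct (Hst (i + j)%nat) as [[_ [[q2 [E2 [V2 S2]]] [[B2 EA2] [EN2 [En2 Ed2]]]]] _].
      exists (fadd q q2), (B2 ++ B). simpl. rewrite E2, E, EA2, EA, fadd_assoc, app_assoc.
      assert (Vq2 : vanishing (sA (st j)) (sN (st j)) q2).
      { rewrite EA in V2. apply (vanishing_weaken _ B _ (sN (st (i + j)%nat))); auto. }
      repeat split; auto; try lia. now apply vanishing_add.
      intros k Hk. specialize (S1 k Hk). specialize (S2 k ltac:(lia)).
      pose proof (sem_add X k q q2 (vanishing_inF X _ _ _ V) (vanishing_inF X _ _ _ V2)). lra. }
  destruct G as [q [B [E [V [_ [_ [_ S1]]]]]]]. exists q. split; auto. split; auto.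
  intros k Hk. specialize (S1 k Hk). assert (0 < sd (st (i + j)%nat)) by apply st_ok. lra.
Qed.

Lemma st_limit : exists g, inF X g /\ forall n d, 0 < d -> exists N, forall j, (N <= j)%nat -> small X n d (fsub (sf (st j)) g).
Proof.
  destruct (space_frechet X) as [_ [_ [_ [_ [_ [_ [_ [_ Hcomp]]]]]]]].
  destruct (Hcomp (fun j => sf (st j))) as [g [Hg Hconv]].
  - intros j. apply st_inF.
  - intros k eps He. destruct (st_sd_small k (eps / 2)) as [N [HN1 HN2]]. lra.
    assert (Hk : forall i, (N <= i)%nat -> sem X k (fsub (sf (st i)) (sf (st N))) < eps / 2).
    { intros i Hi. destruct (st_future N (i - N)) as [q [E [V S1]]].
      replace (i - N + N)%nat with i in E by lia. rewrite E, fsub_fadd.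
      specialize (S1 k). pose proof (st_sn N). assert (sem X k q < sd (st N)) by (apply S1; lia). lra. }
    exists N. intros i j Hi Hj.
    replace (fsub (sf (st i)) (sf (st j))) with (fadd (fsub (sf (st i)) (sf (st N))) (fsub (sf (st N)) (sf (st j)))).
    2: { apply functional_extensionality. intros z. unfold fadd, fsub. ring. }
    eapply Rle_lt_trans. apply sem_add; apply inF_sub; apply st_inF.
    rewrite (sem_sub_sym X k (sf (st N))) by apply st_inF.
    specialize (Hk i Hi) as K1. specialize (Hk j Hj) as K2. lra.
  - exists g. split; auto. intros n d Hd. induction n as [|n [N1 IH]].
    + destruct (Hconv O d Hd) as [N HN]. exists N. intros j Hj k Hk. replace k with O by lia. auto.
    + destruct (Hconv (S n) d Hd) as [N HN]. exists (Nat.max N N1). intros j Hj k Hk.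
      destruct (Nat.eq_dec k (S n)) as [->|]. apply HN; lia. apply (IH j); lia.
Qed.

Variable g : CC -> CC.
Hypothesis Hg : inF X g.
Hypothesis Hlim : forall n d, 0 < d -> exists N, forall j, (N <= j)%nat -> small X n d (fsub (sf (st j)) g).

Lemma fadd_fsub f : fadd g (fsub f g) = f.
Proof. apply functional_extensionality. intros z. unfold fadd, fsub. ring. Qed.

Lemma limit_uniform r eps : 0 < eps -> exists N, forall j, (N <= j)%nat -> forall z, Cmod z <= r -> Cmod (sf (st j) z - g z) < eps.
Proof.
  intros He. destruct (small_uniform X r eps He) as [n [d [Hd H]]]. destruct (Hlim n d Hd) as [N HN].
  exists N. intros j Hj z Hz. apply (H (fsub (sf (st j)) g)); auto. apply inF_sub; auto. apply st_inF.
Qed.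

Lemma limit_value j z : node (sA (st j)) z -> g z = sf (st j) z.
Proof.
  intros Hz. apply NNPP. intros Hne. apply Cmod_pos_neq in Hne.
  destruct (limit_uniform (Cmod z) (Cmod (g z - sf (st j) z)) Hne) as [N HN].
  destruct (st_future j N) as [q [E [V _]]].
  specialize (HN (N + j)%nat ltac:(lia) z (Rle_refl _)). rewrite E in HN.
  destruct (vanishing_agree X (sf (st j)) (sA (st j)) (sN (st j)) q z) as [E1 _]; auto. apply st_inF. apply st_ok.
  rewrite E1, Cmod_minus_sym in HN. lra.
Qed.

Lemma limit_deriv j z : node (sA (st j)) z -> deriv g z = deriv (sf (st j)) z.
Proof.
  intros Hz. apply NNPP. intros Hne. apply Cmod_pos_neq in Hne.
  set (x := Cmod (deriv g z - deriv (sf (st j)) z)) in *.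
  (* [derivative_bound] loses a factor 4, so x / 8 leads to x <= x / 2. *)
  destruct (limit_uniform (Cmod z + 1) (x / 8)) as [N HN]. lra.
  destruct (st_future j N) as [q [E [V _]]].
  specialize (HN (N + j)%nat ltac:(lia)).
  destruct (vanishing_agree X (sf (st j)) (sA (st j)) (sN (st j)) q z) as [_ E1]; auto. apply st_inF. apply st_ok.
  rewrite <- E in E1.
  assert (x <= 4 * (x / 8)); [|lra].
  unfold x at 1. rewrite <- E1.
  apply (derivative_bound (fun w => g w - sf (st (N + j)%nat) w)%C z).
  - apply entire_minus; eapply inF_entire; eauto. apply st_inF.
  - apply (cder_minus g (sf (st (N + j)%nat))); apply deriv_correct; eapply inF_entire; eauto. apply st_inF.
  - intros w Hw. left. rewrite Cmod_minus_sym. apply HN.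
    pose proof (Cmod_triangle (w - z) z). replace (w - z + z)%C with w in H by ring. lra.
Qed.

Lemma limit_orbit j z : (forall i, node (sA (st j)) (Nat.iter i (sf (st j)) z)) ->
  (forall i, Nat.iter i g z = Nat.iter i (sf (st j)) z) /\ forall n, iter_deriv g n z = iter_deriv (sf (st j)) n z.
Proof.
  intros H. split.
  - intros i. apply (iter_agree (sf (st j)) g i z); auto. intros; now apply limit_value.
  - intros n. apply iter_deriv_agree; intros; [now apply limit_value|now apply limit_deriv].
Qed.

Lemma goal_reached a x y : exists j, of_nat j = (a, to_nat (x, y)) /\ of_nat (to_nat (x, y)) = (x, y).
Proof. exists (to_nat (a, to_nat (x, y))). split; apply cancel_of_to. Qed.

Lemma radius_reached z : exists y : nat, Cmod z <= INR y + 1.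
Proof.
  destruct (INR_unbounded (Cmod z)) as [y Hy]. exists y. lra.
Qed.

(** If z were not a root of the stage's product, all later maps would keep a fixed positive distance
    from g(z) at z, against convergence. The limit is reached through the stages only: it need not
    itself be a polynomial perturbation of one. *)
Lemma limit_E (Henum : forall z, tE T z -> exists n, enum n = z) z : tE T (g z) <-> tE T z.
Proof.
  split; intros Hz.
  - destruct (Henum _ Hz) as [x Hx]. destruct (radius_reached z) as [y Hy].
    destruct (goal_reached 1 x y) as [j [J1 J2]]. destruct (Hst j) as [_ G]. unfold goal in G. rewrite J1, J2, Hx in G.
    destruct (G Hz) as [l [dl [Hdl [Hl HG]]]].
    assert (Hin : In z l).
    { apply prodl_zero. apply NNPP. intros Hne.
      assert (Hp : 0 < Cmod (prodl l z)) by (apply -> Cmod_gt_0; exact Hne).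
      assert (Hpos : 0 < dl * Cmod (prodl l z)) by now apply Rmult_lt_0_compat.
      destruct (limit_uniform (Cmod z) _ Hpos) as [N HN].
      destruct (st_future (S j) N) as [q [E Hq]]. specialize (HG q Hq z Hy). rewrite <- E in HG.
      specialize (HN (N + S j)%nat ltac:(lia) z (Rle_refl _)). lra. }
    destruct (st_ok (S j)) as [[_ [_ [HA _]]] _]. apply (HA z). now apply Hl.
  - destruct (Henum _ Hz) as [x Hx].
    destruct (goal_reached 0 x 0) as [j [J1 J2]]. destruct (Hst j) as [_ G]. unfold goal in G. rewrite J1, J2, Hx in G.
    specialize (G Hz). rewrite (limit_value (S j)) by assumption.
    destruct (st_ok (S j)) as [[_ [_ [HA _]]] _]. now apply (HA z).
Qed.

Lemma limit_periodic n z : (1 <= n)%nat -> Nat.iter n g z = z ->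
  exists j, forall i, node (sA (st j)) (Nat.iter i (sf (st j)) z).
Proof.
  intros Hn Hz. destruct n as [|x]; [lia|]. destruct (radius_reached z) as [y Hy].
  destruct (goal_reached 2 x y) as [j [J1 J2]]. destruct (Hst j) as [_ G]. unfold goal in G. rewrite J1, J2 in G.
  destruct G as [l [dl [Hdl [Hl HG]]]].
  exists (S j). intros i. apply Hl. apply prodl_zero. apply NNPP. intros Hne.
  assert (Hp : 0 < Cmod (prodl l z)) by (apply -> Cmod_gt_0; exact Hne).
  assert (Hpos : 0 < dl * Cmod (prodl l z)) by now apply Rmult_lt_0_compat.
  (* Late stages are regarded as small perturbations of g, so their iterates at z converge to that
     of g, which is z. *)
  destruct (iter_close X g (S x) (Cmod z) _ Hg Hpos) as [m [d [Hd Hc]]].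
  destruct (Hlim m d Hd) as [N HN].
  destruct (st_future (S j) N) as [q [E Hq]]. specialize (HG q Hq z Hy). rewrite <- E in HG.
  specialize (HN (N + S j)%nat ltac:(lia)).
  specialize (Hc (fsub (sf (st (N + S j)%nat)) g)). rewrite fadd_fsub in Hc.
  pose proof (Hc (inF_sub X _ _ (st_inF _) Hg) HN z (Rle_refl _)) as HK.
  change (Nat.iter (S x) g z) with (g (Nat.iter x g z)) in HK. change (Nat.iter (S x) g z) with (g (Nat.iter x g z)) in Hz.
  rewrite Hz in HK. lra.
Qed.

Lemma limit_good (Henum : forall z, tE T z -> exists n, enum n = z) : good_map (tE T) (tL T) g.
Proof.
  split; [|split].
  - intros z. now apply limit_E.
  - intros z [n [Hn Hz]]. destruct (limit_periodic n z Hn Hz) as [j Hj].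
    destruct (st_ok j) as [[_ [_ [HA _]]] _]. apply (HA z). apply (Hj O).
  - intros n z [N1 [N2 N3]]. destruct (limit_periodic n z N1 N2) as [j Hj].
    destruct (limit_orbit j z Hj) as [L1 L2].
    exists (iter_deriv g n z). split.
    + apply cder_is_derive. apply iter_deriv_correct. eapply inF_entire; eauto.
    + rewrite L2. destruct (st_ok j) as [[_ [_ [_ HC]]] _]. apply HC; auto.
      split; auto. split. now rewrite <- L1. intros m M1 M2. rewrite <- L1. auto.
Qed.

End Limit.

(** Adding eta z^2 changes the value at 1 and not the one at 0. *)
Lemma separating_start f n d : inF X f -> 0 < d ->
  exists q, inF X q /\ small X n d q /\ fadd f q (RtoC 0) <> fadd f q (RtoC 1).
Proof.
  intros Hf Hd. destruct (Ceq_dec (f (RtoC 0)) (f (RtoC 1))) as [E|NE].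
  - destruct (small_coef X 2 n d Hd) as [eta [He H]].
    exists (ev (0 :: eta :: nil)). split. apply inF_ev. split.
    + apply H. simpl. lia. simpl. rewrite Rabs_R0, Rabs_pos_eq; lra.
    + unfold fadd. rewrite E. intros E2. apply (f_equal (fun u => Re (u - f (RtoC 1)))) in E2.
      unfold ev in E2. simpl in E2. lra.
  - exists fzero. split. apply (space_frechet X). split. now apply small_zero. now rewrite fadd_zero.
Qed.

Lemma good_maps_dense f n eps : inF X f -> 0 < eps ->
  exists g, inF X g /\ good_map (tE T) (tL T) g /\ small X n eps (fsub g f).
Proof.
  intros Hf He. destruct (tE_countable T) as [enum Henum].
  destruct (separating_start f n (eps / 4) Hf) as [q0 [Q1 [Q2 Q3]]]. lra.
  set (f0 := fadd f q0) in *. assert (Hf0 : inF X f0) by now apply inF_add.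
  (* Of eps, [q0] takes a quarter, all stages together a half, and the distance to the limit the
     last quarter. *)
  set (s0 := Stage f0 nil 2 n (eps / 2)).
  assert (Hs0 : stage_ok s0).
  { split; [|split; simpl; [lia|lra]]. split; [|split; [|split]]; simpl; auto.
    - intros z [a [[] _]].
    - intros z k _ Hk. destruct (Hk O) as [a [[] _]]. }
  destruct (stage_sequence enum s0 Hs0) as [st [E0 Hst]]. 
  assert (Hok0 : stage_ok (st O)) by (rewrite E0; exact Hs0).
  destruct (st_limit enum st Hok0 Hst) as [g [Hg Hlim]].
  exists g. split; auto. split.
  - now apply (limit_good enum st Hok0 Hst).
  - destruct (Hlim n (eps / 4)) as [N HN]. lra. specialize (HN N (Nat.le_refl N)).
    destruct (st_future enum st Hok0 Hst O N) as [q [E [V S1]]].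
    rewrite Nat.add_0_r, E0 in E. rewrite E0 in S1, V. simpl in E, S1, V.
    assert (Hq : inF X q) by (eapply vanishing_inF; eauto).
    assert (HfN : inF X (sf (st N))) by (rewrite E; now apply inF_add).
    intros k Hk. specialize (HN k Hk). specialize (S1 k Hk). specialize (Q2 k Hk).
    replace (fsub g f) with (fadd (fsub g (sf (st N))) (fadd q q0)).
    2: { rewrite E. apply functional_extensionality. intros z. unfold f0, fadd, fsub. ring. }
    pose proof (sem_add X k (fsub g (sf (st N))) (fadd q q0) (inF_sub X _ _ Hg HfN) (inF_add X _ _ Hq Q1)).
    pose proof (sem_add X k q q0 Hq Q1).
    rewrite (sem_sub_sym X k g) in H by assumption. lra.
Qed.

End Final.

Theorem theorem1p5
  (F : (CC -> CC) -> Prop) (p : nat -> (CC -> CC) -> R)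
  (E Lam : CC -> Prop) :
  (* (a) *)
  frechet_real_even_entire F p ->
  (forall c : list CC, real_map (poly_map c) -> even_map (poly_map c) ->
     F (poly_map c)) ->
  finer_than_local_uniform F p ->
  (* (b) *)
  countable_set E ->
  dense_in E whole_plane ->
  (forall z, E z -> E (Cconj z)) ->
  (forall z, E z -> E (Copp (Cconj z))) ->
  dense_in E real_union_imag ->
  (* (c) *)
  dense_in Lam whole_plane ->
  (forall z, Lam z -> Lam (Cconj z)) ->
  dense_in Lam real_line ->
  (* conclusion: the good maps are dense in F *)
  forall f, F f -> forall n eps, 0 < eps ->
    exists g, F g /\ good_map E Lam g /\
      forall k, (k <= n)%nat -> p k (fsub g f) < eps.
Proof.
  intros HF Hpoly Hfin HE1 HE2 HE3 HE4 HE5 HL1 HL2 HL3 f Hf n eps He.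
  exact (good_maps_dense (Space F p HF Hpoly Hfin)
    (Targets E Lam HE1 HE2 HE3 HE4 HE5 HL1 HL2 HL3) f n eps Hf He).
Qed.
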